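(* Let $d\ge1$, $\gamma\in(0,1)$, $\beta\in(0,\infty)$, let $\varphi$ be a profile function, and let $(G_t)_{t>0}$ be the age-based spatial preferential attachment network. For every continuous and bounded $g:[0,\infty)\to\mathbb{R}$, $$\frac1{|E(G_t)|}\sum_{(\mathbf{x},\mathbf{y})\in E(G_t)}g\big(t^{1/d}d_1(x,y)\big)=\int g\,d\lambda_t\longrightarrow\int g\,d\lambda$$ in probability, as $t\to\infty$, where the limiting probability measure $\lambda$ on $(0,\infty)$ is given by $$\lambda([a,b))=\frac{1-\gamma}{\beta}\int_0^1\int_0^u\int_{a\le|y|<b}\varphi\big(\beta^{-1}u^{1-\gamma}s^\gamma|y|^d\big)\,dy\,ds\,du .$$
   Context: A profile function is a nonincreasing integrable function $\varphi:[0,\infty)\to[0,1]$ with $\int_{\mathbb{R}^d}\varphi(|x|^d)\,dx=1$ ($|\cdot|$ Euclidean norm). Let $\mathbb{T}^d_1=(-\tfrac12,\tfrac12]^d$ with torus metric $d_1(x,y)=\min\{|x-y+v|: v\in\{-1,0,1\}^d\}$. The age-based spatial preferential attachment network $(G_t)_{t>0}$: vertices $(x,u)$ (position $x\in\mathbb{T}_1^d$, birth time $u>0$) arrive according to a standard (unit rate) Poisson process in time and are placed independently and uniformly on $\mathbb{T}^d_1$. The vertices of $G_t$ are those born in $(0,t]$. A vertex $(x,u)$, at its birth time $u$, is connected to each already existing vertex $(y,s)$, $s<u$, independently with probability $\varphi\big(\frac{u\,d_1(x,y)^d}{\beta\,(u/s)^\gamma}\big)$. $E(G_t)$ is the set of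 edges of $G_t$, each edge counted once and written $(\mathbf{x},\mathbf{y})$ with $\mathbf{x}=(x,u)$ younger than $\mathbf{y}=(y,s)$ ($s<u$). The rescaled empirical edge length distribution is $\lambda_t=\frac1{|E(G_t)|}\sum_{(\mathbf{x},\mathbf{y})\in E(G_t)}\delta_{t^{1/d}d_1(x,y)}$ (its value on the event $E(G_t)=\emptyset$ is irrelevant). In the formula for $\lambda$, $0\le a<b\le\infty$. *)

(* Defs.v *)
From HB Require Import structures.
From mathcomp Require Import all_boot all_order all_algebra finmap.
From mathcomp Require Import all_classical all_reals all_analysis.
Set Implicit Arguments.
Unset Strict Implicit.
Unset Printing Implicit Defensive.
Import Order.TTheory GRing.Theory Num.Theory.
Import numFieldNormedType.Exports.
Local Open Scope classical_set_scope.
Local Open Scope ring_scope.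

(* Points of R^d are d.-tuples, which carry the product sigma-algebra; row
   vectors are avoided because their library norm is the sup norm. *)
Definition enorm (R : realType) (d : nat) (x : d.-tuple R) : R :=
  Num.sqrt (\sum_(i < d) tnth x i ^+ 2).

Fixpoint lebesgue_tuple (R : realType) (d : nat) : set (d.-tuple R) -> \bar R :=
  match d with
  | 0 => \d_[tuple]
  | n.+1 => pushforward
      (product_measure1 (@lebesgue_measure R) (@lebesgue_tuple R n))
      (fun p : R * n.-tuple R => [tuple of p.1 :: p.2])
  end.

Definition torus (R : realType) (d : nat) : set (d.-tuple R) :=
  [set x | forall i, - 2^-1 < tnth x i <= 2^-1].

(* x - y + v, where v in {-1,0,1}^d is coded by v i = k i - 1. *)
Definition shifted_diff (R : realType) (d : nat) (x y : d.-tuple R)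
    (k : {ffun 'I_d -> 'I_3}) : d.-tuple R :=
  [tuple tnth x i - tnth y i + ((k i)%:R - 1) | i < d].

(* The seed of the iterated minimum is the term v = 0, hence it is one of the
   terms over which the minimum is taken. *)
Definition torus_dist (R : realType) (d : nat) (x y : d.-tuple R) : R :=
  \big[Num.min/enorm (shifted_diff x y [ffun=> 1])]_(k : {ffun 'I_d -> 'I_3})
    enorm (shifted_diff x y k).

(* Only the values of phi on [0, +oo[ matter. *)
Definition profile (R : realType) (d : nat) (phi : R -> R) : Prop :=
  [/\ forall r, 0 <= r -> 0 <= phi r <= 1,
      forall r s, 0 <= r -> r <= s -> phi s <= phi r,
      (@lebesgue_measure R).-integrable `[0, +oo[ (EFin \o phi) &
      (\int[@lebesgue_tuple R d]_x (phi (enorm x ^+ d))%:E = 1)%E].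

Definition sigma_of (dO dT : measure_display) (Omega : measurableType dO)
    (T : measurableType dT) (X : Omega -> T) : set_system Omega :=
  preimage_set_system setT X measurable.

Definition mutually_independent (dO : measure_display)
    (Omega : measurableType dO) (R : realType) (P : probability Omega R)
    (I : choiceType) (F : I -> set_system Omega) : Prop :=
  forall (J : {fset I}) (A : I -> set Omega),
    (forall i, i \in J -> F i (A i)) ->
    P (\bigcap_(i in [set` J]) A i) = (\prod_(i <- J) P (A i))%E.

(* Inter-arrival times of the increasing enumeration tau of the arrivals. *)
Definition gap (T : Type) (R : realType) (tau : nat -> T -> R) (n : nat)
    (w : T) : R :=
  if n is m.+1 then tau m.+1 w - tau m w else tau 0%N w.

Definition connection_prob (R : realType) (d : nat) (gamma beta : R)
    (phi : R -> R) (x : d.-tuple R) (u : R) (y : d.-tuple R) (s : R) : R :=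
  phi (u * torus_dist x y ^+ d / (beta * (u / s) `^ gamma)).

(* The n-th vertex is (pos n, birth n), and link p is the event that the younger
   vertex p.1 is connected, at its birth, to the older vertex p.2.  The births
   form a unit rate Poisson process, i.e. the gaps are independent Exp(1)
   variables.  The last field says that, conditionally on all the vertices, the
   events link p are independent with the prescribed probabilities: the
   conditional probability of a finite intersection is the product. *)
Record age_based_network (R : realType) (d : nat) (gamma beta : R)
    (phi : R -> R) (dO : measure_display) (Omega : measurableType dO)
    (P : probability Omega R) := AgeBasedNetwork {
  birth : nat -> {mfun Omega >-> R} ;
  pos : nat -> {mfun Omega >-> d.-tuple R} ;
  link : nat * nat -> set Omega ;
  vertex_sigma (i : nat + nat) : set_system Omega :=
    match i with
    | inl n => sigma_of (gap (fun k => birth k : Omega -> R) n)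
    | inr n => sigma_of (pos n)
    end ;
  gap_exponential : forall n (B : set R), measurable B ->
    P (gap (fun k => birth k : Omega -> R) n @^-1` B) = exponential_prob 1 B ;
  pos_uniform : forall n (B : set (d.-tuple R)), measurable B ->
    P (pos n @^-1` B) = lebesgue_tuple (B `&` @torus R d) ;
  vertices_independent : mutually_independent P vertex_sigma ;
  link_measurable : forall p, measurable (link p) ;
  link_conditional_law :
    forall (J : {fset nat * nat}) (A : set Omega),
      (forall p, p \in J -> (p.2 < p.1)%N) ->
      <<s \bigcup_i vertex_sigma i >> A ->
      P (A `&` \bigcap_(p in [set` J]) link p) =
      (\int[P]_(w in A)
         (\prod_(p <- J) connection_prob gamma beta phi
            (pos p.1 w) (birth p.1 w) (pos p.2 w) (birth p.2 w))%:E)%E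
}.

Section empirical_edge_lengths.
Context (R : realType) (d : nat) (gamma beta : R) (phi : R -> R)
  (dO : measure_display) (Omega : measurableType dO) (P : probability Omega R)
  (G : age_based_network d gamma beta phi P).

Definition vertices (t : R) (w : Omega) : set nat :=
  [set n | 0 < birth G n w <= t].

Definition edges (t : R) (w : Omega) : set (nat * nat) :=
  [set p | [/\ vertices t w p.1, vertices t w p.2,
               birth G p.2 w < birth G p.1 w & link G p w]].

(* G_t is almost surely finite; fset_set is empty on infinite sets. *)
Definition edge_fset (t : R) (w : Omega) : {fset nat * nat} :=
  fset_set (edges t w).

Definition rescaled_length (t : R) (w : Omega) (p : nat * nat) : R :=
  t `^ (d%:R^-1) * torus_dist (pos G p.1 w) (pos G p.2 w).

Definition empirical_average (g : R -> R) (t : R) (w : Omega) : R :=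
  (#|` edge_fset t w|%:R)^-1 *
  \sum_(p <- edge_fset t w) g (rescaled_length t w p).

Definition rescaled_lengths (t : R) (w : Omega) : seq R :=
  [seq rescaled_length t w p | p <- edge_fset t w].

(* The zero measure when there is no edge. *)
Definition empirical_measure (t : R) (w : Omega) : {measure set R -> \bar R} :=
  let l := rescaled_lengths t w in
  mscale ((size l)%:R^-1)%:nng (msum (fun k => \d_(l`_k)) (size l)).

End empirical_edge_lengths.

Definition limit_mass (R : realType) (d : nat) (gamma beta : R) (phi : R -> R)
    (a : R) (b : \bar R) : \bar R :=
  (((1 - gamma) / beta)%:E *
   \int[@lebesgue_measure R]_(u in `]0%R, 1%R[)
   \int[@lebesgue_measure R]_(s in `]0%R, u[)
   \int[@lebesgue_tuple R d]_(y in [set y | (a <= enorm y)%R /\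
                                            (enorm y)%:E < b])
     (phi (beta^-1 * u `^ (1 - gamma) * s `^ gamma * enorm y ^+ d)%R)%:E)%E.

Definition cvg_in_probability (R : realType) (dO : measure_display)
    (Omega : measurableType dO) (P : probability Omega R)
    (X : R -> Omega -> R) (l : R) : Prop :=
  forall eps : R, 0 < eps ->
    P [set w | eps < `|X t w - l|] @[t --> +oo] --> 0%E.

(* Main.v *)
(** Let T_n be the birth time of the n-th vertex and S_t(g) the sum of
    g (t^(1/d) d_1(x, y)) over the edges of G_t; adding a constant, g >= 0.
    Averaging over the position of one end, the translation invariance of the
    torus makes the contribution of a pair j < i depend on the births only: its
    conditional mean is h_t(T_i, T_j), the integral over the torus of
    phi (...|x|^d) g (t^(1/d) |x|).  Since T_n / n -> 1 almost surely (Chebyshev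
    along the squares and monotonicity), the sum of these conditional means,
    divided by t and rewritten as the integral of a step function of
    (u, s, y) = (i / t, j / t, t^(1/d) x), converges by dominated convergence to
    the integral of phi (beta^-1 u^(1-gamma) s^gamma |y|^d) g |y| over
    0 < s < u < 1.

    On the event that T_n >= c (n + 1) for all n, whose probability tends to 1
    with c -> 0, only t / c vertices matter, distinct pairs are conditionally
    uncorrelated and the pair (i, j) has second moment O(1 / (j + 1)).  Hence the
    variance of S_t(g) is O(t^(3/2)) = o(t^2), and S_t(g) / t has the same limit
    in probability.  The theorem is the quotient of the limits for g and for the
    constant 1. *)

Require Import Defs.
From HB Require Import structures.
From mathcomp Require Import all_boot all_order all_algebra finmap.
From mathcomp Require Import all_classical all_reals all_analysis.
From mathcomp Require Import measurable_realfun ring lra.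
Set Implicit Arguments.
Unset Strict Implicit.
Unset Printing Implicit Defensive.
Import Order.TTheory GRing.Theory Num.Theory.
Import numFieldNormedType.Exports.
Local Open Scope classical_set_scope.
Local Open Scope ring_scope.

(** * Lebesgue measure on tuples *)

(** Each edge weight is centred at its conditional mean given the births, not at a constant. With
    this random centring distinct pairs are uncorrelated even if they share a vertex, because one
    position stays free; the randomness of the births then enters only through their law of large
    numbers. The profile is merely monotone and may jump, so the step functions converge only off a
    null set. They live on an unbounded space of displacements, and the limit integrand loses its
    decay as the older birth time tends to 0. The bound T_n >= c (n + 1) yields a majorant of the
    same shape as the limit with worse constants, whose mass is finite because gamma < 1. It also
    yields the second moments: extending the torus integral to R^d and using the normalisation of
    the profile, the mean weight of a pair is at most M beta / T_j. For fixed c this event need not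
    have full probability, so t tends to infinity first and c to 0 afterwards. Keeping g nonnegative
    lets conditioning and changes of variables rest on Tonelli's theorem; signed integrands appear
    only where everything is bounded. *)

Definition tcons (R : realType) n (p : measurableTypeR R * n.-tuple R) :
    n.+1.-tuple R :=
  [tuple of p.1 :: p.2].

Lemma measurable_tcons (R : realType) n :
  measurable_fun setT (@tcons R n).
Proof.
exact: (@measurable_cons _ _ _ _ (fst : measurableTypeR R * n.-tuple R -> R)
  n snd (@measurable_fst _ _ _ _) (@measurable_snd _ _ _ _)).
Qed.

(** Both exhausting sequences are nondecreasing, so the rectangles with equal indices exhaust the
    product. Each recursion step on the dimension needs this, since Tonelli asks for sigma-finite
    factors. *)
Lemma product_measure1_sigma_finite d1 d2 (T1 : measurableType d1)
    (T2 : measurableType d2) (R : realType)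
    (m1 : {sigma_finite_measure set T1 -> \bar R})
    (m2 : {sigma_finite_measure set T2 -> \bar R}) :
  sigma_finite setT (product_measure1 m1 m2).
Proof.
have /sigma_finiteP[F [TF ndF Foo]] := sigma_finiteT m1.
have /sigma_finiteP[G [TG ndG Goo]] := sigma_finiteT m2.
exists (fun n => F n `*` G n).
  rewrite -setXTT TF TG predeqE => -[x y]; split.
    move=> [/= [n _ Fnx] [k _ Gky]]; exists (maxn n k) => //; split.
    - by move: x Fnx; exact/subsetPset/ndF/leq_maxl.
    - by move: y Gky; exact/subsetPset/ndG/leq_maxr.
  by move=> [n _ []/= ? ?]; split; exists n.
move=> k; have [? ?] := Foo k; have [? ?] := Goo k.
split; first exact: measurableX.
by rewrite product_measure1E// lte_mul_pinfty// ge0_fin_numE.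
Qed.

Section cons_measure.
Context (R : realType) (n : nat) (m : {sigma_finite_measure set (n.-tuple R) -> \bar R}).
Local Open Scope ereal_scope.

(** The successor step of [lebesgue_tuple] with an arbitrary sigma-finite measure on the tail, so
    that its instances exist before the induction on the dimension. *)
Definition cons_measure : set (n.+1.-tuple R) -> \bar R :=
  pushforward (product_measure1 (@lebesgue_measure R) m) (@tcons R n).

Let cm0 : cons_measure set0 = 0.
Proof. by rewrite /cons_measure /pushforward preimage_set0 measure0. Qed.

Let cm_ge0 A : 0 <= cons_measure A. Proof. by rewrite /cons_measure /pushforward measure_ge0. Qed.

Let cmM A : measurable A -> measurable (@tcons R n @^-1` A).
Proof. by move=> mA; rewrite -[X in measurable X]setTI; exact: measurable_tcons. Qed.

Let cm_sigma : semi_sigma_additive cons_measure.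
Proof.
move=> F mF tF mUF; rewrite /cons_measure /pushforward preimage_bigcup.
apply: measure_semi_sigma_additive.
- by move=> i; exact: cmM.
- apply/trivIsetP => /= i j _ _ ij; rewrite -preimage_setI.
  by move/trivIsetP : tF => /(_ _ _ _ _ ij) ->//; rewrite preimage_set0.
- by rewrite -preimage_bigcup; exact: cmM.
Qed.

HB.instance Definition _ := isMeasure.Build _ _ _ cons_measure cm0 cm_ge0 cm_sigma.

Let cm_sfin : sigma_finite setT cons_measure.
Proof.
have /sigma_finiteP[F [TF ndF Foo]] := product_measure1_sigma_finite (@lebesgue_measure R) m.
(* [tcons] is a bijection; the exhausting sets are transported by its inverse, head and tail. *)
exists (fun i => (fun x : n.+1.-tuple R => (thead x, [tuple of behead x])) @^-1` F i).
  by rewrite -preimage_bigcup -TF preimage_setT.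
move=> i; have [mF Fi] := Foo i; split.
  rewrite -[X in measurable X]setTI.
  have : measurable_fun setT (fun x : n.+1.-tuple R => (thead x, [tuple of behead x]) : measurableTypeR R * n.-tuple R).
    apply/measurable_fun_pairP; split.
      exact: (@measurable_tnth _ _ n.+1 ord0).
    exact: measurable_behead.
  by move/(_ measurableT _ mF).
rewrite /cons_measure /pushforward.
rewrite (_ : _ @^-1` _ = F i) //.
apply/seteqP; split => -[x v] /=; rewrite theadE.
  by congr (F i (_, _)); exact: val_inj.
by congr (F i (_, _)); exact: val_inj.
Qed.

HB.instance Definition _ := Measure_isSigmaFinite.Build _ _ _ cons_measure cm_sfin.

End cons_measure.

(** [lebesgue_tuple] is a recursive function with values in bare set functions. Equality with some
    sigma-finite measure goes through the induction, and the measure structure is then transferred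
    along that equality. *)
Lemma lebesgue_tuple_measure (R : realType) n :
  exists m : {sigma_finite_measure set (n.-tuple R) -> \bar R},
    @lebesgue_tuple R n = m.
Proof.
elim: n => [|n [m mE]] /=.
  by exists \d_[tuple].
exists (cons_measure m).
by rewrite mE.
Qed.

Section lebesgue_tuple_instance.
Context (R : realType) (n : nat).
Local Notation leb := (@lebesgue_tuple R n).
Local Open Scope ereal_scope.

Let l0 : leb set0 = 0.
Proof. by have [m ->] := lebesgue_tuple_measure R n; exact: measure0. Qed.
Let l_ge0 A : 0 <= leb A.
Proof. by have [m ->] := lebesgue_tuple_measure R n; exact: measure_ge0. Qed.
Let l_sigma : semi_sigma_additive leb.
Proof. by have [m ->] := lebesgue_tuple_measure R n; exact: measure_semi_sigma_additive. Qed.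
HB.instance Definition _ := isMeasure.Build _ _ _ leb l0 l_ge0 l_sigma.
Let l_fin : sigma_finite setT leb.
Proof. by have [m ->] := lebesgue_tuple_measure R n; exact: sigma_finiteT. Qed.
HB.instance Definition _ := Measure_isSigmaFinite.Build _ _ _ leb l_fin.
End lebesgue_tuple_instance.

Lemma integral_lebesgue_tupleS (R : realType) n (f : n.+1.-tuple R -> \bar R) :
  measurable_fun setT f -> (forall x, 0 <= f x)%E ->
  (\int[@lebesgue_tuple R n.+1]_x f x =
   \int[@lebesgue_measure R]_x \int[@lebesgue_tuple R n]_v f (tcons (x, v)))%E.
Proof.
move=> mf f0.
transitivity (\int[product_measure1 (@lebesgue_measure R) (@lebesgue_tuple R n)]_x
    (f \o @tcons R n) x)%E.
  rewrite -[RHS](@ge0_integral_pushforward _ _ _ _ R _ (@measurable_tcons R n)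
  (product_measure1 (@lebesgue_measure R) (@lebesgue_tuple R n)) setT f measurableT mf) //.
rewrite fubini_tonelli1 //.
  exact: measurableT_comp mf (@measurable_tcons R n).
by move=> x; exact: f0.
Qed.

Lemma integral_lebesgue_tuple0 (R : realType) (f : 0.-tuple R -> \bar R) :
  measurable_fun setT f ->
  (\int[@lebesgue_tuple R 0]_x f x = f [tuple])%E.
Proof. by move=> mf; rewrite integral_dirac //= diracT mul1e. Qed.

(** * Affine changes of variables *)

Section lebesgue_affine.
Context (R : realType).
Local Notation mu := (@lebesgue_measure R).

(** Lebesgue measure is determined by its values on half-open intervals, so the identity is checked
    only there; the same argument gives the scaling rule. *)
Lemma lebesgue_measure_shift (a : R) (A : set R) : measurable A ->
  pushforward mu (fun x => x + a : measurableTypeR R) A = mu A.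
Proof.
have mf : measurable_fun [set: measurableTypeR R] (fun x : measurableTypeR R => x + a : measurableTypeR R).
  exact: measurable_funD.
pose mf_ := isMeasurableFun.Build _ _ _ _ _ mf.
move=> mA; apply/esym/lebesgue_measure_unique => //= _ [[b c]] _ <-.
rewrite /pushforward.
have -> : (fun x => x + a) @^-1` `]b, c]%classic = `]b - a, c - a]%classic.
  by apply/seteqP; split=> x /=; rewrite !in_itv /= ltrBlDr lerBrDr.
rewrite !lebesgue_measure_itv /= !lte_fin ltrD2r.
by case: ifPn => // _; rewrite -!EFinB; congr EFin; ring.
Qed.

Lemma lebesgue_measure_scale (a : R) (A : set R) : 0 < a -> measurable A ->
  (a%:E * pushforward mu (fun x => (a * x)%R : measurableTypeR R) A = mu A)%E.
Proof.
move=> a0 mA.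
have mf : measurable_fun [set: measurableTypeR R] (fun x : measurableTypeR R => a * x : measurableTypeR R).
  exact: measurable_funM.
have a00 : 0 <= a by exact: ltW.
apply/esym.
rewrite (@lebesgue_measure_unique R (mscale (NngNum a00) (pushforward mu (fun x => (a * x)%R : measurableTypeR R)))) //.
move=> _ [[b c]] _ <-; rewrite /= /mscale /= /pushforward.
have -> : (fun x => a * x) @^-1` `]b, c]%classic = `]b / a, c / a]%classic.
  by apply/seteqP; split=> x /=; rewrite !in_itv /= ltr_pdivrMr // ler_pdivlMr // ![a * x]mulrC.
rewrite !lebesgue_measure_itv /= !lte_fin ltr_pM2r ?invr_gt0 //.
case: ifPn => _; last by rewrite mule0.
rewrite -!EFinB -EFinM; congr EFin.
by rewrite -mulrBl mulrC divfK ?gt_eqF.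
Qed.

Lemma ge0_integral_shift (a : R) (D : set R) (f : R -> \bar R) :
  measurable D -> measurable_fun D f -> (forall x, D x -> 0 <= f x)%E ->
  (\int[mu]_(x in (fun x => x + a)%R @^-1` D) f (x + a)%R = \int[mu]_(x in D) f x)%E.
Proof.
move=> mD mf f0.
have mh : measurable_fun [set: measurableTypeR R] (fun x : measurableTypeR R => x + a : measurableTypeR R).
  exact: measurable_funD.
have := @ge0_integral_pushforward _ _ _ _ R _ mh mu D f mD mf.
move=> <- //; last by move=> x /set_mem; exact: f0.
apply: eq_measure_integral => A mA AD; exact: lebesgue_measure_shift.
Qed.

Lemma ge0_integral_scale (a : R) (f : R -> \bar R) : 0 < a ->
  measurable_fun setT f -> (forall x, 0 <= f x)%E ->
  (\int[mu]_x f (a * x)%R = (a^-1)%:E * \int[mu]_x f x)%E.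
Proof.
move=> a0 mf f0.
have mh : measurable_fun [set: measurableTypeR R] (fun x : measurableTypeR R => a * x : measurableTypeR R).
  exact: measurable_funM.
have a00 : 0 <= a^-1 by rewrite invr_ge0 ltW.
have := @ge0_integral_pushforward _ _ _ _ R _ mh mu setT f measurableT mf (fun x _ => f0 x).
rewrite preimage_setT => /esym -> //.
rewrite -(@ge0_integral_mscale _ _ _ mu setT measurableT (NngNum a00) f) //.
apply: eq_measure_integral => A mA _; rewrite /= /mscale /=.
by rewrite -(lebesgue_measure_scale a0 mA) muleA -EFinM mulVf ?gt_eqF // mul1e.
Qed.
End lebesgue_affine.

(** * Euclidean norm and torus distance *)

Section euclidean.
Context (R : realType).

Lemma measurable_map_tuple n (h : R -> R) : measurable_fun setT h ->
  measurable_fun setT (map_tuple h : n.-tuple R -> n.-tuple R).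
Proof.
move=> mh; apply/measurable_fun_tnthP => i.
rewrite (_ : _ \o _ = h \o (fun x : n.-tuple R => tnth x i)).
  exact: measurableT_comp mh (measurable_tnth i).
by apply/funext => x /=; rewrite tnth_map.
Qed.

Lemma map_tcons n (h : R -> R) (x : R) (v : n.-tuple R) :
  map_tuple h (tcons (x, v)) = tcons (h x, map_tuple h v).
Proof. exact: val_inj. Qed.

Lemma measurable_enorm n : measurable_fun setT (@enorm R n).
Proof.
apply: (@measurableT_comp _ _ _ _ _ _ (@Num.sqrt R)).
  by apply: continuous_measurable_fun; exact: sqrt_continuous.
apply: measurable_sum => i; apply: measurable_funX.
exact: measurable_tnth.
Qed.

Lemma enorm_ge0 n (x : n.-tuple R) : 0 <= enorm x.
Proof. exact: sqrtr_ge0. Qed.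

Lemma enorm_map_scale n (c : R) (x : n.-tuple R) : 0 <= c ->
  enorm (map_tuple ( *%R c) x) = c * enorm x.
Proof.
move=> c0; rewrite /enorm; under eq_bigr do rewrite tnth_map exprMn.
by rewrite -mulr_sumr sqrtrM ?sqr_ge0 // sqrtr_sqr ger0_norm.
Qed.

Lemma ge0_integral_lebesgue_tuple_scale n (c : R) (f : n.-tuple R -> \bar R) :
  0 < c -> measurable_fun setT f -> (forall x, 0 <= f x)%E ->
  (\int[@lebesgue_tuple R n]_x f (map_tuple ( *%R c) x) =
   ((c^-1) ^+ n)%:E * \int[@lebesgue_tuple R n]_x f x)%E.
Proof.
move=> c0; elim: n f => [|n IH] f mf f0.
  rewrite !integral_lebesgue_tuple0 // ?mul1e.
    by congr f; exact: val_inj.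
  by apply: measurableT_comp mf _; apply: measurable_map_tuple; exact: measurable_funM.
have mc : measurable_fun setT ( *%R c) by exact: measurable_funM.
have mc1 : measurable_fun setT (fun r => f (map_tuple ( *%R c) r)).
  exact: measurableT_comp mf (measurable_map_tuple mc).
rewrite !integral_lebesgue_tupleS //.
have mft : measurable_fun setT (f \o @tcons R n).
  exact: measurableT_comp mf (@measurable_tcons R n).
have mG : measurable_fun setT (fun r => \int[@lebesgue_tuple R n]_v f (tcons (r, v)))%E.
  apply: (@measurable_fun_fubini_tonelli_F _ _ _ _ _ (@lebesgue_tuple R n) (f \o @tcons R n)) => //.
  by move=> x; exact: f0.
rewrite exprS.
under eq_integral => r _.
  under eq_integral do rewrite map_tcons.
  rewrite (IH (fun v => f (tcons (c * r, v)))) //; last first.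
    exact: (@measurable_fun_pair2 _ _ _ _ _ _ (f \o @tcons R n)).
  over.
rewrite /= ge0_integralZl //; last 3 first.
- by apply: (measurableT_comp mG); exact: mc.
- by move=> r _; exact: integral_ge0.
- by rewrite lee_fin exprn_ge0 // invr_ge0 ltW.
rewrite (@ge0_integral_scale R c (fun r => \int[@lebesgue_tuple R n]_v f (tcons (r, v))))%E //.
  by rewrite muleA mulrC EFinM.
by move=> r; exact: integral_ge0.
Qed.

(* On (-1/2, 1/2] the minimum over the shifts decouples: it is attained
   coordinatewise, where it is the distance on the circle. *)
Definition torus_coord (r s : R) : R := Num.min `|r - s| (1 - `|r - s|).

Definition torus_coords n (x y : n.-tuple R) : n.-tuple R :=
  [tuple torus_coord (tnth x i) (tnth y i) | i < n].

Lemma torus_coordC r s : torus_coord r s = torus_coord s r.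
Proof. by rewrite /torus_coord distrC. Qed.

Lemma torus_coord_ge0 (r s : R) : - 2^-1 < r <= 2^-1 -> - 2^-1 < s <= 2^-1 ->
  0 <= torus_coord r s.
Proof.
move=> /andP[r1 r2] /andP[s1 s2]; rewrite le_min normr_ge0 /= subr_ge0.
by rewrite ler_norml; lra.
Qed.

Lemma torus_coord_le (r s : R) (k : 'I_3) :
  - 2^-1 < r <= 2^-1 -> - 2^-1 < s <= 2^-1 ->
  torus_coord r s <= `|r - s + (k%:R - 1)|.
Proof.
move=> /andP[r1 r2] /andP[s1 s2].
rewrite /torus_coord ge_min; apply/orP.
have [rs|rs] := lerP 0 (r - s); rewrite ?(ger0_norm rs) ?(ltr0_norm rs);
  case: k => [[|[|[|//]]]] i /=.
- by right; rewrite ler_normr; apply/orP; right; lra.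
- by left; rewrite ler_normr; apply/orP; left; lra.
- by left; rewrite ler_normr; apply/orP; left; lra.
- by left; rewrite ler_normr; apply/orP; right; lra.
- by left; rewrite ler_normr; apply/orP; right; lra.
- by right; rewrite ler_normr; apply/orP; left; lra.
Qed.

Lemma torus_coord_attained (r s : R) :
  - 2^-1 < r <= 2^-1 -> - 2^-1 < s <= 2^-1 ->
  exists k : 'I_3, torus_coord r s = `|r - s + (k%:R - 1)|.
Proof.
move=> /andP[r1 r2] /andP[s1 s2]; rewrite /torus_coord minEle.
case: ifPn => [_|_].
  by exists (@Ordinal 3 1 isT); rewrite subrr addr0.
have [rs|rs] := lerP 0 (r - s).
  by exists (@Ordinal 3 0 isT); rewrite (ger0_norm rs) ler0_norm /=; lra.
exists (@Ordinal 3 2 isT); rewrite (ltr0_norm rs) ger0_norm /=; lra.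
Qed.

Lemma le_enorm n (x y : n.-tuple R) : (forall i, `|tnth x i| <= `|tnth y i|) ->
  enorm x <= enorm y.
Proof.
move=> xy; rewrite /enorm ler_wsqrtr // ler_sum // => i _.
by rewrite -[leLHS]real_normK ?num_real // -[leRHS]real_normK ?num_real // lerXn2r ?nnegrE.
Qed.

Lemma torus_distE n (x y : n.-tuple R) : torus x -> torus y ->
  torus_dist x y = enorm (torus_coords x y).
Proof.
move=> tx ty; apply/eqP; rewrite eq_le; apply/andP; split.
  pose k : {ffun 'I_n -> 'I_3} :=
    [ffun i => sval (cid (torus_coord_attained (tx i) (ty i)))].
  rewrite /torus_dist (bigD1 k) //= ge_min; apply/orP; left.
  apply: le_enorm => i; rewrite !tnth_mktuple.
  rewrite /k ffunE; case: cid => j /= <-.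
  exact: ler_norm.
have H k : enorm (torus_coords x y) <= enorm (shifted_diff x y k).
  apply: le_enorm => i; rewrite !tnth_mktuple.
  by rewrite ger0_norm ?torus_coord_ge0 ?torus_coord_le.
rewrite /torus_dist; elim/big_ind : _ => //.
by move=> a b ha hb; rewrite le_min ha hb.
Qed.

Lemma torus_distC n (x y : n.-tuple R) : torus x -> torus y ->
  torus_dist x y = torus_dist y x.
Proof.
move=> tx ty; rewrite !torus_distE //; congr enorm.
by apply: eq_from_tnth => i; rewrite !tnth_mktuple torus_coordC.
Qed.
End euclidean.

(** * Integration over the torus *)

Section torus_integral.
Context (R : realType).
Local Notation mu := (@lebesgue_measure R).
Local Notation TI := (`](- 2^-1 : R), 2^-1]%classic).

Lemma torus_tcons n (r : R) (v : n.-tuple R) :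
  torus (tcons (r, v)) <-> TI r /\ torus v.
Proof.
split=> [H|[rI tv] i].
  split; first by have := H ord0; rewrite /= in_itv.
  by move=> i; have := H (lift ord0 i); rewrite tnthS.
by case: (unliftP ord0 i) => [j|] ->; rewrite ?tnthS ?tnth0 //; move: rI; rewrite /= in_itv.
Qed.

Lemma measurable_torus {n} : measurable (@torus R n).
Proof.
rewrite (_ : @torus R n = \bigcap_(i in [set: 'I_n]) ((fun x : n.-tuple R => tnth x i) @^-1` TI)).
  apply: fin_bigcap_measurable => // i _; rewrite -[X in measurable X]setTI.
  by apply: (measurable_tnth i) => //; exact: measurable_itv.
apply/seteqP; split=> [x H i _|x H i]; first by have := H i; rewrite /= in_itv.
by have := H i I; rewrite /= in_itv.
Qed.

Lemma integral_torusS n (f : n.+1.-tuple R -> \bar R) :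
  measurable_fun setT f -> (forall x, 0 <= f x)%E ->
  (\int[@lebesgue_tuple R n.+1]_(x in @torus R n.+1) f x =
   \int[mu]_(r in TI) \int[@lebesgue_tuple R n]_(v in @torus R n) f (tcons (r, v)))%E.
Proof.
move=> mf f0; rewrite integral_mkcond integral_lebesgue_tupleS; last 2 first.
- by apply/(measurable_restrictT f (@measurable_torus n.+1)); exact: measurable_funTS.
- by move=> x; rewrite patchE; case: ifPn.
rewrite [RHS]integral_mkcond; apply: eq_integral => r _.
rewrite patchE; case: ifPn => [/set_mem rI|/negP rI].
  rewrite [RHS]integral_mkcond; apply: eq_integral => v _; rewrite !patchE.
  case: ifPn => [/set_mem/torus_tcons [_ tv]|/negP nt]; first by rewrite mem_set.
  case: ifPn => // /set_mem tv; exfalso; apply: nt; apply/mem_set/torus_tcons.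
  by split.
rewrite integral0_eq // => v _; rewrite patchE; case: ifPn => // /set_mem /torus_tcons [rI' _].
by exfalso; apply: rI; exact/mem_set.
Qed.

(** Translation invariance of the circle. For s >= 0 the distance is |r - s| on ]s - 1/2, 1/2] and
    |r + 1 - s| on ]-1/2, s - 1/2]. The two translations carry these pieces onto ]-1/2, 1/2 - s] and
    ]1/2 - s, 1/2], which tile the interval again, in the opposite order. For s < 0 the cut is at s
    + 1/2. *)
Lemma integral_torus_coord (s : R) (f : R -> \bar R) : TI s ->
  measurable_fun setT f -> (forall x, 0 <= f x)%E ->
  (\int[mu]_(r in TI) f (torus_coord r s) = \int[mu]_(r in TI) f `|r|%R)%E.
Proof.
rewrite /= in_itv /= => /andP[s1 s2] mf f0.
have mfn : measurable_fun setT (fun r : R => f `|r|%R) by exact: measurableT_comp mf _.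
have split_itv (a b c : R) (h : R -> \bar R) : a <= b -> b <= c ->
    measurable_fun setT h -> (forall x, 0 <= h x)%E ->
    (\int[mu]_(r in `]a, c]) h r =
     \int[mu]_(r in `]a, b]) h r + \int[mu]_(r in `]b, c]) h r)%E.
  move=> ab bc mh h0; rewrite -ge0_integral_setU //=.
  - congr (integral _ _ _).
    apply/seteqP; split=> x /=; rewrite !in_itv /=.
      by move=> /andP[x1 x2]; case: (leP x b) => xb; [left|right]; apply/andP.
    by case=> /andP[x1 x2]; apply/andP; split=> //; lra.
  - exact: measurable_funTS.
  - by apply: lt_disjoint => x y; rewrite !in_itv /= => /andP[_ xb] /andP[yb _]; lra.
have shift (a b c : R) : (\int[mu]_(r in `]a, b]) f `|r + c|%R =
    \int[mu]_(r in `](a + c)%R, (b + c)%R]) f `|r|%R)%E.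
  rewrite -(@ge0_integral_shift R c `](a + c)%R, (b + c)%R]%classic (fun r => f `|r|)%R) //.
    by congr (integral _ _ _); apply/seteqP; split=> x /=; rewrite !in_itv /= ltrD2r lerD2r.
  exact: measurable_funTS.
have mfc : measurable_fun setT (fun r : R => f (torus_coord r s)).
  apply: (measurableT_comp mf); apply: measurable_minr.
    by apply: measurableT_comp => //; exact: measurable_funB.
  by apply: measurable_funB => //; apply: measurableT_comp => //; exact: measurable_funB.
have [s0|s0] := leP 0 s.
  have h1 : - 2^-1 <= s - 2^-1 by lra.
  have h2 : s - 2^-1 <= 2^-1 by lra.
  have h3 : - 2^-1 <= 2^-1 - s by lra.
  have h4 : 2^-1 - s <= 2^-1 by lra.
  rewrite (split_itv _ _ _ _ h1 h2) // [RHS](split_itv _ _ _ _ h3 h4) //.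
  rewrite addeC; congr (_ + _)%E.
    transitivity (\int[mu]_(r in `](s - 2^-1)%R, 2^-1%R]) f `|r + - s|%R)%E; last first.
      by rewrite shift (_ : s - 2^-1 + - s = - 2^-1); last lra.
    apply: eq_integral => r /set_mem /=; rewrite in_itv /= => /andP[r1 r2].
    congr f; rewrite /torus_coord min_l //.
    by have [?|?] := leP 0 (r - s); [rewrite ger0_norm|rewrite ltr0_norm] => //; lra.
  transitivity (\int[mu]_(r in `](- 2^-1)%R, (s - 2^-1)%R]) f `|r + (1 - s)|%R)%E; last first.
    rewrite shift (_ : s - 2^-1 + (1 - s) = 2^-1); last lra.
    by rewrite (_ : - 2^-1 + (1 - s) = 2^-1 - s); last lra.
  apply: eq_integral => r /set_mem /=; rewrite in_itv /= => /andP[r1 r2].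
  congr f; rewrite /torus_coord (@ler0_norm _ (r - s)); last lra.
  by rewrite min_r; last lra; rewrite ger0_norm; lra.
have h1 : - 2^-1 <= s + 2^-1 by lra.
have h2 : s + 2^-1 <= 2^-1 by lra.
have h3 : - 2^-1 <= - 2^-1 - s by lra.
have h4 : - 2^-1 - s <= 2^-1 by lra.
rewrite (split_itv _ _ _ _ h1 h2) // [RHS](split_itv _ _ _ _ h3 h4) //.
rewrite addeC; congr (_ + _)%E.
  transitivity (\int[mu]_(r in `](s + 2^-1)%R, 2^-1%R]) f `|r + (- s - 1)|%R)%E; last first.
    rewrite shift (_ : s + 2^-1 + (- s - 1) = - 2^-1); last lra.
    by rewrite (_ : 2^-1 + (- s - 1) = - 2^-1 - s); last lra.
  apply: eq_integral => r /set_mem /=; rewrite in_itv /= => /andP[r1 r2].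
  congr f; rewrite /torus_coord (@ger0_norm _ (r - s)); last lra.
  by rewrite min_r; last lra; rewrite ler0_norm; lra.
transitivity (\int[mu]_(r in `](- 2^-1)%R, (s + 2^-1)%R]) f `|r + - s|%R)%E; last first.
  by rewrite shift (_ : s + 2^-1 + - s = 2^-1); last lra.
apply: eq_integral => r /set_mem /=; rewrite in_itv /= => /andP[r1 r2].
congr f; rewrite /torus_coord min_l //.
by have [?|?] := leP 0 (r - s); [rewrite ger0_norm|rewrite ltr0_norm] => //; lra.
Qed.

Lemma torus_coords_tcons n (x : R) (v : n.-tuple R) (y : n.+1.-tuple R) :
  torus_coords (tcons (x, v)) y =
  tcons (torus_coord x (thead y), torus_coords v [tuple of behead y]).
Proof.
case/tupleP: y => y0 y; rewrite theadE.
rewrite (_ : [tuple of behead [tuple of y0 :: y]] = y); last exact: val_inj.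
apply: eq_from_tnth => i; rewrite tnth_mktuple.
by case: (unliftP ord0 i) => [j|] ->; rewrite ?tnthS ?tnth0 // tnth_mktuple.
Qed.

Lemma measurable_torus_coords n (y : n.-tuple R) :
  measurable_fun setT (fun x : n.-tuple R => torus_coords x y).
Proof.
apply/measurable_fun_tnthP => i.
rewrite (_ : _ \o _ = (fun x : n.-tuple R => torus_coord (tnth x i) (tnth y i))); last first.
  by apply/funext => x /=; rewrite tnth_mktuple.
have mx : measurable_fun setT (fun x : n.-tuple R => tnth x i) by exact: measurable_tnth.
apply: measurable_minr.
  by apply: measurableT_comp => //; exact: measurable_funB.
by apply: measurable_funB => //; apply: measurableT_comp => //; exact: measurable_funB.
Qed.

(** The coordinates are treated one at a time, each by the invariance on the circle applied to the
    integral over the remaining ones. The absolute values left on the right disappear once [f]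
    depends on the norm only. *)
Lemma integral_torus_coords n (y : n.-tuple R) (f : n.-tuple R -> \bar R) :
  torus y -> measurable_fun setT f -> (forall x, 0 <= f x)%E ->
  (\int[@lebesgue_tuple R n]_(x in @torus R n) f (torus_coords x y) =
   \int[@lebesgue_tuple R n]_(x in @torus R n) f (map_tuple Num.norm x))%E.
Proof.
elim: n y f => [|n IH] y f ty mf f0.
  apply: eq_integral => x _; congr f; apply: eq_from_tnth; by case.
have mft : measurable_fun setT (f \o @tcons R n).
  exact: measurableT_comp mf (@measurable_tcons R n).
rewrite !integral_torusS //; last 2 first.
- by apply: measurableT_comp mf _; exact: measurable_map_tuple.
- by apply: measurableT_comp mf _; exact: measurable_torus_coords.
have [ty0 ty1] : TI (thead y) /\ torus [tuple of behead y].
  by apply/torus_tcons; move: ty; rewrite {1}(tuple_eta y).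
under eq_integral => r _.
  under eq_integral do rewrite torus_coords_tcons.
  rewrite (IH _ (fun v => f (tcons (torus_coord r (thead y), v)))) //; last first.
    exact: (@measurable_fun_pair2 _ _ _ _ _ _ (f \o @tcons R n)).
  over.
rewrite /=.
rewrite (@integral_torus_coord _ (fun r => \int[@lebesgue_tuple R n]_(v in @torus R n) f (tcons (r, map_tuple Num.norm v)))%E) //.
  by apply: eq_integral => r _; apply: eq_integral => v _; rewrite map_tcons.
- pose F (p : measurableTypeR R * n.-tuple R) :=
    (f (tcons (p.1, map_tuple Num.norm p.2)) * (\1_(@torus R n) p.2)%:E)%E.
  rewrite (_ : (fun r => _) = (fun r => \int[@lebesgue_tuple R n]_v F (r, v)))%E; last first.
    apply/funext => r; rewrite integral_mkcond; apply: eq_integral => v _.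
    by rewrite patchE /F indicE; case: ifPn => _; rewrite ?mule1 ?mule0.
  have F0 x : (0 <= F x)%E by rewrite /F mule_ge0 ?f0 // lee_fin.
  have mF : measurable_fun setT F.
    apply: emeasurable_funM.
      pose h (p : measurableTypeR R * n.-tuple R) := (p.1, map_tuple Num.norm p.2).
      apply: (measurableT_comp (g := h) mft); apply: measurable_fun_pair => //.
      by apply: measurableT_comp => //; exact: measurable_map_tuple.
    apply/measurable_EFinP.
    apply: (measurableT_comp (f := (\1_(@torus R n) : _ -> R)) (g := snd)) => //.
    exact: measurable_indic (@measurable_torus n).
  exact: (@measurable_fun_fubini_tonelli_F _ _ _ _ _ (@lebesgue_tuple R n) F mF F0).
- by move=> x; apply: integral_ge0 => v _; exact: f0.
Qed.

Lemma integral_torus_dist n (y : n.-tuple R) (f : R -> \bar R) :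
  torus y -> measurable_fun setT f -> (forall x, 0 <= f x)%E ->
  (\int[@lebesgue_tuple R n]_(x in @torus R n) f (torus_dist x y) =
   \int[@lebesgue_tuple R n]_(x in @torus R n) f (enorm x))%E.
Proof.
move=> ty mf f0.
transitivity (\int[@lebesgue_tuple R n]_(x in @torus R n) f (enorm (torus_coords x y)))%E.
  by apply: eq_integral => x /set_mem tx; rewrite torus_distE.
rewrite (@integral_torus_coords _ _ (fun x => f (enorm x))) //.
  apply: eq_integral => x _; congr f; apply/eqP; rewrite eq_le.
  by rewrite !le_enorm // => i; rewrite tnth_map normr_id.
exact: measurableT_comp mf (@measurable_enorm R n).
Qed.
End torus_integral.

(** The dilation of R^n by the n-th root of k multiplies |x|^n by k, and its Jacobian is k. *)
Lemma ge0_integral_enorm_scale (R : realType) n (k : R) (f : R -> \bar R) :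
  (0 < n)%N -> 0 < k ->
  measurable_fun setT f -> (forall x, 0 <= f x)%E ->
  (\int[@lebesgue_tuple R n]_x f (k * enorm x ^+ n)%R =
   (k^-1)%:E * \int[@lebesgue_tuple R n]_x f (enorm x ^+ n)%R)%E.
Proof.
move=> n0 k0 mf f0.
pose c := k `^ (n%:R^-1).
have c0 : 0 < c by exact: powR_gt0.
have ck : c ^+ n = k.
  by rewrite -powR_mulrn ?ltW // -powRrM mulVf ?powRr1 ?ltW // pnatr_eq0 -lt0n.
transitivity (\int[@lebesgue_tuple R n]_x (fun z => f (enorm z ^+ n)%R) (map_tuple ( *%R c) x))%E.
  by apply: eq_integral => x _ /=; rewrite enorm_map_scale ?ltW // exprMn ck.
rewrite (@ge0_integral_lebesgue_tuple_scale R n c (fun z => f (enorm z ^+ n)%R)) //.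
  by rewrite exprVn ck.
apply: (measurableT_comp mf); apply: measurable_funX; exact: measurable_enorm.
Qed.

(** * Integrals of powers *)

Section powR_integral.
Context (R : realType).
Local Notation mu := (@lebesgue_measure R).

Lemma continuous_powR_gt0 (p x : R) : 0 < x -> {for x, continuous (@powR R ^~ p)}.
Proof.
move=> x0; apply: differentiable_continuous; apply/derivable1_diffP.
by apply: derivable_powR; rewrite in_itv /= x0.
Qed.

(** The integrand is unbounded at 0, so the fundamental theorem is applied on compact intervals away
    from 0, followed by monotone convergence. *)
Lemma integral_powRN (g u : R) : 0 < g < 1 -> 0 < u ->
  (\int[mu]_(s in `]0%R, u[) (s `^ (- g))%:E = (u `^ (1 - g) / (1 - g))%:E)%E.
Proof.
move=> /andP[g0 g1] u0.
have g10 : 0 < 1 - g by rewrite subr_gt0.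
rewrite integral_itv_bndo_bndc; last first.
  by apply/measurable_EFinP; apply: measurable_funTS; exact: measurable_powR.
(* The shift by 2 keeps the left end point strictly below u for every n, including n = 0. *)
pose a (n : nat) : R := u / n.+2%:R.
have a0 n : 0 < a n by rewrite divr_gt0.
have au n : a n < u by rewrite ltr_pdivrMr // ltr_pMr // ltr1n.
pose F (x : R) := (1 - g)^-1 * x `^ (1 - g).
have FTC n : (\int[mu]_(s in `[a n, u]) (s `^ (- g))%:E = (F u)%:E - (F (a n))%:E)%E.
  have cF x : 0 < x -> {for x, continuous F}.
    by move=> x0; apply: continuousM; [exact: cvg_cst|exact: continuous_powR_gt0].
  apply: continuous_FTC2 => //.
  - apply: continuous_in_subspaceT => x; rewrite inE /= in_itv /= => /andP[x1 _].
    by apply: continuous_powR_gt0; exact: lt_le_trans x1.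
  - split.
    + move=> x; rewrite in_itv /= => /andP[x1 _].
      apply: derivableM; first exact: derivable_cst.
      by apply: derivable_powR; rewrite in_itv /= (lt_trans _ x1).
    + by apply: cvg_at_right_filter; exact: cF.
    + by apply: cvg_at_left_filter; exact: cF.
  - move=> x; rewrite in_itv /= => /andP[x1 _].
    have x0 : 0 < x by exact: lt_trans x1.
    rewrite /F derive1E deriveM //; last by apply: derivable_powR; rewrite in_itv /= x0.
    rewrite derive_cst scaler0 addr0 -derive1E powR_derive1 ?in_itv /= ?x0 //.
    rewrite /GRing.scale /= mulrA mulVf ?gt_eqF // mul1r; congr (_ `^ _); lra.
have -> : (\int[mu]_(s in `]0%R, u]) (s `^ (- g))%:E =
    \int[mu]_(s in \bigcup_n `[a n, u]%classic) (s `^ (- g))%:E)%E.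
  congr (integral _ _ _); apply/seteqP; split=> x /=.
    rewrite in_itv /= => /andP[x0 xu].
    exists (Num.truncn (u / x)) => //=; rewrite in_itv /= xu andbT.
    rewrite /a ler_pdivrMr // mulrC -ler_pdivrMr // ltW //.
    by rewrite (lt_le_trans (truncnS_gt _)) // ler_nat.
  by move=> [n _ /=]; rewrite !in_itv /= => /andP[x1 ->]; rewrite (lt_le_trans (a0 n)).
have H1 := @ge0_nondecreasing_set_cvg_integral _ (measurableTypeR R) R (fun n => `[a n, u]%classic)
  (fun s => (s `^ (- g))%:E) mu.
have {}H1 : (\int[mu]_(s in `[a n, u]) (s `^ (- g))%:E)%E @[n --> \oo] -->
    (\int[mu]_(s in \bigcup_n `[a n, u]%classic) (s `^ (- g))%:E)%E.
  apply: H1.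
  - move=> m n mn; rewrite subsetEset => x /=; rewrite !in_itv /= => /andP[x1 ->].
    rewrite andbT (le_trans _ x1) // ler_pM2l // lef_pV2 ?posrE // ler_nat.
    by rewrite !ltnS.
  - by move=> n; exact: measurable_itv.
  - by move=> n; apply/measurable_EFinP; apply: measurable_funTS; exact: measurable_powR.
  - by move=> n x _; rewrite lee_fin powR_ge0.
apply: cvg_unique H1 _ => //.
rewrite (_ : (fun n => _) = (fun n => (F u - F (a n))%:E)); last by apply/funext.
apply: cvg_EFin; first by near=> n.
rewrite /comp /=.
rewrite (_ : u `^ (1 - g) / (1 - g) = F u - (1 - g)^-1 * 0); last by rewrite /F mulr0 subr0 mulrC.
apply: cvgB; first exact: cvg_cst.
apply: cvgM; first exact: cvg_cst.
have /cvg_at_rightP := powR_cvg0 g10; apply; split=> [n|]; first exact: a0.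
rewrite /a -[X in _ --> X](mulr0 u); apply: cvgM; first exact: cvg_cst.
by have := @cvg_harmonic R; rewrite -cvg_shiftS.
Unshelve. all: by end_near. Qed.
End powR_integral.

(** * Integrals against image measures *)

Section density.
Local Open Scope ereal_scope.
Context d1 d2 (X : measurableType d1) (Y : measurableType d2) (R : realType).
Context (mu : {measure set X -> \bar R}) (nu : {measure set Y -> \bar R}).
Context (f : X -> R) (h : X -> Y).
Hypotheses (mf : measurable_fun setT f) (mh : measurable_fun setT h).
Hypothesis f0 : forall x, (0 <= f x)%R.
Hypothesis nuE : forall A, measurable A -> nu A = \int[mu]_(x in h @^-1` A) (f x)%:E.

Import HBNNSimple.

Let mhA A : measurable A -> measurable (h @^-1` A).
Proof. by move=> mA; rewrite -[X in measurable X]setTI; exact: mh. Qed.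

(** [nu] is the image under [h] of the measure with density [f], and the formula passes from simple
    functions to the limit by monotone convergence. It serves three purposes: the limit law, laws of
    random variables with a density, and, with [h] the identity into a coarser sigma-algebra,
    conditioning. *)
Lemma ge0_integral_density (G : Y -> \bar R) :
  measurable_fun setT G -> (forall y, 0 <= G y) ->
  \int[nu]_y G y = \int[mu]_x ((f x)%:E * G (h x)).
Proof.
move=> mG G0.
pose f_ := nnsfun_approx measurableT mG.
transitivity (limn (fun n => \int[nu]_x (f_ n x)%:E)).
  rewrite -monotone_convergence//.
  - apply: eq_integral => y _; apply/esym/cvg_lim => //.
    exact: cvg_nnsfun_approx.
  - by move=> n; exact/measurable_EFinP/measurable_funP.
  - by move=> n y _; rewrite lee_fin.
  - by move=> y _ m n mn; rewrite lee_fin; exact/lefP/nd_nnsfun_approx.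
have mfh n : measurable_fun setT (f_ n \o h) by exact: measurableT_comp.
rewrite [X in limn X](_ : _ = (fun n => \int[mu]_x ((f x)%:E * (f_ n (h x))%:E))).
  rewrite -monotone_convergence//; last 3 first.
    - by move=> n /=; apply: emeasurable_funM; apply/measurable_EFinP => //; exact: mfh.
    - by move=> n x _ /=; rewrite mule_ge0 // lee_fin.
    - move=> x _ m n mn; rewrite lee_wpmul2l ?lee_fin //; exact/lefP/nd_nnsfun_approx.
  apply: eq_integral => x _; apply/cvg_lim => //.
  by apply: cvgeZl => //; exact: cvg_nnsfun_approx.
apply/funext => n.
transitivity (\sum_(k \in range (f_ n)) k%:E * nu (f_ n @^-1` [set k])).
  under eq_integral do rewrite fimfunE -fsumEFin//.
  rewrite ge0_integral_fsum//; last 2 first.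
  - by move=> y; exact/measurable_EFinP/measurable_funM.
  - by move=> y x _; rewrite nnfun_muleindic_ge0.
  by apply: eq_fsbigr => r _; rewrite integralZl_indic_nnsfun// integral_indic//= setIT.
have m1 r : measurable_fun setT (fun x => (f x)%:E * (r * \1_(h @^-1` (f_ n @^-1` [set r])) x)%:E).
  apply: emeasurable_funM; apply/measurable_EFinP => //; apply: measurable_funM => //.
  by apply: measurable_indic; exact: mhA.
have p1 r x : 0 <= (f x)%:E * (r * \1_(h @^-1` (f_ n @^-1` [set r])) x)%:E.
  by rewrite mule_ge0 ?lee_fin //; exact: nnfun_muleindic_ge0.
transitivity (\int[mu]_x (\sum_(r \in range (f_ n)) (f x)%:E * (r * \1_(h @^-1` (f_ n @^-1` [set r])) x)%:E)).
  rewrite ge0_integral_fsum//; apply: eq_fsbigr => r /set_mem [y _ fr].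
  have r0 : (0 <= r)%R by rewrite -fr.
  rewrite nuE //.
  rewrite [in LHS]integral_mkcond -ge0_integralZl //.
  - apply: eq_integral => x _; rewrite patchE indicE.
    by case: ifPn => _; rewrite ?mulr1 ?mulr0 ?mule0 // muleC.
  - by apply/(measurable_restrictT _ (mhA (measurable_sfunP _ _))) => //; exact/measurable_EFinP/measurable_funTS.
  - by move=> x _; rewrite patchE; case: ifPn => // _; rewrite lee_fin.
apply: eq_integral => x _; rewrite [in RHS]fimfunE -fsumEFin // ge0_mule_fsumr //.
by move=> r; exact: nnfun_muleindic_ge0.
Qed.
End density.

(** * The limit law *)

Section lebesgue_products.
Context (R : realType) (d : nat).
Local Notation mu := (@lebesgue_measure R).
Local Notation pairT := (measurableTypeR R * d.-tuple R)%type.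
Local Open Scope ereal_scope.

Definition lebesgue_pair : set pairT -> \bar R :=
  product_measure1 mu (@lebesgue_tuple R d).

HB.instance Definition _ := Measure.on lebesgue_pair.
HB.instance Definition _ :=
  Measure_isSigmaFinite.Build _ _ _ lebesgue_pair
    (product_measure1_sigma_finite mu (@lebesgue_tuple R d)).

Definition lebesgue_triple : set (measurableTypeR R * pairT) -> \bar R :=
  product_measure1 mu lebesgue_pair.

HB.instance Definition _ := Measure.on lebesgue_triple.

Lemma integral_lebesgue_triple (f : measurableTypeR R * pairT -> \bar R) :
  measurable_fun setT f -> (forall z, 0 <= f z) ->
  \int[lebesgue_triple]_z f z =
  \int[mu]_a \int[mu]_b \int[@lebesgue_tuple R d]_y f (a, (b, y)).
Proof.
move=> mf f0; rewrite fubini_tonelli1 //; apply: eq_integral => a _.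
rewrite /fubini_F (@fubini_tonelli1 _ _ _ _ _ mu (@lebesgue_tuple R d) (fun p => f (a, p))) //.
exact: measurable_fun_pair2.
Qed.

(* The sections in the first variable are integrated first. *)
Lemma lebesgue_triple_null (E : set (measurableTypeR R * pairT)) :
  measurable E -> (forall p, mu (ysection E p) = 0) -> lebesgue_triple E = 0.
Proof.
move=> mE E0.
rewrite /lebesgue_triple.
rewrite (@product_measure_unique _ _ _ _ _ mu lebesgue_pair
  (product_measure2 mu lebesgue_pair)) //.
  by apply: integral0_eq => p _; exact: E0.
by move=> A B mA mB; exact: product_measure2E.
Qed.
End lebesgue_products.

Section clamp.
Context (R : realType) (d : nat) (phi : R -> R).
Hypothesis phiP : profile d phi.

(* Only the values of [phi] on [0, +oo[ are constrained; [clamped phi] is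
   nonincreasing, hence measurable, on the whole line. *)
Definition clamped r := phi (Num.max r 0).

Lemma clampedE r : 0 <= r -> clamped r = phi r.
Proof. by move=> r0; rewrite /clamped max_l. Qed.

Lemma clamped_ge0 r : 0 <= clamped r.
Proof.
have [H _ _ _] := phiP; have /andP[//] : 0 <= clamped r <= 1.
by apply: H; rewrite le_max lexx orbT.
Qed.

Lemma clamped_le1 r : clamped r <= 1.
Proof.
have [H _ _ _] := phiP; have /andP[//] : 0 <= clamped r <= 1.
by apply: H; rewrite le_max lexx orbT.
Qed.

Lemma clamped_nonincreasing r s : r <= s -> clamped s <= clamped r.
Proof.
have [_ H _ _] := phiP => rs; apply: H; first by rewrite le_max lexx orbT.
by rewrite ge_max !le_max rs lexx !orbT.
Qed.

Lemma measurable_clamped : measurable_fun setT clamped.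
Proof. by apply: nonincreasing_measurable => // r s rs; exact: clamped_nonincreasing. Qed.

(** The normalisation of the profile after a dilation. The value 1 / k determines both the total
    mass of the limit law and the bound on the mean weight of a pair. *)
Lemma integral_clamped (k : R) : (0 < d)%N -> 0 < k ->
  (\int[@lebesgue_tuple R d]_x (clamped (k * enorm x ^+ d))%:E = (k^-1)%:E)%E.
Proof.
move=> d0 k0; have [_ _ _ H] := phiP.
rewrite (@ge0_integral_enorm_scale R d k (EFin \o clamped)) //.
- rewrite -[RHS]mule1 -H; congr (_ * _)%E; apply: eq_integral => x _ /=.
  by rewrite clampedE // exprn_ge0 // enorm_ge0.
- by apply/measurable_EFinP; exact: measurable_clamped.
- by move=> x /=; rewrite lee_fin clamped_ge0.
Qed.
End clamp.

Section limit_law.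
Context (R : realType) (d : nat) (gamma beta : R) (phi : R -> R).
Hypotheses (d0 : (0 < d)%N) (gammaP : 0 < gamma < 1) (beta0 : 0 < beta).
Hypothesis phiP : profile d phi.
Local Notation mu := (@lebesgue_measure R).
Local Notation pairT := (measurableTypeR R * d.-tuple R)%type.
Local Notation tripleT := (measurableTypeR R * pairT)%type.
Local Notation phi0 := (clamped phi).

(* For [k = beta^-1] this is the argument of [phi] in [limit_mass], the birth
   times and the displacement being rescaled. *)
Definition rate (k : R) (z : tripleT) : R :=
  k * z.1 `^ (1 - gamma) * z.2.1 `^ gamma * enorm z.2.2 ^+ d.

Definition wedge (U : R) : set tripleT := [set z | 0 < z.2.1 < z.1 /\ z.1 < U].

(** With k = 1 / beta and U = 1 this is the density of the limit before normalisation; with k = c /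
    beta and U = 1 / c + 1 it is, up to the factor M, the majorant for dominated convergence. *)
Definition limit_density (k U : R) (z : tripleT) : R :=
  \1_(wedge U) z * phi0 (rate k z).

Lemma measurable_wedge U : measurable (wedge U).
Proof.
have m1 : measurable_fun setT (fun z : tripleT => z.1 : R) by exact: measurable_fst.
have m2 : measurable_fun setT (fun z : tripleT => z.2.1 : R).
  exact: (measurableT_comp measurable_fst measurable_snd).
rewrite (_ : wedge U = ((fun z => (0 < z.2.1) && (z.2.1 < z.1) && (z.1 < U)) @^-1` [set true])); last first.
  by apply/seteqP; split => z /=; rewrite /wedge /=; [case=> -> ->|case/andP].
rewrite -[X in measurable X]setTI.
apply: (measurable_and (measurable_and (measurable_fun_ltr _ m2) (measurable_fun_ltr m2 m1)) (measurable_fun_ltr m1 _)) => //; exact: measurable_cst.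
Qed.

Lemma measurable_norm3 : measurable_fun setT (fun z : tripleT => enorm z.2.2).
Proof.
apply: measurableT_comp; first exact: measurable_enorm.
exact: (measurableT_comp measurable_snd measurable_snd).
Qed.

Lemma measurable_rate k : measurable_fun setT (rate k).
Proof.
apply: measurable_funM; last by apply: measurable_funX; exact: measurable_norm3.
apply: measurable_funM.
  apply: measurable_funM => //.
  by apply: (measurableT_comp (measurable_powR _)); exact: measurable_fst.
apply: (measurableT_comp (measurable_powR _)).
exact: (measurableT_comp measurable_fst measurable_snd).
Qed.

Lemma measurable_limit_density k U : measurable_fun setT (limit_density k U).
Proof.
apply: measurable_funM; first by apply: measurable_indic; exact: measurable_wedge.
exact: measurableT_comp (measurable_clamped phiP) (measurable_rate k).
Qed.

Lemma limit_density_ge0 k U z : 0 <= limit_density k U z.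
Proof. by rewrite mulr_ge0 // (clamped_ge0 phiP). Qed.

Lemma integral_limit_density k U (G : R -> \bar R) :
  measurable_fun setT G -> (forall r, 0 <= G r)%E ->
  (\int[@lebesgue_triple R d]_z ((limit_density k U z)%:E * G (enorm z.2.2)) =
   \int[mu]_(a in `]0%R, U[) \int[mu]_(b in `]0%R, a[) \int[@lebesgue_tuple R d]_y
     ((phi0 (k * a `^ (1 - gamma) * b `^ gamma * enorm y ^+ d))%:E * G (enorm y)))%E.
Proof.
move=> mG G0; rewrite integral_lebesgue_triple; last 2 first.
- apply: emeasurable_funM.
    by apply/measurable_EFinP; exact: measurable_limit_density.
  exact: measurableT_comp mG measurable_norm3.
- by move=> z; rewrite mule_ge0 // lee_fin limit_density_ge0.
rewrite [RHS]integral_mkcond; apply: eq_integral => a _; rewrite patchE.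
rewrite /limit_density; case: ifPn => [/set_mem /=|/negP aU].
  rewrite in_itv /= => /andP[a0 aU].
  rewrite [RHS]integral_mkcond; apply: eq_integral => b _; rewrite patchE.
  case: ifPn => [/set_mem /=|/negP ba].
    rewrite in_itv /= => /andP[b0 ba].
    apply: eq_integral => y _; rewrite indicE mem_set ?mul1r // /wedge /= b0 ba.
    by [].
  rewrite integral0_eq // => y _; rewrite indicE memNset ?mul0r ?mul0e //.
  by rewrite /wedge /= => -[ba' _]; apply: ba; apply/mem_set; rewrite /= in_itv.
rewrite integral0_eq // => b _; rewrite integral0_eq // => y _.
rewrite indicE memNset ?mul0r ?mul0e //.
rewrite /wedge /= => -[/andP[b0 ba] a1]; apply: aU; apply/mem_set; rewrite /= in_itv /= a1.
by rewrite (lt_trans b0).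
Qed.

(** The displacement integrates to 1 / (k a^(1 - gamma) b^gamma). Since gamma < 1 the power b^(-
    gamma) is integrable at 0, and its integral up to a equals a^(1 - gamma) / (1 - gamma), which
    cancels the power of a: the outer integrand is constant. *)
Lemma mass_limit_density k U : 0 < k -> 0 < U ->
  (\int[@lebesgue_triple R d]_z (limit_density k U z)%:E = (U / (k * (1 - gamma)))%:E)%E.
Proof.
move=> k0 U0; case/andP: (gammaP) => g0 g1.
have g10 : 0 < 1 - gamma by rewrite subr_gt0.
have := @integral_limit_density k U (cst 1%E) (measurable_cst _) (fun=> lee01).
under eq_integral do rewrite mule1.
move=> ->.
transitivity (\int[mu]_(a in `]0%R, U[) ((k * (1 - gamma))^-1)%:E)%E.
  apply: eq_integral => a /set_mem /=; rewrite in_itv /= => /andP[a0 _].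
  transitivity (\int[mu]_(b in `]0%R, a[) ((k * a `^ (1 - gamma))^-1%:E * (b `^ (- gamma))%:E))%E.
    apply: eq_integral => b /set_mem /=; rewrite in_itv /= => /andP[b0 _].
    under eq_integral do rewrite mule1.
    rewrite (integral_clamped phiP) //; last by rewrite !mulr_gt0 // powR_gt0.
    by rewrite powRN -EFinM -invfM.
  rewrite ge0_integralZl //; last 3 first.
  - by apply/measurable_EFinP; apply: measurable_funTS; exact: measurable_powR.
  - by move=> b _; rewrite lee_fin powR_ge0.
  - by rewrite lee_fin invr_ge0 mulr_ge0 ?powR_ge0 // ltW.
  rewrite integral_powRN // -EFinM; congr EFin.
  have ap : 0 < a `^ (1 - gamma) by exact: powR_gt0.
  by field; rewrite !gt_eqF.
rewrite integral_cst //= lebesgue_measure_itv /= lte_fin U0 -EFinD subr0 -EFinM.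
by congr EFin; rewrite mulrC.
Qed.
End limit_law.

(** A vanishing norm forces the first coordinate to be 0, and a point is null on the line. This is
    why the limit law has no mass at 0. *)
Lemma lebesgue_tuple_enorm0 (R : realType) (d : nat) : (0 < d)%N ->
  @lebesgue_tuple R d [set y | enorm y = 0] = 0%E.
Proof.
case: d => [//|n] _.
have m0 : measurable [set y : n.+1.-tuple R | enorm y = 0].
  rewrite (_ : mkset _ = @enorm R n.+1 @^-1` [set 0]) // -[X in measurable X]setTI.
  by apply: measurable_enorm => //; exact: measurable_set1.
rewrite -[LHS]mul1e -[LHS](@integral_cst _ _ _ (@lebesgue_tuple R n.+1) _ m0 1%E).
rewrite integral_mkcond integral_lebesgue_tupleS; last 2 first.
- by apply/(measurable_restrictT _ m0); exact: measurable_cst.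
- by move=> x; rewrite patchE; case: ifPn.
transitivity (\int[@lebesgue_measure R]_(x in [set (0%R : R)])
  \int[@lebesgue_tuple R n]_v (cst 1%E \_ [set y | enorm y = 0%R]) (tcons (x, v)))%E; last first.
  exact: integral_set1.
rewrite [RHS]integral_mkcond; apply: eq_integral => x _; rewrite [RHS]patchE.
case: ifPn => // /negP x0; rewrite integral0_eq // => v _; rewrite patchE.
case: ifPn => // /set_mem /= E; exfalso; apply: x0; apply/mem_set => /=.
have /eqP := E; rewrite sqrtr_eq0 big_ord_recl /= tnth0 => H.
have x2 : x ^+ 2 <= 0 by apply: le_trans H; rewrite lerDl sumr_ge0 // => i _; exact: sqr_ge0.
by apply/eqP; rewrite -sqrf_eq0 eq_le x2 sqr_ge0.
Qed.

Section edge_law.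
Context (R : realType) (d : nat) (gamma beta : R) (phi : R -> R).
Hypotheses (d0 : (0 < d)%N) (gammaP : 0 < gamma < 1) (beta0 : 0 < beta).
Hypothesis phiP : profile d phi.
Local Notation mu := (@lebesgue_measure R).
Local Notation tripleT := (measurableTypeR R * (measurableTypeR R * d.-tuple R))%type.
Local Notation density := (@limit_density R d gamma phi beta^-1 1).

(** The law is the image, under the norm of the displacement, of the limit density multiplied by (1
    - gamma) / beta, the inverse of its total mass. The last clause is the form in which the
    convergence proof uses it. *)
Lemma edge_law_exists : exists lambda : probability R R,
  [/\ lambda `]0, +oo[%classic = 1%E,
      forall (a : R) (b : \bar R), 0 <= a -> (a%:E < b)%E ->
          lambda [set r | a <= r /\ (r%:E < b)%E] =
          limit_mass d gamma beta phi a b &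
      forall G : R -> \bar R, measurable_fun setT G -> (forall r, 0 <= G r)%E ->
        (\int[lambda]_r G r =
          ((1 - gamma) / beta)%:E * \int[@lebesgue_triple R d]_z ((density z)%:E * G (enorm z.2.2)))%E].
Proof.
have /andP[g0 g1] := gammaP.
have c0 : 0 < (1 - gamma) / beta by rewrite divr_gt0 // subr_gt0.
set c := (1 - gamma) / beta in c0 *.
have md : measurable_fun setT density by exact: measurable_limit_density.
have d00 z : 0 <= density z by apply: limit_density_ge0.
pose h (z : tripleT) := enorm z.2.2.
have mh : measurable_fun setT h by exact: measurable_norm3.
have mhA (A : set R) : measurable A -> measurable (h @^-1` A).
  by move=> mA; rewrite -[X in measurable X]setTI; exact: mh.
pose f (z : tripleT) : R := c * density z.
have mf : measurable_fun setT f by exact: measurable_funM.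
have f0 z : 0 <= f z by rewrite mulr_ge0 // ltW.
pose lam (A : set R) : \bar R := (\int[@lebesgue_triple R d]_(z in h @^-1` A) (f z)%:E)%E.
have lam0 : lam set0 = 0%E by rewrite /lam preimage_set0 integral_set0.
have lam_ge0 A : (0 <= lam A)%E by apply: integral_ge0 => z _; rewrite lee_fin.
have lam_sigma : semi_sigma_additive lam.
  move=> F mF tF mUF; rewrite /lam preimage_bigcup.
  apply: (@semi_sigma_additive_nng_induced _ _ R (@lebesgue_triple R d) (EFin \o f)).
  - by apply/measurable_EFinP.
  - by move=> z; rewrite /= lee_fin.
  - by move=> i; exact: mhA.
  - apply/trivIsetP => /= i j _ _ ij; rewrite -preimage_setI.
    by move/trivIsetP : tF => /(_ _ _ _ _ ij) ->//; rewrite preimage_set0.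
  - by rewrite -preimage_bigcup; exact: mhA.
pose lamM := isMeasure.Build _ _ _ lam lam0 lam_ge0 lam_sigma.
pose lamm : {measure set R -> \bar R} := HB.pack lam lamM.
have lam1 : lamm setT = 1%E.
  rewrite /= /lam preimage_setT /f; under eq_integral do rewrite EFinM.
  rewrite ge0_integralZl ?lee_fin ?(ltW c0) //.
  - rewrite mass_limit_density ?invr_gt0 // -EFinM; congr EFin; rewrite /c.
    by field; rewrite gt_eqF //= gt_eqF // subr_gt0.
  - exact/measurable_EFinP.
  - by move=> z _; rewrite lee_fin.
pose lamP := Measure_isProbability.Build _ _ _ lamm lam1.
have [L LE] : exists L : probability R R, forall A, measurable A ->
    L A = (\int[@lebesgue_triple R d]_(z in h @^-1` A) (f z)%:E)%E.
  pose L0 : probability R R := HB.pack lam lamM lamP.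
  by exists L0.
have LG (G : R -> \bar R) : measurable_fun setT G -> (forall r, 0 <= G r)%E ->
    (\int[L]_r G r = c%:E * \int[@lebesgue_triple R d]_z ((density z)%:E * G (enorm z.2.2)))%E.
  move=> mG G0; rewrite (@ge0_integral_density _ _ _ _ R (@lebesgue_triple R d) L f h) //.
  rewrite -ge0_integralZl ?lee_fin ?(ltW c0) //.
  - by apply: eq_integral => z _; rewrite muleA -EFinM.
  - apply: emeasurable_funM; first exact/measurable_EFinP.
    exact: measurableT_comp mG mh.
  - by move=> z _; rewrite mule_ge0 ?lee_fin.
have LI A : measurable A -> L A =
    (c%:E * \int[mu]_(a in `]0%R, 1%R[) \int[mu]_(b in `]0%R, a[) \int[@lebesgue_tuple R d]_y
     ((clamped phi (beta^-1 * a `^ (1 - gamma) * b `^ gamma * enorm y ^+ d))%:E * (\1_A (enorm y))%:E))%E.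
  move=> mA.
  have mI : measurable_fun setT (fun r : R => (\1_A r : R)%:E).
    by apply/measurable_EFinP; exact: measurable_indic.
  transitivity (\int[L]_r (\1_A r)%:E)%E; first by rewrite integral_indic // setIT.
  rewrite LG //.
  congr (_ * _)%E; have H := @integral_limit_density R d gamma phi.
  by apply: (H _ _ _ (fun r => (\1_A r)%:E)) => // r; rewrite lee_fin.
exists L; split => //.
- transitivity (L setT); last exact: probability_setT.
  rewrite (LI _ (measurable_itv _)).
  rewrite (LI _ measurableT).
  apply: (f_equal (fun z => c%:E * z)%E).
  apply: eq_integral => a _; apply: eq_integral => b _.
  have mphi : measurable_fun setT (fun y : d.-tuple R =>
      clamped phi (beta^-1 * a `^ (1 - gamma) * b `^ gamma * enorm y ^+ d)).
    apply: (measurableT_comp (measurable_clamped phiP)); apply: measurable_funM => //.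
    by apply: measurable_funX; exact: measurable_enorm.
  have mI (A : set R) : measurable A -> measurable_fun setT (fun y : d.-tuple R =>
      ((clamped phi (beta^-1 * a `^ (1 - gamma) * b `^ gamma * enorm y ^+ d))%:E * (\1_A (enorm y))%:E)%E).
    move=> mA; apply: emeasurable_funM; apply/measurable_EFinP => //.
    apply: (measurableT_comp (f := (\1_A : R -> R)) (g := @enorm R d)).
      exact: measurable_indic.
    exact: measurable_enorm.
  apply: ae_eq_integral => //; [exact: mI|exact: mI|].
  (* The indicators of the positive half-line and of the whole line, evaluated at the norm, differ
     only where the norm is 0. *)
  exists [set y | enorm y = 0]; split.
  + rewrite (_ : mkset _ = @enorm R d @^-1` [set 0]) // -[X in measurable X]setTI.
    by apply: measurable_enorm => //; exact: measurable_set1.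
  + exact: lebesgue_tuple_enorm0.
  + move=> y /= H; apply: contrapT => /eqP y0; apply: H => _.
    rewrite !indicE !mem_set //= in_itv /= andbT lt_def y0.
    exact: enorm_ge0.
- move=> a b a0 ab.
  have mA : measurable [set r : R | a <= r /\ (r%:E < b)%E].
    rewrite (_ : mkset _ = (fun r => (a%:E <= r%:E)%E && (r%:E < b)%E) @^-1` [set true]); last first.
      by apply/seteqP; split => r /=; rewrite lee_fin; [case=> -> ->|case/andP].
    rewrite -[X in measurable X]setTI.
    by apply: (measurable_and (measurable_fun_lee _ _) (measurable_fun_lte _ _)) => //; exact: measurable_cst.
  rewrite (LI _ mA) /limit_mass -/c; apply: (f_equal (fun z => c%:E * z)%E).
  apply: eq_integral => u /set_mem /=; rewrite in_itv /= => /andP[u0 u1].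
  apply: eq_integral => s /set_mem /=; rewrite in_itv /= => /andP[s0 su].
  rewrite [RHS]integral_mkcond; apply: eq_integral => y _; rewrite patchE indicE.
  rewrite clampedE; last by rewrite !mulr_ge0 ?powR_ge0 ?exprn_ge0 ?enorm_ge0 // invr_ge0 ltW.
  rewrite (_ : (enorm y \in _) = (y \in [set y0 : d.-tuple R | a <= enorm y0 /\ ((enorm y0)%:E < b)%E])); last first.
    by apply/idP/idP => /set_mem H; apply/mem_set.
  by case: ifPn => _; rewrite ?mule1 ?mule0.
Qed.
End edge_law.

(** * Convergence of the mean edge sum for deterministic births *)

(** Monotonicity gives both one-sided limits, with the value squeezed between them. If they agree
    the function is continuous, so every other point is a jump, and on each bounded interval the
    jumps are countable. *)
Lemma nondecreasing_noncontinuous_countable (R : realType) (G : R -> R) :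
  nondecreasing_fun G -> countable [set x | ~ {for x, continuous G}].
Proof.
move=> ndG.
apply: (@sub_countable _ _ _ (\bigcup_(n in @setT nat)
  [set x | (x \in `](- n%:R), n%:R[) /\ discontinuity G x])); last first.
  apply: bigcup_countable => // n _; apply: discontinuity_countable.
  by move=> x y _ _; exact: ndG.
apply: subset_card_le => x /= cx.
exists (Num.truncn `|x|).+1 => //=; split.
  by rewrite in_itv /= -ltr_norml truncnS_gt.
have cl : cvg (G z @[z --> x^'-]).
  apply: nondecreasing_at_left_is_cvgr.
    by near=> r; move=> y z _ _; exact: ndG.
  near=> r; exists (G x) => _ [z /= /[!in_itv] /= /andP[_ zx] <-]; exact/ndG/ltW.
have cr : cvg (G z @[z --> x^'+]).
  apply: nondecreasing_at_right_is_cvgr.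
    by near=> r; move=> y z _ _; exact: ndG.
  near=> r; exists (G x) => _ [z /= /[!in_itv] /= /andP[xz _] <-]; exact/ndG/ltW.
split => //; apply/eqP => lr; apply: cx.
have lx : lim (G z @[z --> x^'-]) <= G x.
  by apply: limr_le => //; near=> z; apply/ndG/ltW.
have xr : G x <= lim (G z @[z --> x^'+]).
  by apply: limr_ge => //; near=> z; apply/ndG/ltW.
have lE : lim (G z @[z --> x^'-]) = G x by apply/eqP; rewrite eq_le lx lr.
apply/left_right_continuousP; split.
  by rewrite -lE.
by rewrite -lE lr.
Unshelve. all: by end_near. Qed.

Lemma clamped_noncontinuous_countable (R : realType) (d : nat) (phi : R -> R) :
  profile d phi -> countable [set x | ~ {for x, continuous (clamped phi)}].
Proof.
move=> phiP.
apply: (@sub_countable _ _ _ [set x | ~ {for x, continuous (fun r => - clamped phi r)}]).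
  apply: subset_card_le => x /= H K; apply: H.
  have := @continuousN R R^o _ _ _ K.
  by rewrite (_ : (fun _ => _) = clamped phi) //; apply/funext => r; rewrite opprK.
apply: nondecreasing_noncontinuous_countable => r s rs.
by rewrite lerN2 (clamped_nonincreasing phiP).
Qed.

Lemma lebesgue_tuple_torus (R : realType) (d : nat) :
  @lebesgue_tuple R d (@torus R d) = 1%E.
Proof.
elim: d => [|n IH]; first by rewrite /= diracE mem_set // => -[].
have mT k : measurable (@torus R k) by exact: measurable_torus.
rewrite -[LHS]mul1e -[LHS](@integral_cst _ _ _ (@lebesgue_tuple R n.+1) _ (mT _) 1%E).
rewrite integral_torusS //.
have H1 : (\int[@lebesgue_tuple R n]_(v in @torus R n) 1 = 1)%E.
  transitivity (1 * @lebesgue_tuple R n (@torus R n))%E; last by rewrite IH mule1.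
  exact: (@integral_cst _ _ _ (@lebesgue_tuple R n) _ (mT _) 1%E).
under eq_integral do rewrite H1.
transitivity (1 * @lebesgue_measure R `](- 2^-1)%R, 2^-1%R]%classic)%E.
  exact: (@integral_cst _ _ _ (@lebesgue_measure R) _ (measurable_itv _) 1%E).
rewrite lebesgue_measure_itv /= lte_fin ifT; last lra.
by rewrite mul1e -EFinD; congr EFin; lra.
Qed.

Lemma integral_torus_cst (R : realType) (d : nat) (c : \bar R) :
  (\int[@lebesgue_tuple R d]_(x in @torus R d) c = c)%E.
Proof.
transitivity (c * @lebesgue_tuple R d (@torus R d))%E.
  exact: (@integral_cst _ _ _ (@lebesgue_tuple R d) _ (@measurable_torus R d)).
by rewrite lebesgue_tuple_torus mule1.
Qed.

Section step_sum.
Context (R : realType) (d : nat) (gamma beta : R) (phi : R -> R).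
Hypotheses (d0 : (0 < d)%N) (gammaP : 0 < gamma < 1) (beta0 : 0 < beta).
Hypothesis phiP : profile d phi.
Context (g : R -> R) (M : R).
Hypotheses (mg : measurable_fun setT g) (gM : forall r, 0 <= g r <= M).
Local Notation mu := (@lebesgue_measure R).
Local Notation tripleT := (measurableTypeR R * (measurableTypeR R * d.-tuple R))%type.
Local Notation phi0 := (clamped phi).

Definition edge_density (t u s : R) (r : R) : R :=
  phi0 (u * r ^+ d / (beta * (u / s) `^ gamma)) * g (t `^ (d%:R^-1) * r).

(* By translation invariance of the torus, this is the conditional mean of the
   contribution of a pair of vertices given their birth times. *)
Definition edge_mean (t u s : R) : R :=
  fine (\int[@lebesgue_tuple R d]_(x in @torus R d) (edge_density t u s (enorm x))%:E).

Let M0 : 0 <= M. Proof. by have /andP[] := gM 0; exact: le_trans. Qed.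

Lemma edge_density_ge0 t u s r : 0 <= edge_density t u s r.
Proof. by rewrite mulr_ge0 ?(clamped_ge0 phiP) //; have /andP[] := gM (t `^ (d%:R^-1) * r). Qed.

Lemma edge_density_le t u s r : edge_density t u s r <= M.
Proof.
rewrite -[leRHS]mul1r ler_pM ?(clamped_ge0 phiP) ?(clamped_le1 phiP) //.
  by have /andP[] := gM (t `^ (d%:R^-1) * r).
by have /andP[] := gM (t `^ (d%:R^-1) * r).
Qed.

Lemma measurable_edge_density t u s : measurable_fun setT (edge_density t u s).
Proof.
apply: measurable_funM.
  apply: (measurableT_comp (measurable_clamped phiP)).
  by apply: measurable_funM => //; apply: measurable_funM => //; exact: measurable_funX.
by apply: measurableT_comp => //; exact: measurable_funM.
Qed.

Lemma edge_meanE t u s : (edge_mean t u s)%:E =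
  (\int[@lebesgue_tuple R d]_(x in @torus R d) (edge_density t u s (enorm x))%:E)%E.
Proof.
rewrite fineK // ge0_fin_numE; last first.
  by apply: integral_ge0 => x _; rewrite lee_fin edge_density_ge0.
apply: (@le_lt_trans _ _ (\int[@lebesgue_tuple R d]_(x in @torus R d) M%:E)%E).
  apply: ge0_le_integral => //.
  - exact: measurable_torus.
  - by move=> x _; rewrite lee_fin edge_density_ge0.
  - apply/measurable_EFinP/measurable_funTS.
    by apply: measurableT_comp (@measurable_enorm R d); exact: measurable_edge_density.
  - by move=> x _; rewrite lee_fin edge_density_le.
by rewrite integral_torus_cst ltry.
Qed.

Lemma edge_mean_ge0 t u s : 0 <= edge_mean t u s.
Proof.
by apply: fine_ge0; apply: integral_ge0 => x _; rewrite lee_fin edge_density_ge0.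
Qed.

Lemma edge_mean_le t u s : edge_mean t u s <= M.
Proof.
rewrite -lee_fin edge_meanE.
apply: (@le_trans _ _ (\int[@lebesgue_tuple R d]_(x in @torus R d) M%:E)%E).
  apply: ge0_le_integral => //.
  - exact: measurable_torus.
  - by move=> x _; rewrite lee_fin edge_density_ge0.
  - apply/measurable_EFinP/measurable_funTS.
    by apply: measurableT_comp (@measurable_enorm R d); exact: measurable_edge_density.
  - by move=> x _; rewrite lee_fin edge_density_le.
by rewrite integral_torus_cst.
Qed.

(* The cells of the indices i partition ]0, +oo[ into pieces of length 1 / t, so
   that sums over births become integrals of step functions. *)
Definition cell (t : R) (i : nat) : set R :=
  [set a | 0 < a /\ i%:R <= t * a < i.+1%:R].

Lemma cellE t i : 0 < t ->
  cell t i = [set` Interval (BSide (0 < i)%N (i%:R / t)) (BLeft (i.+1%:R / t))].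
Proof.
move=> t0; apply/seteqP; split => a /=; rewrite in_itv /=.
  move=> [a0 /andP[ia ai]]; apply/andP; split; last by rewrite ltr_pdivlMr // mulrC.
  case: i ia ai => [|i] ia _; first by rewrite /= mul0r.
  by rewrite /= ler_pdivrMr // mulrC.
move=> /andP[H]; rewrite ltr_pdivlMr // mulrC => ai.
suff [a0 ia] : 0 < a /\ i%:R <= t * a by split => //; apply/andP; split.
case: i H {ai} => [|i] /=; first by rewrite mul0r => a0; rewrite a0 mulr_ge0 // ltW.
rewrite ler_pdivrMr // mulrC => ia; split => //.
by rewrite -(pmulr_rgt0 _ t0) (lt_le_trans _ ia).
Qed.

Lemma measurable_cell t i : 0 < t -> measurable (cell t i : set (measurableTypeR R)).
Proof. by move=> t0; rewrite cellE //; exact: measurable_itv. Qed.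

Lemma lebesgue_measure_cell t i : 0 < t -> mu (cell t i) = (t^-1)%:E.
Proof.
move=> t0; rewrite cellE // lebesgue_measure_itv /= lte_fin ltr_pM2r ?invr_gt0 //.
rewrite ltr_nat ltnSn -EFinB; congr EFin.
by rewrite -mulrBl -natrB // subSnn mul1r.
Qed.

Lemma integral_cell (k t : R) i : 0 <= k -> 0 < t ->
  (\int[mu]_b (k%:E * (\1_(cell t i) b)%:E) = (k / t)%:E)%E.
Proof.
move=> k0 t0.
have mI : measurable_fun setT (fun b : measurableTypeR R => (\1_(cell t i) b : R)%:E).
  by apply/measurable_EFinP; apply: measurable_indic; exact: measurable_cell.
transitivity (k%:E * mu (cell t i))%E; last by rewrite lebesgue_measure_cell.
rewrite (@ge0_integralZl _ _ _ mu setT measurableT _ mI) ?lee_fin //.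
apply: (f_equal (fun z => k%:E * z)%E).
by rewrite integral_indic ?setIT //; exact: measurable_cell.
Qed.

(* The substitution y = t^(1/d) x absorbs the scaling of the edge lengths. *)
Definition rescaled_density (t u s : R) (y : d.-tuple R) : R :=
  (fun x : d.-tuple R => \1_(@torus R d) x * edge_density t u s (enorm x))
    (map_tuple ( *%R ((t `^ (d%:R^-1))^-1)) y).

Lemma measurable_torus_density t u s : measurable_fun setT
  (fun x : d.-tuple R => \1_(@torus R d) x * edge_density t u s (enorm x)).
Proof.
apply: measurable_funM; first by apply: measurable_indic; exact: measurable_torus.
by apply: measurableT_comp (@measurable_enorm R d); exact: measurable_edge_density.
Qed.

Lemma measurable_rescaled_density t u s : measurable_fun setT (rescaled_density t u s).
Proof.
apply: (measurableT_comp (measurable_torus_density t u s)).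
by apply: measurable_map_tuple; exact: measurable_funM.
Qed.

Lemma rescaled_density_ge0 t u s y : 0 <= rescaled_density t u s y.
Proof. by rewrite mulr_ge0 // edge_density_ge0. Qed.

Lemma powR_root (t : R) : 0 < t -> (t `^ (d%:R^-1)) ^+ d = t.
Proof.
move=> t0.
by rewrite -powR_mulrn ?powR_ge0 // -powRrM mulVf ?powRr1 ?ltW // pnatr_eq0 -lt0n.
Qed.

Lemma integral_rescaled_density t u s : 0 < t ->
  (\int[@lebesgue_tuple R d]_y (rescaled_density t u s y)%:E = (t * edge_mean t u s)%:E)%E.
Proof.
move=> t0.
rewrite (@ge0_integral_lebesgue_tuple_scale R d (t `^ (d%:R^-1))^-1
  (fun x => (\1_(@torus R d) x * edge_density t u s (enorm x))%:E)) //.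
- rewrite invrK powR_root // EFinM edge_meanE; congr (_ * _)%E.
  rewrite [RHS]integral_mkcond; apply: eq_integral => x _.
  by rewrite patchE indicE; case: ifPn; rewrite ?mul1r ?mul0r.
- by rewrite invr_gt0 powR_gt0.
- by apply/measurable_EFinP; exact: measurable_torus_density.
- by move=> x; rewrite lee_fin mulr_ge0 // edge_density_ge0.
Qed.

(** Only the younger index is tested against t: on the event where this is used the births increase,
    so the older vertex is then present too. *)
Definition step_term (tau : nat -> R) (t : R) (i j : nat) (z : tripleT) : R :=
  (tau i <= t)%R%:R * (\1_(cell t i) z.1 *
    (\1_(cell t j) z.2.1 * rescaled_density t (tau i) (tau j) z.2.2)).

Lemma step_term_ge0 tau t i j z : 0 <= step_term tau t i j z.
Proof.
apply: mulr_ge0 => //; apply: mulr_ge0 => //; apply: mulr_ge0 => //.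
exact: rescaled_density_ge0.
Qed.

Lemma measurable_step_term tau t i j : 0 < t -> measurable_fun setT (step_term tau t i j).
Proof.
move=> t0; apply: measurable_funM => //; apply: measurable_funM.
  apply: (measurableT_comp (f := (\1_(cell t i) : measurableTypeR R -> R)) (g := fst)) => //.
  by apply: measurable_indic; exact: measurable_cell.
apply: measurable_funM.
  apply: (measurableT_comp (f := (\1_(cell t j) : measurableTypeR R -> R)) (g := fst \o snd)).
    by apply: measurable_indic; exact: measurable_cell.
  exact: (measurableT_comp measurable_fst measurable_snd).
apply: (measurableT_comp (measurable_rescaled_density _ _ _)).
exact: (measurableT_comp measurable_snd measurable_snd).
Qed.

(** Each of the two cells contributes 1 / t and the substitution in the displacement contributes t.
    The remaining 1 / t is exactly the normalisation of the edge sum. *)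
Lemma integral_step_term tau t i j : 0 < t ->
  (\int[@lebesgue_triple R d]_z (step_term tau t i j z)%:E =
   ((tau i <= t)%R%:R * edge_mean t (tau i) (tau j) / t)%:E)%E.
Proof.
move=> t0.
rewrite integral_lebesgue_triple; last 2 first.
- by apply/measurable_EFinP; exact: measurable_step_term.
- by move=> z; rewrite lee_fin step_term_ge0.
rewrite /step_term /=.
transitivity (\int[mu]_a (((tau i <= t)%R%:R * edge_mean t (tau i) (tau j))%:E * (\1_(cell t i) a)%:E))%E.
  apply: eq_integral => a _.
  transitivity (\int[mu]_b (((tau i <= t)%R%:R * \1_(cell t i) a * (t * edge_mean t (tau i) (tau j)))%:E * (\1_(cell t j) b)%:E))%E.
    apply: eq_integral => b _.
    transitivity (\int[@lebesgue_tuple R d]_y (((tau i <= t)%R%:R * \1_(cell t i) a * \1_(cell t j) b)%:E * (rescaled_density t (tau i) (tau j) y)%:E))%E.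
      by apply: eq_integral => y _; rewrite -EFinM !mulrA.
    rewrite ge0_integralZl //.
    - by rewrite integral_rescaled_density // -!EFinM; congr EFin; ring.
    - by apply/measurable_EFinP; exact: measurable_rescaled_density.
    - by move=> y _; rewrite lee_fin rescaled_density_ge0.
  rewrite integral_cell //; last by rewrite !mulr_ge0 ?edge_mean_ge0 // ltW.
  by rewrite -EFinM; congr EFin; field; rewrite gt_eqF.
by rewrite integral_cell // mulr_ge0 // edge_mean_ge0.
Qed.

Definition mean_sum (tau : nat -> R) (t : R) (N : nat) : R :=
  \sum_(i < N) \sum_(j < i) (tau i <= t)%R%:R * edge_mean t (tau i) (tau j).

Definition step_sum (tau : nat -> R) (t : R) (N : nat) (z : tripleT) : R :=
  \sum_(i < N) \sum_(j < i) step_term tau t i j z.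

Lemma measurable_step_sum tau t N : 0 < t -> measurable_fun setT (step_sum tau t N).
Proof.
move=> t0; apply: measurable_sum => i; apply: measurable_sum => j.
exact: measurable_step_term.
Qed.

Lemma integral_step_sum tau t N : 0 < t ->
  (\int[@lebesgue_triple R d]_z (step_sum tau t N z)%:E = (mean_sum tau t N / t)%:E)%E.
Proof.
move=> t0; rewrite /step_sum.
under eq_integral do rewrite -sumEFin.
rewrite ge0_integral_sum //; last 2 first.
- by move=> i; apply/measurable_EFinP; apply: measurable_sum => j; exact: measurable_step_term.
- by move=> i z _; rewrite lee_fin sumr_ge0 // => j _; exact: step_term_ge0.
rewrite /mean_sum mulr_suml -sumEFin; apply: eq_bigr => i _.
under eq_integral do rewrite -sumEFin.
rewrite ge0_integral_sum //; last 2 first.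
- by move=> j; apply/measurable_EFinP; exact: measurable_step_term.
- by move=> j z _; rewrite lee_fin step_term_ge0.
rewrite mulr_suml -sumEFin; apply: eq_bigr => j _.
by rewrite integral_step_term.
Qed.
End step_sum.

Lemma powR_div (R : realType) (x y p : R) : 0 <= x -> 0 < y ->
  (x / y) `^ p = x `^ p / y `^ p.
Proof.
move=> x0 y0; have H := @powRM R (x / y) y p (divr_ge0 x0 (ltW y0)) (ltW y0).
by rewrite divfK ?gt_eqF // in H; rewrite H mulfK // gt_eqF // powR_gt0.
Qed.

Section step_sum_limit.
Context (R : realType) (d : nat) (gamma beta : R) (phi : R -> R).
Hypotheses (d0 : (0 < d)%N) (gammaP : 0 < gamma < 1) (beta0 : 0 < beta).
Hypothesis phiP : profile d phi.
Context (g : R -> R) (M : R).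
Hypotheses (mg : measurable_fun setT g) (gM : forall r, 0 <= g r <= M).
Local Notation mu := (@lebesgue_measure R).
Local Notation tripleT := (measurableTypeR R * (measurableTypeR R * d.-tuple R))%type.
Local Notation phi0 := (clamped phi).
Local Notation rescaled_density := (@rescaled_density R d gamma beta phi g).
Local Notation step_sum := (@step_sum R d gamma beta phi g).
Local Notation mean_sum := (@mean_sum R d gamma beta phi g).

(** u / (u / s)^gamma equals u^(1 - gamma) s^gamma, which is homogeneous of degree 1 in the birth
    times. Dividing both times by t therefore absorbs the factor 1 / t in |x|^d = |y|^d / t. *)
Lemma rescaled_densityE (t u s : R) (y : d.-tuple R) : 0 < t -> 0 < u -> 0 < s ->
  rescaled_density t u s y =
  \1_(@torus R d) (map_tuple ( *%R ((t `^ (d%:R^-1))^-1)) y) *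
    (phi0 (rate gamma beta^-1 (u / t, (s / t, y))) * g (enorm y)).
Proof.
move=> t0 u0 s0; rewrite /rescaled_density /edge_density; congr (_ * (phi0 _ * g _)).
  rewrite enorm_map_scale ?invr_ge0 ?powR_ge0 // exprMn exprVn (powR_root d0) // /rate /=.
  rewrite [u / s](_ : _ = (u / t) / (s / t)); last by field; rewrite !gt_eqF.
  set U := u / t; have U0 : 0 < U by exact: divr_gt0.
  set S := s / t; have S0 : 0 < S by exact: divr_gt0.
  have -> : U `^ (1 - gamma) = U / U `^ gamma.
    by rewrite powRB ?powRr1 ?(ltW U0) //; apply/implyP => _; rewrite gt_eqF.
  rewrite (@powR_div R U S) ?(ltW U0) //.
  have Up : 0 < U `^ gamma by exact: powR_gt0.
  have Sp : 0 < S `^ gamma by exact: powR_gt0.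
  rewrite (_ : u = U * t); last by rewrite /U divfK // gt_eqF.
  by field; rewrite !gt_eqF.
rewrite enorm_map_scale ?invr_ge0 ?powR_ge0 // mulrA mulfV ?mul1r // gt_eqF //.
exact: powR_gt0.
Qed.

Lemma indic_cell (t a : R) i : 0 < t ->
  \1_(cell t i) a = ((0 < a) && (i == Num.truncn (t * a)))%:R :> R.
Proof.
move=> t0; rewrite indicE; congr (nat_of_bool _)%:R.
apply/idP/idP => [/set_mem [a0 H]|/andP[a0 /eqP ->]].
  by rewrite a0 /= eq_sym truncn_eq // mulr_ge0 // ltW.
apply/mem_set; split => //; apply: truncn_itv; by rewrite mulr_ge0 // ltW.
Qed.

(** Cells with different indices are disjoint, so at a given point at most one pair of indices
    contributes; truncation finds it. *)
Lemma step_sumE (tau : nat -> R) (t : R) N (z : tripleT) : 0 < t ->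
  step_sum tau t N z =
  let i := Num.truncn (t * z.1) in let j := Num.truncn (t * z.2.1) in
  if [&& 0 < z.1, 0 < z.2.1, (i < N)%N, (j < i)%N & tau i <= t]
  then rescaled_density t (tau i) (tau j) z.2.2 else 0.
Proof.
move=> t0 /=; set i := Num.truncn (t * z.1); set j := Num.truncn (t * z.2.1).
rewrite /step_sum /step_term.
transitivity (\sum_(k < N | k == i :> nat) \sum_(l < k | l == j :> nat)
   (if [&& 0 < z.1, 0 < z.2.1 & tau k <= t] then rescaled_density t (tau k) (tau l) z.2.2 else 0)).
  rewrite [RHS]big_mkcond /=; apply: eq_bigr => k _.
  case: ifPn => [/eqP ki|/negPf ki]; last first.
    rewrite big1 // => l _; rewrite (indic_cell z.1 k t0) -/i ki andbF /=.
    by rewrite mul0r mulr0.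
  rewrite [RHS]big_mkcond /=; apply: eq_bigr => l _.
  rewrite !(indic_cell _ _ t0) -/i -/j; case: l => l _ /=; rewrite ki eqxx andbT.
  case: (0 < z.1) => /=; last by rewrite mul0r mulr0 if_same.
  case: (0 < z.2.1) => /=; last by rewrite mul0r !mulr0 if_same.
  case: (l == j); last by rewrite mul0r !mulr0.
  by case: (tau i <= t); rewrite !(mul1r, mul0r).
rewrite (big_ord1_eq _ (fun k => \sum_(l < k | l == j :> nat)
   (if [&& 0 < z.1, 0 < z.2.1 & tau k <= t] then rescaled_density t (tau k) (tau l) z.2.2 else 0))).
case: (i < N)%N => /=; last by rewrite !andbF.
rewrite (big_ord1_eq _ (fun l =>
   (if [&& 0 < z.1, 0 < z.2.1 & tau i <= t] then rescaled_density t (tau i) (tau l) z.2.2 else 0))).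
by case: (j < i)%N => //=; rewrite !andbF.
Qed.

Section limit.
Context (tau : nat -> R) (c : R).
Hypotheses (c0 : 0 < c) (tau_ge : forall n, c * n.+1%:R <= tau n).
Hypothesis tau_cvg : (fun n => tau n / n.+1%:R) @ \oo --> (1 : R).
Context (t : nat -> R) (N : nat -> nat).
Hypotheses (t0 : forall k, 0 < t k) (toy : t @ \oo --> +oo).
Hypothesis tN : forall k, t k < c * (N k)%:R.

Let tau0 n : 0 < tau n.
Proof. by apply: lt_le_trans (tau_ge n); rewrite mulr_gt0. Qed.

Lemma tau_scaled_ge k (a : R) :
  0 < a -> c * a <= tau (Num.truncn (t k * a)) / t k.
Proof.
move=> a0; rewrite ler_pdivlMr //; apply: le_trans (tau_ge _).
by rewrite -mulrA ler_pM2l // mulrC ltW // truncnS_gt.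
Qed.

(** With n the integer part of t a, the quotient is the product of tau n / (n + 1), which tends to
    1, and (n + 1) / t, which differs from a by at most 1 / t. *)
Lemma tau_scaled_cvg (a : R) : 0 < a ->
  (fun k => tau (Num.truncn (t k * a)) / t k) @ \oo --> a.
Proof.
move=> a0.
have toy' : (fun k => Num.truncn (t k * a)) @ \oo --> \oo.
  apply/cvgnyPge => A; have /cvgryPge /(_ (A%:R / a)) := toy.
  apply: filterS => k; rewrite ler_pdivrMr // => H.
  by rewrite truncn_ge_nat // mulr_ge0 // ltW.
have H1 : (fun k => tau (Num.truncn (t k * a)) / (Num.truncn (t k * a)).+1%:R) @ \oo --> (1 : R).
  exact: (cvg_comp _ _ toy' tau_cvg).
have tV : (fun k => (t k)^-1) @ \oo --> (0 : R).
  by apply/gtr0_cvgV0 => //; near=> k.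
have H2 : (fun k => (Num.truncn (t k * a)).+1%:R / t k) @ \oo --> a.
  apply/cvgrPdist_le => e e0; have /cvgr0Pnorm_le /(_ e e0) := tV.
  apply: filterS => k; rewrite gtr0_norm ?invr_gt0 // => H; apply: le_trans H.
  have /andP[h1 h2] := @truncn_itv R (t k * a) (mulr_ge0 (ltW (t0 k)) (ltW a0)).
  rewrite (_ : a - _ = (t k * a - (Num.truncn (t k * a)).+1%:R) / t k); last by field; rewrite gt_eqF.
  rewrite normrM.
  rewrite (@gtr0_norm _ (t k)^-1) ?invr_gt0 // ler_piMl ?invr_ge0 ?(ltW (t0 k)) //.
  by rewrite -natr1 in h2; rewrite -[X in _ - X]natr1 ler_norml; lra.
have H3 := cvgM H1 H2; rewrite mul1r in H3.
rewrite (_ : (fun k => _) = (fun k => tau (Num.truncn (t k * a)) / (Num.truncn (t k * a)).+1%:R *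
  ((Num.truncn (t k * a)).+1%:R / t k))); last by apply/funext => k; rewrite mulrA divfK.
exact: H3.
Unshelve. all: by end_near. Qed.

Let V (a : R) (k : nat) : R := tau (Num.truncn (t k * a)) / t k.

Lemma step_sum_value k (z : tripleT) :
  let B := [&& 0 < z.1, 0 < z.2.1, (Num.truncn (t k * z.1) < N k)%N,
    (Num.truncn (t k * z.2.1) < Num.truncn (t k * z.1))%N & tau (Num.truncn (t k * z.1)) <= t k] in
  step_sum tau (t k) (N k) z =
  if B then \1_(@torus R d) (map_tuple ( *%R (((t k) `^ (d%:R^-1))^-1)) z.2.2) *
    (phi0 (rate gamma beta^-1 (V z.1 k, (V z.2.1 k, z.2.2))) * g (enorm z.2.2)) else 0.
Proof.
by move=> /=; rewrite step_sumE //=; case: ifPn => // _; rewrite rescaled_densityE.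
Qed.

Lemma rate_mono (k a b a' b' : R) (y : d.-tuple R) : 0 <= k -> 0 <= a <= a' -> 0 <= b <= b' ->
  rate gamma k (a, (b, y)) <= rate gamma k (a', (b', y)).
Proof.
move=> k0 /andP[a0 aa] /andP[b0 bb]; have /andP[g0 g1] := gammaP.
rewrite /rate /= ler_wpM2r ?exprn_ge0 ?enorm_ge0 // ler_pM ?mulr_ge0 ?powR_ge0 //.
  by rewrite ler_wpM2l // ge0_ler_powR ?nnegrE ?subr_ge0 ?(ltW g1) // (le_trans a0).
by rewrite ge0_ler_powR ?nnegrE ?(ltW g0) // (le_trans b0).
Qed.

Lemma rate_scale (k s a b : R) (y : d.-tuple R) : 0 < s -> 0 <= a -> 0 <= b ->
  rate gamma k (s * a, (s * b, y)) = rate gamma (s * k) (a, (b, y)).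
Proof.
move=> s0 a0 b0; rewrite /rate /= !powRM ?(ltW s0) //.
rewrite [RHS](_ : _ = (s `^ (1 - gamma) * s `^ gamma) * k * a `^ (1 - gamma) * b `^ gamma * enorm y ^+ d).
  by ring.
rewrite -powRD; last by apply/implyP => _; rewrite gt_eqF.
by rewrite subrK powRr1 // ltW.
Qed.

(** The scaled births are at least c times the coordinates. As the rate increases in both births and
    is homogeneous of degree 1 in them, this amounts to replacing 1 / beta by c / beta, and the
    profile only grows. A younger birth before t forces c a <= 1, hence the cut-off; the added 1
    makes that bound strict. *)
Lemma step_sum_le k z : `|step_sum tau (t k) (N k) z| <=
  M * limit_density gamma phi (c * beta^-1) (c^-1 + 1) z.
Proof.
have Mg r : 0 <= g r by have /andP[] := gM r.
have M0 : 0 <= M by have /andP[] := gM 0; exact: le_trans.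
rewrite step_sum_value; case: ifPn => [|_]; last first.
  by rewrite normr0 mulr_ge0 // (limit_density_ge0 gamma phiP).
case/and5P => a0 b0 iN ji it.
have ba : z.2.1 < z.1.
  rewrite ltNge; apply/negP => ab; move: ji; rewrite ltnNge => /negP; apply.
  by apply: le_truncn; rewrite ler_pM2l.
have aU : z.1 < c^-1 + 1.
  rewrite ltr_pwDr // -(ler_pM2l c0) mulfV ?gt_eqF //.
  by apply: (le_trans (tau_scaled_ge k a0)); rewrite ler_pdivrMr // mul1r.
rewrite /limit_density (indicE _ (wedge _)) mem_set; last by split => //; apply/andP; split.
rewrite mul1r ger0_norm; last by rewrite !mulr_ge0 // (clamped_ge0 phiP).
apply: (@le_trans _ _ (phi0 (rate gamma beta^-1 (V z.1 k, (V z.2.1 k, z.2.2))) * g (enorm z.2.2))).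
  by rewrite ler_piMl ?mulr_ge0 ?(clamped_ge0 phiP) // indicE lern1 leq_b1.
rewrite mulrC ler_pM ?(clamped_ge0 phiP) //; first by have /andP[] := gM (enorm z.2.2).
apply: (clamped_nonincreasing phiP).
case: z a0 b0 {iN ji it ba aU} => a [b y] /= a0 b0.
rewrite -rate_scale ?(ltW a0) ?(ltW b0) //; apply: rate_mono.
- by rewrite invr_ge0 ltW.
- by rewrite mulr_ge0 ?(ltW c0) ?(ltW a0) //= tau_scaled_ge.
- by rewrite mulr_ge0 ?(ltW c0) ?(ltW b0) //= tau_scaled_ge.
Qed.
End limit.
End step_sum_limit.

Lemma cvg_powR_gt0 (R : realType) (p l : R) (u : nat -> R) : 0 < l ->
  u @ \oo --> l -> (fun k => u k `^ p) @ \oo --> l `^ p.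
Proof.
move=> l0 ul; have H := @continuous_powR_gt0 R p l l0.
by have := @continuous_cvg _ _ _ (nbhs \oo) _ u (fun x : R => x `^ p) l H ul; exact.
Qed.

Section mean_sum_cvg.
Context (R : realType) (d : nat) (gamma beta : R) (phi : R -> R).
Hypotheses (d0 : (0 < d)%N) (gammaP : 0 < gamma < 1) (beta0 : 0 < beta).
Hypothesis phiP : profile d phi.
Local Notation mu := (@lebesgue_measure R).
Local Notation tripleT := (measurableTypeR R * (measurableTypeR R * d.-tuple R))%type.
Local Notation phi0 := (clamped phi).
Local Notation rate := (@rate R d gamma beta^-1).

(* Off this null set the step functions converge.  For fixed second birth time
   and displacement, [rate] is injective in the first birth time, so each section
   of the last clause is countable, [phi] being monotone. *)
Definition exceptional : set tripleT :=
  [set z | [\/ z.1 = z.2.1, z.1 = 1 |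
     [/\ 0 < z.1, 0 < z.2.1, enorm z.2.2 != 0 & ~ {for rate z, continuous phi0}]]].

Let m1 : measurable_fun setT (fun z : tripleT => z.1 : R).
Proof. exact: measurable_fst. Qed.
Let m2 : measurable_fun setT (fun z : tripleT => z.2.1 : R).
Proof. exact: (measurableT_comp measurable_fst measurable_snd). Qed.

Lemma measurable_exceptional : measurable exceptional.
Proof.
have cm (D : set R) (f : tripleT -> R) : measurable_fun setT f -> measurable D ->
    measurable (f @^-1` D).
  by move=> mf mD; rewrite -[X in measurable X]setTI; exact: mf.
have mD : measurable [set r : R | ~ {for r, continuous phi0}].
  apply: countable_measurable; first exact: measurable_set1.
  exact: clamped_noncontinuous_countable phiP.
pose A1 := (fun z : tripleT => z.1 - z.2.1 : R) @^-1` [set 0].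
pose A2 := (fun z : tripleT => z.1 : R) @^-1` [set 1].
pose A3 := (fun z : tripleT => z.1 : R) @^-1` `]0, +oo[%classic.
pose A4 := (fun z : tripleT => z.2.1 : R) @^-1` `]0, +oo[%classic.
pose A5 := ~` ((fun z : tripleT => enorm z.2.2) @^-1` [set 0]).
pose A6 := rate @^-1` [set r | ~ {for r, continuous phi0}].
rewrite (_ : exceptional = A1 `|` A2 `|` (A3 `&` A4 `&` A5 `&` A6)).
  apply: measurableU; first apply: measurableU.
  - by apply: cm; [exact: measurable_funB|exact: measurable_set1].
  - by apply: cm => //; exact: measurable_set1.
  - apply: measurableI; last by apply: cm => //; exact: measurable_rate.
    apply: measurableI; last first.
      by apply: measurableC; apply: cm; [exact: measurable_norm3|exact: measurable_set1].
    by apply: measurableI; apply: cm => //; exact: measurable_itv.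
apply/seteqP; split => z; rewrite /exceptional /A1 /A2 /A3 /A4 /A5 /A6 /= !in_itv /= !andbT.
  case=> [->|->|[z1 z2 /eqP z3 z4]]; first by left; left; rewrite subrr.
    by left; right.
  by right.
case=> [[/subr0_eq ->|->]|[[[z1 z2] /eqP z3] z4]].
- exact: Or31.
- exact: Or32.
- by apply: Or33; split.
Qed.

Lemma exceptional_null : @lebesgue_triple R d exceptional = 0%E.
Proof.
have /andP[g0 g1] := gammaP.
apply: lebesgue_triple_null; first exact: measurable_exceptional.
move=> [b y]; apply: countable_lebesgue_measure0.
(* On the section the rate is K a^(1 - gamma), so a is recovered from it as (rate / K)^(1 / (1 -
   gamma)); the third clause is covered by the image of the countable set of discontinuities. *)
pose K := beta^-1 * b `^ gamma * enorm y ^+ d.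
pose F (n : nat) : set R := match n with
  | 0 => [set b] | 1 => [set 1]
  | _ => (fun r => (r / K) `^ ((1 - gamma)^-1)) @` [set r | ~ {for r, continuous phi0}] end.
apply: (@sub_countable _ _ _ (\bigcup_(n in @setT nat) F n)); last first.
  apply: bigcup_countable => // -[|[|n]] _; [exact: countable1|exact: countable1|].
  apply: sub_countable (card_image_le _ _) _.
  exact: clamped_noncontinuous_countable phiP.
apply: subset_card_le => a /=; rewrite /ysection /= => /set_mem.
rewrite /exceptional /= => -[->|->|[a0 b0 y0 H]].
- by exists 0%N.
- by exists 1%N.
exists 2%N => //; exists (rate (a, (b, y))) => //.
have K0 : 0 < K.
  by rewrite !mulr_gt0 ?invr_gt0 ?powR_gt0 ?exprn_gt0 // lt_def y0 enorm_ge0.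
have -> : rate (a, (b, y)) = a `^ (1 - gamma) * K by rewrite /rate /= /K; ring.
rewrite mulfK ?gt_eqF //.
by rewrite -powRrM mulfV ?powRr1 ?(ltW a0) // gt_eqF // subr_gt0.
Qed.

(** The dilated torus exhausts R^d. Every coordinate is bounded by |y|, so t^(1/d) >= 2 |y| + 1 puts
    all rescaled coordinates strictly within 1/2. *)
Lemma torus_near (y : d.-tuple R) (t : nat -> R) : (forall k, 0 < t k) -> t @ \oo --> +oo ->
  \forall k \near \oo, @torus R d (map_tuple ( *%R (((t k) `^ (d%:R^-1))^-1)) y).
Proof.
move=> t0 toy.
have : \forall k \near \oo, (2 * enorm y + 1) ^+ d <= t k by have /cvgryPge := toy; exact.
apply: filterS => k H i; rewrite tnth_map.
have t1 : 0 < t k `^ d%:R^-1 by exact: powR_gt0.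
have yi : `|tnth y i| <= enorm y.
  rewrite /enorm -sqrtr_sqr ler_wsqrtr // (bigD1 i) //= lerDl sumr_ge0 // => j _.
  exact: sqr_ge0.
have tk : 2 * enorm y + 1 <= t k `^ d%:R^-1.
  rewrite -(@ler_pXn2r _ d d0) ?nnegrE ?(ltW t1) ?addr_ge0 ?mulr_ge0 ?enorm_ge0 //.
  by rewrite powR_root.
suff : `|(t k `^ d%:R^-1)^-1 * tnth y i| < 2^-1 by rewrite ltr_norml => /andP[-> /ltW ->].
rewrite normrM gtr0_norm ?invr_gt0 // mulrC ltr_pdivrMr //.
by have := enorm_ge0 y; lra.
Qed.

Context (g : R -> R) (M : R).
Hypotheses (mg : measurable_fun setT g) (gM : forall r, 0 <= g r <= M).
Local Notation step_sum := (@step_sum R d gamma beta phi g).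
Local Notation mean_sum := (@mean_sum R d gamma beta phi g).

Context (tau : nat -> R) (c : R).
Hypotheses (c0 : 0 < c) (tau_ge : forall n, c * n.+1%:R <= tau n).
Hypothesis tau_cvg : (fun n => tau n / n.+1%:R) @ \oo --> (1 : R).
Context (t : nat -> R) (N : nat -> nat).
Hypotheses (t0 : forall k, 0 < t k) (toy : t @ \oo --> +oo).
Hypothesis tN : forall k, t k < c * (N k)%:R.

Let tau0 n : 0 < tau n.
Proof. by apply: lt_le_trans (tau_ge n); rewrite mulr_gt0. Qed.

Lemma cvg_rate (a b : nat -> R) (a0 b0 : R) (y : d.-tuple R) : 0 < a0 -> 0 < b0 ->
  a @ \oo --> a0 -> b @ \oo --> b0 ->
  (fun k => rate (a k, (b k, y))) @ \oo --> rate (a0, (b0, y)).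
Proof.
move=> a00 b00 ha hb; rewrite /rate /=.
apply: cvgM; last exact: cvg_cst.
apply: cvgM; last exact: cvg_powR_gt0.
apply: cvgM; first exact: cvg_cst.
exact: cvg_powR_gt0.
Qed.

Lemma step_sum_cvg (z : tripleT) : ~ exceptional z ->
  (fun k => step_sum tau (t k) (N k) z) @ \oo -->
    limit_density gamma phi beta^-1 1 z * g (enorm z.2.2).
Proof.
case: z => a [b y] /=; rewrite /exceptional /= => nE.
have ab : a != b by apply/eqP => H; apply: nE; exact: Or31.
have a1 : a != 1 by apply/eqP => H; apply: nE; exact: Or32.
pose V (x : R) (k : nat) : R := tau (Num.truncn (t k * x)) / t k.
have ssE k := step_sum_value gamma phi d0 beta0 g c0 tau_ge N t0 k (a, (b, y)).
(* Outside the wedge the limit density is 0, so there it suffices that the step sums vanish from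
   some k on. *)
have zero : (\forall k \near \oo, step_sum tau (t k) (N k) (a, (b, y)) = 0) ->
    ~ (0 < b < a /\ a < 1) ->
  (fun k => step_sum tau (t k) (N k) (a, (b, y))) @ \oo -->
    limit_density gamma phi beta^-1 1 (a, (b, y)) * g (enorm y).
  move=> H W; rewrite /limit_density indicE memNset // !mul0r.
  by apply: cvg_near_cst; exact: H.
have [a0|a0] := ltP 0 a; last first.
  apply: zero.
    by near=> k; rewrite ssE /= ltNge a0.
  by case=> /andP[b0 ba] _; move: (lt_trans b0 ba); rewrite ltNge a0.
have [b0|b0] := ltP 0 b; last first.
  apply: zero.
    by near=> k; rewrite ssE /= (ltNge _ b) b0 andbF.
  by case=> /andP[b0'] _ _; move: b0'; rewrite ltNge b0.
have [ba|{}ab] := ltP b a; last first.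
  apply: zero.
    near=> k; rewrite ssE /= (ltnNge (Num.truncn (t k * b))).
    by rewrite (le_truncn (x := t k * a)) ?ler_pM2l //= !andbF.
  by case=> /andP[_] ba _; move: ba; rewrite ltNge ab.
have Va : V a @ \oo --> a by exact: tau_scaled_cvg.
have Vb : V b @ \oo --> b by exact: tau_scaled_cvg.
have [a1'|{}a1'] := ltP a 1; last first.
  have {a1'}a1' : 1 < a by rewrite lt_def a1.
  apply: zero.
    have : \forall k \near \oo, 1 < V a k by apply: (cvgr_gt a).
    apply: filterS => k; rewrite /V ltr_pdivlMr // mul1r => H.
    by rewrite ssE /= (leNgt _ (t k)) H /= !andbF.
  by case=> _; rewrite ltNge (ltW a1').
rewrite /limit_density indicE mem_set; last by split => //; apply/andP.
rewrite mul1r.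
have key : (fun k => phi0 (rate (V a k, (V b k, y)))) @ \oo --> phi0 (rate (a, (b, y))).
  (* At zero displacement the rate is 0 for every k, so the sequence is constant. *)
  have [y0|y0] := eqVneq (enorm y) 0.
    rewrite (_ : (fun k => _) = (fun k => phi0 0)); last first.
      by apply/funext => k; rewrite /rate /= y0 expr0n gtn_eqF ?d0 // mulr0.
    by rewrite /rate /= y0 expr0n gtn_eqF ?d0 // mulr0; exact: cvg_cst.
  have cphi : {for rate (a, (b, y)), continuous phi0}.
    by apply: contrapT => H; apply: nE; apply: Or33; split.
  have crate : (fun k => rate (V a k, (V b k, y))) @ \oo --> rate (a, (b, y)) by exact: cvg_rate.
  by have := @continuous_cvg _ _ _ (nbhs \oo) _ _ phi0 _ cphi crate; exact.
have {}key : (fun k => phi0 (rate (V a k, (V b k, y))) * g (enorm y)) @ \oo -->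
    phi0 (rate (a, (b, y))) * g (enorm y).
  by apply: cvgM key _; exact: cvg_cst.
apply: cvg_trans key; apply: near_eq_cvg.
have Va1 : \forall k \near \oo, V a k < 1 by apply: (cvgr_lt a).
(* Once t >= 1 / (a - b), the numbers t a and t b are at least 1 apart, so their integer parts
   differ and the pair is correctly ordered. *)
have tb : \forall k \near \oo, (a - b)^-1 <= t k by have /cvgryPge := toy; exact.
have ty := torus_near y t0 toy.
near=> k.
have H1 : V a k < 1 by near: k.
have H2 : (a - b)^-1 <= t k by near: k.
have H3 : @torus R d (map_tuple ( *%R (((t k) `^ (d%:R^-1))^-1)) y) by near: k.
rewrite ssE /= a0 b0 /=.
move: H1; rewrite /V ltr_pdivrMr // mul1r => H1.
rewrite ifT; first by rewrite indicE mem_set // mul1r.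
apply/and3P; split; last exact: ltW.
  rewrite -(ltr_nat R) -(ltr_pM2l c0); apply: lt_trans (tN k).
  by apply: le_lt_trans H1; apply: le_trans (tau_ge _); rewrite ler_pM2l // ler_nat.
rewrite truncn_gt_nat -natr1.
have /andP[h1 _] := @truncn_itv R (t k * b) (mulr_ge0 (ltW (t0 k)) (ltW b0)).
have : 1 <= t k * (a - b) by rewrite -(@ler_pdivrMr _ (a - b)) ?subr_gt0 // div1r.
rewrite mulrBr; lra.
Unshelve. all: by end_near. Qed.

Lemma mean_sum_cvg : (fun k => mean_sum tau (t k) (N k) / t k) @ \oo -->
  fine (\int[@lebesgue_triple R d]_z
    ((limit_density gamma phi beta^-1 1 z)%:E * (g (enorm z.2.2))%:E))%E.
Proof.
have /andP[g0 g1] := gammaP.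
have Mg r : 0 <= g r by have /andP[] := gM r.
have M0 : 0 <= M by have /andP[] := gM 0; exact: le_trans.
pose f_ k (z : tripleT) := (step_sum tau (t k) (N k) z)%:E.
pose f (z : tripleT) := (limit_density gamma phi beta^-1 1 z * g (enorm z.2.2))%:E.
pose G (z : tripleT) := (M%:E * (limit_density gamma phi (c * beta^-1) (c^-1 + 1) z)%:E)%E.
have mf_ k : measurable_fun setT (f_ k) by apply/measurable_EFinP; exact: measurable_step_sum.
have mf : measurable_fun setT f.
  apply/measurable_EFinP; apply: measurable_funM; first exact: measurable_limit_density.
  by apply: measurableT_comp => //; exact: measurable_norm3.
have mG : measurable_fun setT (fun z : tripleT => (limit_density gamma phi (c * beta^-1) (c^-1 + 1) z)%:E).
  by apply/measurable_EFinP; exact: measurable_limit_density.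
have iG : (@lebesgue_triple R d).-integrable setT G.
  apply: integrableZl => //; apply/integrableP; split => //.
  under eq_integral do rewrite gee0_abs ?lee_fin ?limit_density_ge0 //.
  by rewrite mass_limit_density ?mulr_gt0 ?invr_gt0 ?ltry // addr_gt0 // invr_gt0.
have f_f : {ae @lebesgue_triple R d, forall z, setT z -> f_ ^~ z @ \oo --> f z}.
  exists exceptional; split; [exact: measurable_exceptional|exact: exceptional_null|].
  move=> z /= H; apply: contrapT => nE; apply: H => _.
  by apply: cvg_EFin; [exact: nearW|exact: step_sum_cvg].
have f_G : {ae @lebesgue_triple R d, forall z k, setT z -> (`|f_ k z| <= G z)%E}.
  apply: aeW => z k _; rewrite /f_ /G abse_EFin -EFinM lee_fin.
  exact: (step_sum_le d0 gammaP beta0 phiP gM c0 tau_ge).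
have [intf _] := @dominated_convergence _ _ R (@lebesgue_triple R d) setT measurableT f_ f G
  mf_ mf f_f iG f_G.
have -> : (\int[@lebesgue_triple R d]_z
    ((limit_density gamma phi beta^-1 1 z)%:E * (g (enorm z.2.2))%:E) = \int[@lebesgue_triple R d]_z f z)%E.
  by [].
rewrite (_ : (fun k => _) = (fun k => (mean_sum tau (t k) (N k) / t k)%:E)); last first.
  by apply/funext => k; exact: integral_step_sum.
rewrite -{1}(fineK (integrable_fin_num measurableT intf)) => H.
exact: fine_cvg H.
Qed.
End mean_sum_cvg.

(** * Independence and conditioning *)

Section independence.
Context (dO : measure_display) (Omega : measurableType dO) (R : realType).
Context (P : probability Omega R) (I : choiceType) (F : I -> set_system Omega).
Hypothesis Fm : forall i A, F i A -> measurable A.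
Hypothesis FT : forall i, F i setT.
Hypothesis FI : forall i A B, F i A -> F i B -> F i (A `&` B).
Hypothesis Find : mutually_independent P F.

(** For fixed B, the measures P (A [&] B) and P B * P A agree on finite intersections of events with
    indices other than v. These form a pi-system generating the sigma-algebra, so the two measures
    agree on all of it. *)
Lemma independent_rest (v : I) (A B : set Omega) :
  <<s \bigcup_(i in [set i | i != v]) F i >> A -> F v B ->
  P (A `&` B) = (P A * P B)%E.
Proof.
move=> sA FB; have mB := Fm FB.
pose G : set_system Omega := [set C | exists J : {fset I}, v \notin J /\
  exists D : I -> set Omega, (forall i, F i (D i)) /\ C = \bigcap_(i in [set` J]) D i].
have mG : G `<=` measurable.
  move=> C [J [_ [D [FD ->]]]]; apply: fin_bigcap_measurable => // i _.
  exact: Fm (FD i).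
have IG : setI_closed G.
  move=> _ _ [J1 [vJ1 [D1 [FD1 ->]]]] [J2 [vJ2 [D2 [FD2 ->]]]].
  exists (J1 `|` J2)%fset; split; first by rewrite in_fsetU negb_or vJ1.
  (* Each family is completed by the sure event outside its own index set, so the intersection of
     two members is again a member. *)
  exists (fun i => (if i \in J1 then D1 i else setT) `&` (if i \in J2 then D2 i else setT)).
  split=> [i|]; first by apply: FI; case: ifP.
  apply/seteqP; split => w /=.
    move=> [H1 H2] i /= _; split; case: ifPn => // iJ; [exact: H1|exact: H2].
  move=> H; split => i /= iJ.
    have := H i; rewrite /= in_fsetU iJ => /(_ isT) [] //.
  have := H i; rewrite /= in_fsetU iJ orbT => /(_ isT) [] //.
have sub : <<s \bigcup_(i in [set i | i != v]) F i >> `<=` <<s G >>.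
  apply: sub_sigma_algebra2 => C [i /= iv FC].
  exists [fset i]%fset; split; first by rewrite in_fset1 eq_sym.
  exists (fun j => if j == i then C else setT); split.
    by move=> j; case: eqP => [->|_].
  apply/seteqP; split => w /=.
    by move=> Cw j /=; rewrite in_fset1 => ->.
  by move=> /(_ i); rewrite /= in_fset1 eqxx; exact.
have PB0 : 0 <= fine (P B) by exact: fine_ge0.
have PBE : (fine (P B))%:E = P B by rewrite fineK // fin_num_measure.
have : mrestr P mB A = mscale (NngNum PB0) P A.
  apply: (@g_sigma_algebra_measure_unique _ R Omega G mG (fun=> setT)) => //.
  - move=> _; exists fset0; split => //; exists (fun=> setT); split => //.
    by rewrite set_fset0 bigcap_set0.
  - by rewrite bigcup_const.
  - move=> _ [J [vJ [D [FD ->]]]].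
    rewrite -[LHS]/(P (_ `&` B)) -[RHS]/((fine (P B))%:E * P _)%E PBE.
    have H1 := @Find J D (fun i _ => FD i).
    have H2 := @Find (v |` J)%fset (fun i => if i == v then B else D i).
    rewrite {}H1.
    have -> : \bigcap_(i in [set` J]) D i `&` B =
        \bigcap_(i in [set` (v |` J)%fset]) (if i == v then B else D i).
      apply/seteqP; split => w /=.
        by move=> [H Bw] i /=; rewrite in_fset1U; case: eqVneq => //= _; exact: H.
      move=> H; split; last by have := H v; rewrite /= in_fset1U eqxx; exact.
      move=> i /= iJ; have := H i; rewrite /= in_fset1U iJ orbT => /(_ isT).
      by rewrite ifN //; apply: contraNneq vJ => <-.
    rewrite H2; last by move=> i _; case: eqP => [->|_].
    rewrite big_fsetU1 //= eqxx; congr (_ * _)%E.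
    rewrite !big_seq; apply: eq_bigr => i iJ; rewrite ifN //.
    by apply: contraNneq vJ => <-.
  - move=> k; rewrite -[ltLHS]/(P (setT `&` B)) setTI.
    by rewrite (le_lt_trans (probability_le1 P mB)) ?ltry.
  - exact: sub.
by rewrite -[LHS]/(P (A `&` B)) -[RHS]/((fine (P B))%:E * P _)%E PBE muleC.
Qed.
End independence.

Section sub_sigma.
Context (dO : measure_display) (Omega : measurableType dO) (R : realType).
Context (P : probability Omega R) (S : set_system Omega).
Hypothesis Sm : S `<=` measurable.
Local Notation OS := (g_sigma_algebraType S).

Lemma measurable_sub_sigma (A : set Omega) : <<s S >> A -> measurable A.
Proof. by apply: smallest_sub => //; exact: sigma_algebra_measurable. Qed.

Lemma measurable_fun_sub_sigma d (T : measurableType d) (f : Omega -> T) :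
  measurable_fun (setT : set OS) (f : OS -> T) -> measurable_fun (setT : set Omega) f.
Proof.
move=> mf _ B mB; apply: measurable_sub_sigma.
by have := mf measurableT B mB.
Qed.

(** This takes the place of conditional expectation: two functions with equal integrals over all
    events of the sub-sigma-algebra define one measure there, and both sides integrate [F] against
    it. *)
Lemma ge0_integral_eq_density (f1 f2 : Omega -> R) (F : OS -> R) :
  measurable_fun setT f1 -> measurable_fun setT f2 ->
  (forall w, 0 <= f1 w) -> (forall w, 0 <= f2 w) ->
  (forall A, <<s S >> A ->
    (\int[P]_(w in A) (f1 w)%:E = \int[P]_(w in A) (f2 w)%:E)%E) ->
  measurable_fun setT F -> (forall w, 0 <= F w) ->
  (\int[P]_w (f1 w * F w)%:E = \int[P]_w (f2 w * F w)%:E)%E.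
Proof.
move=> mf1 mf2 f10 f20 f12 mF F0.
pose nu (A : set OS) : \bar R := (\int[P]_(w in (A : set Omega)) (f1 w)%:E)%E.
have nu0 : nu set0 = 0%E by rewrite /nu integral_set0.
have nu_ge0 A : (0 <= nu A)%E by apply: integral_ge0 => z _; rewrite lee_fin.
have nu_sigma : semi_sigma_additive nu.
  move=> A mA tA mUA.
  apply: (@semi_sigma_additive_nng_induced _ _ R P (EFin \o f1)).
  - by apply/measurable_EFinP.
  - by move=> z; rewrite /= lee_fin.
  - by move=> i; exact: measurable_sub_sigma (mA i).
  - exact: tA.
  - exact: measurable_sub_sigma mUA.
pose nuM := isMeasure.Build _ _ _ nu nu0 nu_ge0 nu_sigma.
pose num : {measure set OS -> \bar R} := HB.pack nu nuM.
(* The identity into the same set with the coarser sigma-algebra turns the restriction of a measure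
   into an image measure. *)
have mid : measurable_fun setT (idfun : Omega -> OS).
  by move=> _ A mA; rewrite setTI; exact: measurable_sub_sigma mA.
have mFE : measurable_fun setT (EFin \o F) by exact/measurable_EFinP.
have FE0 w : (0 <= (EFin \o F) w)%E by rewrite lee_fin.
have H1 := @ge0_integral_density _ _ _ _ R P num f1 idfun mf1 mid f10 (fun A _ => erefl) _ mFE FE0.
have H2 := @ge0_integral_density _ _ _ _ R P num f2 idfun mf2 mid f20 (fun A mA => f12 A mA) _ mFE FE0.
transitivity (\int[P]_w ((f1 w)%:E * (F w)%:E))%E.
  by apply: eq_integral => w _; rewrite EFinM.
transitivity (\int[P]_w ((f2 w)%:E * (F w)%:E))%E; last first.
  by apply: eq_integral => w _; rewrite EFinM.
by rewrite -H1.
Qed.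

(** Freezing: a variable independent of the sub-sigma-algebra may be integrated out while everything
    measurable for the latter is held fixed. Independence says that the joint law of the outcome and
    [X] is a product on rectangles, hence everywhere, and Tonelli applies. *)
Lemma ge0_integral_freeze d (T : measurableType d) (X : Omega -> T)
    (nu : probability T R) (f : OS * T -> R) :
  measurable_fun setT X ->
  (forall A B, <<s S >> A -> measurable B ->
     P (A `&` X @^-1` B) = (P A * nu B)%E) ->
  measurable_fun setT f -> (forall z, 0 <= f z) ->
  (\int[P]_w (f (w, X w))%:E = \int[P]_w \int[nu]_x (f (w, x))%:E)%E.
Proof.
move=> mX PX mf f0.
have mid : measurable_fun setT (idfun : Omega -> OS).
  by move=> _ A mA; rewrite setTI; exact: measurable_sub_sigma mA.
pose idM := isMeasurableFun.Build _ _ _ _ (idfun : Omega -> OS) mid.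
pose idm : {mfun Omega >-> OS} := HB.pack (idfun : Omega -> OS) idM.
pose Phi (w : Omega) : OS * T := (w, X w).
have mPhi : measurable_fun setT Phi by apply: measurable_fun_pair.
pose PhiM := isMeasurableFun.Build _ _ _ _ Phi mPhi.
pose Phim : {mfun Omega >-> (OS * T)%type} := HB.pack Phi PhiM.
pose PS : probability OS R := distribution P idm.
have mfE : measurable_fun setT (EFin \o f) by exact/measurable_EFinP.
have fE0 z : (0 <= (EFin \o f) z)%E by rewrite lee_fin.
transitivity (\int[distribution P Phim]_z (EFin \o f) z)%E.
  by rewrite ge0_integral_distribution.
transitivity (\int[product_measure1 PS nu]_z (EFin \o f) z)%E.
  apply: eq_measure_integral => A mA _; apply/esym.
  by apply: product_measure_unique => // B C mB mC; exact: PX.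
rewrite fubini_tonelli1 // /fubini_F.
rewrite (@ge0_integral_distribution _ _ _ _ R P idm) //.
  apply: (@measurable_fun_fubini_tonelli_F _ _ _ _ _ nu (EFin \o f)) => //.
by move=> w; apply: integral_ge0.
Qed.
End sub_sigma.

(** * A strong law for the births *)

Section exponential_moments.
Context (R : realType) (dO : measure_display) (Omega : measurableType dO).
Context (P : probability Omega R) (X : Omega -> R).
Hypothesis mX : measurable_fun setT X.
Hypothesis XP : forall B : set R, measurable B -> P (X @^-1` B) = exponential_prob 1 B.
Local Notation mu := (@lebesgue_measure R).

Let measurable_pdf r : measurable_fun setT (fun x : R => (exponential_pdf r x)%:E).
Proof. by apply/measurable_EFinP; exact: measurable_exponential_pdf. Qed.

Let pdf_ge0 (r x : R) : 0 <= r -> (0 <= (exponential_pdf r x)%:E)%E.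
Proof. by move=> r0; rewrite lee_fin exponential_pdf_ge0. Qed.

Let mXA (A : set R) : measurable A -> measurable (X @^-1` A).
Proof. by move=> mA; rewrite -[X in measurable X]setTI; exact: mX. Qed.

Lemma exponential_gt0_ae : P (X @^-1` `]0, +oo[) = 1%E.
Proof.
rewrite (_ : X @^-1` `]0, +oo[ = ~` (X @^-1` `]-oo, 0])); last first.
  apply/seteqP; split => w /=; rewrite !in_itv /= andbT; first by rewrite ltNge => /negP.
  by rewrite ltNge => /negP.
rewrite probability_setC; last exact: mXA.
rewrite XP // /exponential_prob -integral_itv_bndo_bndc; last exact: measurable_funTS.
rewrite integral0_eq ?sube0 // => x /=; rewrite in_itv /= => x0.
by rewrite lt0_exponential_pdf.
Qed.

Lemma exponential_tail (r : R) : 0 < r -> P (X @^-1` `]r, +oo[) = (expR (- r))%:E.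
Proof.
move=> r0.
have mA (a b : itv_bound R) : measurable (X @^-1` [set` Interval a b]).
  by apply: mXA; exact: measurable_itv.
have H0 : P (X @^-1` `]-oo, 0[) = 0%E.
  rewrite XP // /exponential_prob integral0_eq // => x /=; rewrite in_itv /= => x0.
  by rewrite lt0_exponential_pdf.
have -> : X @^-1` `]r, +oo[ = ~` (X @^-1` `]-oo, 0[ `|` X @^-1` `[0, r]).
  apply/seteqP; split => w /=; rewrite !in_itv /= andbT.
    move=> rX [X0|/andP[_ Xr]]; first by move: (lt_trans X0 r0); rewrite ltNge (ltW rX).
    by move: rX; rewrite ltNge Xr.
  move=> H; rewrite ltNge; apply/negP => Xr; apply: H.
  by have [X0|X0] := ltP (X w) 0; [left|right; apply/andP; split].
rewrite probability_setC; last exact: measurableU.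
rewrite measureU //; last first.
  apply/seteqP; split => w //=; rewrite !in_itv /= => -[X0 /andP[X1 _]].
  by move: X0; rewrite ltNge X1.
rewrite [X in (_ - X)%E](_ : _ = P (X @^-1` `[0, r])); last by rewrite /= H0 add0e.
rewrite XP // exponential_prob_itv0c //.
transitivity ((1 - (1 - expR (-1 * r)))%:E); first by [].
by rewrite mulN1r opprB addrC subrK.
Qed.

(** The mean is the integral of the tail, and at rate 1 the tail and the density coincide on the
    positive half-line, so it equals the total mass 1. *)
Lemma exponential_mean : (\int[P]_w (Num.max (X w) 0)%:E = 1)%E.
Proof.
have mX0 : measurable_fun setT (fun w => Num.max (X w) 0) by exact: measurable_maxr.
pose XM := isMeasurableFun.Build _ _ _ _ _ mX0.
pose X0 : {RV P >-> R} := HB.pack (fun w => Num.max (X w) 0) XM.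
rewrite -[LHS](expectation_def X0) ge0_expectation_ccdf; last first.
  by move=> w; rewrite /= le_max lexx orbT.
rewrite -integral_itv_obnd_cbnd; last first.
  by apply: measurable_funTS; exact: ccdf_measurable.
rewrite -(@integral_exponential_pdf R 1) //.
transitivity (\int[mu]_(r in `]0%R, +oo[) (exponential_pdf 1 r)%:E)%E.
  apply: eq_integral => r /set_mem /=; rewrite in_itv /= andbT => r0.
  rewrite exponential_pdfE ?ltW // mul1r mulN1r -exponential_tail // /ccdf /distribution /pushforward /=.
  congr (P _); apply/seteqP; split => w /=; rewrite !in_itv /= !andbT lt_max.
    by case/orP => //; rewrite ltNge (ltW r0).
  by move=> ->.
rewrite integral_itv_obnd_cbnd; last exact: measurable_funTS.
rewrite integral_mkcond; apply: eq_integral => x _; rewrite patchE.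
case: ifPn => // /negP x0; rewrite lt0_exponential_pdf // ltNge; apply/negP => H.
by apply: x0; apply/mem_set; rewrite /= in_itv /= H.
Qed.

(* The constant comes from x^2 <= 16 exp (x / 2). *)
Lemma exponential_second_moment : (\int[P]_w ((Num.max (X w) 0) ^+ 2)%:E <= 32%:E)%E.
Proof.
pose h (x : R) := (Num.max x 0) ^+ 2.
have mh : measurable_fun setT h by apply: measurable_funX; exact: measurable_maxr.
pose XM := isMeasurableFun.Build _ _ _ _ _ mX.
pose X0 : {mfun Omega >-> R} := HB.pack X XM.
rewrite -[leLHS](@ge0_integral_distribution _ _ _ _ R P X0 (EFin \o h)); last 2 first.
- exact/measurable_EFinP.
- by move=> x; rewrite /= lee_fin sqr_ge0.
rewrite (@ge0_integral_density _ _ _ _ R mu (distribution P X0) (exponential_pdf 1) idfun); last 6 first.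
- exact: measurable_exponential_pdf.
- exact: measurable_id.
- by move=> x; exact: exponential_pdf_ge0.
- by move=> A mA; exact: (XP mA).
- exact/measurable_EFinP.
- by move=> x; rewrite /= lee_fin sqr_ge0.
(* For x >= 0, 16 exp (x / 2) times the density exp (- x) is 16 exp (- x / 2), which is 32 times the
   exponential density of rate 1/2. *)
apply: (@le_trans _ _ (\int[mu]_x (32%:E * (exponential_pdf (2^-1) x)%:E))%E); last first.
  rewrite ge0_integralZl //.
  - by rewrite integral_exponential_pdf ?invr_gt0 // mule1.
  - exact: measurable_pdf.
  - by move=> x _; apply: pdf_ge0; rewrite invr_ge0.
apply: ge0_le_integral => //.
- by move=> x _; apply: mule_ge0; [exact: pdf_ge0|rewrite /= lee_fin sqr_ge0].
- by apply: emeasurable_funM; [exact: measurable_pdf|exact/measurable_EFinP].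
- by apply: emeasurable_funM; [exact: measurable_cst|exact: measurable_pdf].
move=> x _; rewrite -!EFinM lee_fin /h /=.
have [x0|x0] := ltP x 0; first by rewrite !lt0_exponential_pdf // mul0r mulr0.
rewrite !exponential_pdfE ?invr_ge0 // mul1r mulN1r ?max_l //.
have e4 : x / 4 <= expR (x / 4).
  by apply: le_trans (expR_ge1Dx _); rewrite lerDr.
have e2 : x ^+ 2 <= 16 * expR (x / 2).
  rewrite (_ : x / 2 = 2%:R * (x / 4)); last by field.
  rewrite expRM_natl (_ : x ^+ 2 = 16 * (x / 4) ^+ 2); last by field.
  by rewrite ler_pM2l // ler_pXn2r ?nnegrE ?divr_ge0 // ltW // expR_gt0.
rewrite [leRHS](_ : _ = 16 * expR (- 2^-1 * x)); last by field.
have -> : expR (- x) = (expR (x / 2))^-1 * expR (- 2^-1 * x).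
  by rewrite -expRN -expRD; congr expR; field.
by rewrite mulrAC ler_pM2r ?expR_gt0 // mulrC ler_pdivrMr ?expR_gt0.
Qed.
End exponential_moments.

(* Consecutive squares have ratio tending to 1, so monotonicity fills the gaps. *)
Lemma cvg_average_of_squares (R : realType) (S : nat -> R) :
  (forall n, 0 <= S n) -> {homo S : m n / (m <= n)%N >-> m <= n} ->
  (fun k => S (k.+1 ^ 2)%N / (k.+1 ^ 2)%:R) @ \oo --> (1 : R) ->
  (fun n => S n.+1 / n.+1%:R) @ \oo --> (1 : R).
Proof.
move=> S0 ndS H; apply/cvgrPdist_le => e e0.
(* Two factors 1 + e' are lost, one from the squares and one from the ratio of consecutive squares;
   since e' <= 1/8, the product stays within 1 + e. *)
pose e' := Num.min (e / 8) (1 / 8).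
have e'0 : 0 < e' by rewrite lt_min !divr_gt0.
have e'e : e' <= e / 8 by rewrite ge_min lexx.
have e'1 : e' <= 1 / 8 by rewrite ge_min lexx orbT.
have /cvgrPdist_le /(_ _ e'0) [K0 _ HK0] := H.
(* Beyond 3 / e' one has 2 k + 1 <= 3 k <= e' k^2, so (k + 1)^2 <= (1 + e') k^2. *)
pose K := maxn K0 (Num.truncn (3 / e')).+1.
have kK (k : nat) : (K <= k)%N -> 3 <= e' * k%:R.
  move=> Kk; rewrite mulrC -ler_pdivrMr // ltW // (lt_le_trans (truncnS_gt _)) // ler_nat.
  exact: leq_trans (leq_maxr _ _) Kk.
exists (K.+2 ^ 2)%N => // n /= Kn.
have [k /andP[kn nk]] : exists k, (k ^ 2 <= n.+1 < k.+1 ^ 2)%N.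
  have ex : exists k, (k ^ 2 <= n.+1)%N by exists 0%N.
  have bd k : (k ^ 2 <= n.+1)%N -> (k <= n.+1)%N.
    by apply: leq_trans; rewrite -mulnn; case: k => // k; rewrite leq_pmulr.
  case: (ex_maxnP ex bd) => k kn kmax; exists k; rewrite kn /= ltnNge.
  by apply/negP => /kmax; rewrite ltnn.
have Kk : (K.+1 <= k)%N.
  rewrite leqNgt; apply/negP => kK1.
  have : (k.+1 ^ 2 <= n)%N by apply: leq_trans Kn; rewrite leq_exp2r // ltnW.
  by move=> h; move: nk; rewrite ltnNge (leq_trans h).
have k0 : (0 < k)%N by exact: leq_trans Kk.
have k0R : 0 < k%:R :> R by rewrite ltr0n.
have e3 := kK k (ltnW Kk).
have K0k : (K0 <= k.-1)%N.
  by rewrite -ltnS prednK // (leq_trans _ Kk) // ltnS leq_maxl.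
have := HK0 k.-1 K0k; rewrite /= prednK // natrX.
have := HK0 k (leq_trans K0k (leq_pred _)); rewrite /= natrX.
set x := k%:R in k0R e3 *; rewrite -natr1 -/x.
rewrite !ler_distl => /andP[h2 _] /andP[_ h1].
have {}h1 : (1 - e') * x ^+ 2 <= S (k ^ 2)%N.
  by rewrite -ler_pdivlMr ?exprn_gt0 //; lra.
have {}h2 : S (k.+1 ^ 2)%N <= (1 + e') * (x + 1) ^+ 2.
  by rewrite -ler_pdivrMr ?exprn_gt0 ?addr_gt0 //; lra.
have nn : x ^+ 2 <= n.+1%:R by rewrite -natrX ler_nat.
have nn2 : n.+1%:R <= (x + 1) ^+ 2 by rewrite natr1 -natrX ler_nat ltnW.
have S1 : S (k ^ 2)%N <= S n.+1 by exact: ndS.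
have S2 : S n.+1 <= S (k.+1 ^ 2)%N by apply: ndS; exact: ltnW.
have n0 : 0 < n.+1%:R :> R by rewrite ltr0n.
have sq : (x + 1) ^+ 2 <= (1 + e') * x ^+ 2.
  have : 3 * x <= e' * x * x by rewrite ler_pM2r.
  have : 1 <= x by rewrite /x ler1n.
  by rewrite sqrrD expr1n mulr1 expr2; nra.
have x20 : 0 <= x ^+ 2 by rewrite sqr_ge0.
apply/andP; split.
  rewrite lerBlDr ler_pdivrMr //; apply: (le_trans S2); apply: (le_trans h2).
  apply: (@le_trans _ _ ((1 + e') * ((1 + e') * x ^+ 2))); first by rewrite ler_pM2l; lra.
  rewrite mulrA; apply: ler_pM => //; first by rewrite mulr_ge0; lra.
  nra.
rewrite -lerBlDr ler_pdivlMr //; apply: le_trans S1; apply: le_trans h1.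
have [e1|e1] := leP e 1; last by nra.
apply: (@le_trans _ _ ((1 - e) * ((1 + e') * x ^+ 2))).
  by apply: ler_wpM2l; [lra|exact: le_trans sq].
by rewrite mulrA; apply: ler_wpM2r => //; nra.
Qed.

Lemma ge0_integralD_real d (T : measurableType d) (R : realType)
    (mu : {measure set T -> \bar R}) (f1 f2 : T -> R) :
  measurable_fun setT f1 -> measurable_fun setT f2 ->
  (forall x, 0 <= f1 x) -> (forall x, 0 <= f2 x) ->
  (\int[mu]_x (f1 x)%:E + \int[mu]_x (f2 x)%:E = \int[mu]_x (f1 x + f2 x)%:E)%E.
Proof.
move=> mf1 mf2 f10 f20.
have mE1 : measurable_fun setT (fun x => (f1 x)%:E) by exact/measurable_EFinP.
have mE2 : measurable_fun setT (fun x => (f2 x)%:E) by exact/measurable_EFinP.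
transitivity (\int[mu]_x ((f1 x)%:E + (f2 x)%:E))%E; last by apply: eq_integral.
apply/esym; apply: ge0_integralD => //.
- by move=> x _; rewrite lee_fin.
- by move=> x _; rewrite lee_fin.
Qed.

Section positive_sums.
Context (R : realType) (dO : measure_display) (Omega : measurableType dO).
Context (P : probability Omega R) (X : nat -> Omega -> R).
Hypothesis mX : forall n, measurable_fun setT (X n).
Hypothesis XP : forall n (B : set R), measurable B ->
  P (X n @^-1` B) = exponential_prob 1 B.
Hypothesis Xind : forall i j (A B : set R), i != j -> measurable A -> measurable B ->
  P (X j @^-1` A `&` X i @^-1` B) = (P (X j @^-1` A) * P (X i @^-1` B))%E.

Let g n w := Num.max (X n w) 0.

Let g0 n w : 0 <= g n w. Proof. by rewrite le_max lexx orbT. Qed.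

Let mg n : measurable_fun setT (g n). Proof. exact: measurable_maxr. Qed.

(* Truncating at 0 changes nothing almost surely and makes the sums monotone
   everywhere. *)
Definition positive_sum n w := \sum_(m < n) g m w.

Let S := positive_sum.

Let S0 n w : 0 <= S n w. Proof. by apply: sumr_ge0. Qed.

Let mS n : measurable_fun setT (S n). Proof. by apply: measurable_sum. Qed.

(** Pairwise independence lets [X i] be integrated out with [X j] frozen; each factor has mean 1. *)
Lemma exponential_cross_moment i j : i != j -> (\int[P]_w (g j w * g i w)%:E = 1)%E.
Proof.
move=> ij.
pose F := preimage_set_system setT (X j) (measurable : set_system R).
have sF : sigma_algebra setT F.
  by apply: sigma_algebra_preimage; exact: sigma_algebra_measurable.
have Fm : F `<=` measurable by move=> _ [B mB <-]; exact: mX.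
pose XM := isMeasurableFun.Build _ _ _ _ _ (mX i).
pose Xi : {mfun Omega >-> R} := HB.pack (X i) XM.
have mh : measurable_fun setT (fun x : R => Num.max x 0) by exact: measurable_maxr.
have mXj : measurable_fun setT (X j : g_sigma_algebraType F -> R).
  move=> _ B mB; apply: sub_sigma_algebra.
  by exists B => //; rewrite setTI.
pose f (z : g_sigma_algebraType F * R) := Num.max (X j z.1) 0 * Num.max z.2 0.
have mf : measurable_fun setT f.
  apply: measurable_funM; apply: (measurableT_comp mh); last exact: measurable_snd.
  exact: measurableT_comp mXj measurable_fst.
have f0 z : 0 <= f z by rewrite mulr_ge0 // le_max lexx orbT.
have := @ge0_integral_freeze _ _ R P F Fm _ _ (X i) (distribution P Xi) f (mX i) _ mf f0.
rewrite /f /= => ->; last first.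
  move=> A B sA mB.
  have [C mC <-] : F A by rewrite -(sigma_algebra_id sF).
  by rewrite setTI Xind.
rewrite -[RHS](exponential_mean (mX j) (XP j)); apply: eq_integral => w _.
under eq_integral do rewrite EFinM.
rewrite ge0_integralZl ?lee_fin //; last 3 first.
- exact/measurable_EFinP.
- by move=> x _; rewrite lee_fin le_max lexx orbT.
- by rewrite le_max lexx orbT.
rewrite (@ge0_integral_distribution _ _ _ _ R P Xi (fun x => (Num.max x 0)%:E)) //.
- by rewrite /comp /= (exponential_mean (mX i) (XP i)) mule1.
- exact/measurable_EFinP.
- by move=> x; rewrite lee_fin le_max lexx orbT.
Qed.

Lemma positive_sum_variance n :
  (\int[P]_w ((S n w - n%:R) ^+ 2)%:E <= (32 * n%:R)%:E)%E.
Proof.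
have mean : (\int[P]_w (S n w)%:E = (n%:R)%:E)%E.
  rewrite /S /positive_sum; under eq_integral do rewrite -sumEFin.
  rewrite ge0_integral_sum //; last 2 first.
  - by move=> i; exact/measurable_EFinP.
  - by move=> i w _; rewrite lee_fin.
  rewrite (eq_bigr (fun=> 1%E)) => [|i _]; last exact: (exponential_mean (mX i) (XP i)).
  by rewrite sumEFin sumr_const card_ord.
have second : (\int[P]_w ((S n w) ^+ 2)%:E <= (n%:R ^+ 2 + 32 * n%:R)%:E)%E.
  have -> : (\int[P]_w ((S n w) ^+ 2)%:E = \sum_(i < n) \sum_(j < n) \int[P]_w (g j w * g i w)%:E)%E.
    transitivity (\int[P]_w (\sum_(i < n) \sum_(j < n) (g j w * g i w)%:E))%E.
      apply: eq_integral => w _; under eq_bigr do rewrite sumEFin.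
      rewrite sumEFin; congr EFin; rewrite /S /positive_sum expr2 mulr_sumr.
      by apply: eq_bigr => i _; rewrite mulr_suml.
    have mgg i j : measurable_fun setT (fun w => (g j w * g i w)%:E).
      by apply/measurable_EFinP; exact: measurable_funM.
    rewrite ge0_integral_sum //; last 2 first.
    - by move=> i; apply: emeasurable_sum.
    - by move=> i w _; apply: sume_ge0 => j _; rewrite lee_fin mulr_ge0.
    apply: eq_bigr => i _; rewrite ge0_integral_sum //.
    by move=> j w _; rewrite lee_fin mulr_ge0.
  (* Adding 1 on the diagonal as well makes the double sum exactly n^2 + 32 n. *)
  apply: (@le_trans _ _ (\sum_(i < n) \sum_(j < n) (1 + 32 * (j == i)%:R)%:E)%E).
    apply: lee_sum => i _; apply: lee_sum => j _.
    have [->|ji] := eqVneq j i.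
      rewrite mulr1; under eq_integral do rewrite -expr2.
      apply: (le_trans (exponential_second_moment (mX i) (XP i))).
      by rewrite lee_fin lerDr.
    by rewrite mulr0 addr0 exponential_cross_moment // eq_sym.
  under eq_bigr do rewrite sumEFin.
  rewrite sumEFin lee_fin.
  under eq_bigr => i _.
    rewrite big_split /= sumr_const card_ord -mulr_sumr (bigD1 i) //= eqxx big1 ?addr0 => [|j /negPf ->//].
    over.
  by rewrite sumr_const card_ord mulr1 -[leLHS]mulr_natr mulrDl expr2.
(* The expanded square is rearranged so that every integrand is nonnegative and no signed integral
   occurs. *)
have id1 : (\int[P]_w ((S n w - n%:R) ^+ 2)%:E + (2 * n%:R ^+ 2)%:E =
    \int[P]_w ((S n w) ^+ 2)%:E + (n%:R ^+ 2)%:E)%E.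
  have -> : (2 * n%:R ^+ 2)%:E = (\int[P]_w (2 * n%:R * S n w)%:E)%E.
    under eq_integral do rewrite EFinM.
    have mSE : measurable_fun setT (fun w => (S n w)%:E) by exact/measurable_EFinP.
    have SE0 w : setT w -> (0 <= (S n w)%:E)%E by rewrite lee_fin.
    rewrite (@ge0_integralZl _ _ R P setT measurableT _ mSE _ SE0); last by rewrite lee_fin mulr_ge0.
    by rewrite mean -EFinM -mulrA expr2.
  have -> : (n%:R ^+ 2)%:E = (\int[P]_w (n%:R ^+ 2)%:E)%E.
    transitivity ((n%:R ^+ 2)%:E * P setT)%E; first by rewrite probability_setT mule1.
    by rewrite integral_cst.
  have m1 : measurable_fun setT (fun w => (S n w - n%:R) ^+ 2).
    by apply: measurable_funX; exact: measurable_funB.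
  have m2 : measurable_fun setT (fun w => 2 * n%:R * S n w) by exact: measurable_funM.
  have m3 : measurable_fun setT (fun w => (S n w) ^+ 2) by exact: measurable_funX.
  have p2 w : 0 <= 2 * n%:R * S n w by rewrite !mulr_ge0.
  rewrite (ge0_integralD_real P m1 m2 (fun=> sqr_ge0 _) p2).
  rewrite (ge0_integralD_real P m3 (measurable_cst _) (fun=> sqr_ge0 _) (fun=> sqr_ge0 _)).
  by apply: eq_integral => w _ /=; congr EFin; ring.
rewrite -(@leeD2rE _ (2 * n%:R ^+ 2)%:E) // id1.
apply: (@le_trans _ _ ((n%:R ^+ 2 + 32 * n%:R)%:E + (n%:R ^+ 2)%:E)%E); first exact: leeD2r.
by rewrite -!EFinD lee_fin; lra.
Qed.
End positive_sums.

(** The sharper bound 2 - 1 / n passes the induction, since 1 / n - 1 / (n + 1) exceeds 1 / (n +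
    1)^2. At n = 0 the convention 0^-1 = 0 applies, so the step from 0 to 1 is checked
    separately. *)
Lemma inverse_squares_le (R : realType) n :
  \sum_(0 <= k < n) ((k.+1 ^ 2)%:R)^-1 <= 2 :> R.
Proof.
suff : \sum_(0 <= k < n) ((k.+1 ^ 2)%:R)^-1 <= 2 - n%:R^-1 :> R.
  by move=> /le_trans; apply; rewrite gerDl oppr_le0 invr_ge0.
elim: n => [|n IH]; first by rewrite big_geq //= invr0 subr0.
rewrite big_nat_recr //=.
case: n IH => [|n IH]; first by move=> _; rewrite big_geq //= exp1n invr1; lra.
apply: (le_trans (lerD IH (lexx _))).
have n0 : 0 < n.+1%:R :> R by rewrite ltr0n.
rewrite natrX -[n.+2]addn1 natrD.
set x := n.+1%:R in n0 *.
have x1 : 0 < x + 1 by rewrite addr_gt0.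
rewrite -subr_ge0 (_ : _ - _ = (x * (x + 1) ^+ 2)^-1); last by field; rewrite !gt_eqF.
by rewrite invr_ge0 mulr_ge0 ?sqr_ge0 // ltW.
Qed.

Lemma nneseries_fin_cvg0 (R : realType) (u : nat -> R) : (forall k, 0 <= u k) ->
  (\sum_(0 <= k <oo) (u k)%:E < +oo)%E -> u @ \oo --> (0 : R).
Proof.
move=> u0 ufin; apply: cvg_series_cvg_0.
have uE0 n : (0 <= n)%N -> true -> (0 <= (u n)%:E)%E by rewrite lee_fin.
apply: nondecreasing_is_cvgn.
  by apply/nondecreasing_series => n _ _.
exists (fine (\sum_(0 <= k <oo) (u k)%:E)%E) => _ [n _ <-].
rewrite -lee_fin fineK; last first.
  by rewrite ge0_fin_numE //; apply: nneseries_ge0 => k _; exact: uE0.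
rewrite /series /= -sumEFin.
exact: (@nneseries_lim_ge R (fun k => (u k)%:E) xpredT 0 n).
Qed.

Section strong_law.
Context (R : realType) (dO : measure_display) (Omega : measurableType dO).
Context (P : probability Omega R) (X : nat -> Omega -> R).
Hypothesis mX : forall n, measurable_fun setT (X n).
Hypothesis XP : forall n (B : set R), measurable B ->
  P (X n @^-1` B) = exponential_prob 1 B.
Hypothesis Xind : forall i j (A B : set R), i != j -> measurable A -> measurable B ->
  P (X j @^-1` A `&` X i @^-1` B) = (P (X j @^-1` A) * P (X i @^-1` B))%E.

Let S := positive_sum X.

Let mS n : measurable_fun setT (S n).
Proof. by apply: measurable_sum => i; exact: measurable_maxr. Qed.

(** Along the squares the mean squared deviation is at most 32 / (k + 1)^2, which is summable. Hence
    the random series [U] of squared deviations has finite mean, converges almost surely, and its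
    terms tend to 0. Monotonicity does the rest. *)
Lemma strong_law : {ae P, forall w, (fun n => S n.+1 w / n.+1%:R) @ \oo --> (1 : R)}.
Proof.
pose N (k : nat) := (k.+1 ^ 2)%N.
have N0 k : 0 < (N k)%:R :> R by rewrite ltr0n expn_gt0.
pose u k w := (S (N k) w / (N k)%:R - 1) ^+ 2.
have u0 k w : 0 <= u k w by exact: sqr_ge0.
have mu k : measurable_fun setT (fun w => (u k w)%:E).
  apply/measurable_EFinP; apply: measurable_funX; apply: measurable_funB => //.
  exact: measurable_funM.
have uE0 k w : (0 <= (u k w)%:E)%E by rewrite lee_fin.
have iu k : (\int[P]_w (u k w)%:E <= (32 * (N k)%:R^-1)%:E)%E.
  have -> : (\int[P]_w (u k w)%:E =
      \int[P]_w (((N k)%:R ^- 2)%:E * ((S (N k) w - (N k)%:R) ^+ 2)%:E))%E.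
    apply: eq_integral => w _; rewrite -EFinM; congr EFin; rewrite /u; field.
    by rewrite gt_eqF.
  have m1 : measurable_fun setT (fun w => ((S (N k) w - (N k)%:R) ^+ 2)%:E).
    by apply/measurable_EFinP; apply: measurable_funX; exact: measurable_funB.
  have p1 w : setT w -> (0 <= ((S (N k) w - (N k)%:R) ^+ 2)%:E)%E.
    by rewrite lee_fin sqr_ge0.
  have c0 : 0 <= (N k)%:R ^- 2 :> R by rewrite invr_ge0 exprn_ge0 // ltW.
  rewrite (@ge0_integralZl _ _ R P setT measurableT _ m1 _ p1) ?lee_fin //.
  apply: (@le_trans _ _ (((N k)%:R ^- 2)%:E * (32 * (N k)%:R)%:E)%E).
    by apply: lee_wpmul2l; rewrite ?lee_fin //; exact: positive_sum_variance.
  by rewrite -EFinM lee_fin le_eqVlt; apply/orP; left; apply/eqP; field; rewrite gt_eqF.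
pose U w := (\sum_(0 <= k <oo) (u k w)%:E)%E.
have mU : measurable_fun setT U by apply: ge0_emeasurable_sum.
have U0 w : (0 <= U w)%E by apply: nneseries_ge0.
have iU : (\int[P]_w U w <= 64%:E)%E.
  rewrite /U integral_nneseries //.
  apply: lime_le; first by apply: is_cvg_nneseries => k _ _; apply: integral_ge0.
  near=> n; apply: (@le_trans _ _ (\sum_(0 <= k < n) (32 * (N k)%:R^-1)%:E)%E).
    exact: lee_sum.
  rewrite sumEFin lee_fin -mulr_sumr; have := inverse_squares_le R n.
  by rewrite /N; lra.
have UI : P.-integrable setT U.
  apply/integrableP; split => //; under eq_integral do rewrite gee0_abs //.
  exact: le_lt_trans iU (ltry _).
have := integrable_ae measurableT UI.
apply: filterS => w /(_ I) Ufin.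
have {}Ufin : (U w < +oo)%E by rewrite -ge0_fin_numE.
have u_cvg := nneseries_fin_cvg0 (u0 ^~ w) Ufin.
apply: (@cvg_average_of_squares R (S ^~ w)).
- by move=> n; apply: sumr_ge0 => i _; rewrite le_max lexx orbT.
- move=> m n mn; rewrite /S /positive_sum -!(big_mkord xpredT (fun i => Num.max (X i w) 0)).
  rewrite (@big_cat_nat _ _ _ m 0 n _ _ (leq0n m) mn) /= lerDl sumr_ge0 // => i _.
  by rewrite le_max lexx orbT.
apply/cvgrPdist_le => e e0.
have e20 : 0 < e ^+ 2 by rewrite exprn_gt0.
have /cvgr0Pnorm_le /(_ _ e20) := u_cvg.
apply: filterS => k; rewrite ger0_norm // /u => H.
by rewrite distrC -[leLHS]ger0_norm // -(@ler_pXn2r _ 2) ?nnegrE ?(ltW e0) //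
  ger0_norm // real_normK ?num_real.
Unshelve. all: by end_near. Qed.
End strong_law.

(** * Conditional means of the edge weights *)

Section measurability.
Context (R : realType) dW (W : measurableType dW).

(** The power of a square with exponent -1 is measurable, and x (x^2)^(-1) is the inverse, also at
    0, where both sides are 0. *)
Lemma measurable_invr : measurable_fun setT (@GRing.inv R).
Proof.
rewrite (_ : @GRing.inv R = (fun x => x * (x ^+ 2) `^ (- 1))).
  apply: measurable_funM => //.
  by apply: (measurableT_comp (measurable_powR _)); exact: measurable_funX.
apply/funext => x; have [->|x0] := eqVneq x 0; first by rewrite invr0 mul0r.
by rewrite powR_inv1 ?sqr_ge0 // expr2 invfM mulrA mulfV // mul1r.
Qed.

Lemma measurable_bigmin (I : Type) (r : seq I) (e : W -> R) (f : I -> W -> R) :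
  measurable_fun setT e -> (forall i, measurable_fun setT (f i)) ->
  measurable_fun setT (fun w => \big[Num.min/e w]_(i <- r) f i w).
Proof.
move=> me mf; elim: r => [|i r IH].
  by rewrite (_ : (fun w => _) = e) //; apply/funext => w; rewrite big_nil.
rewrite (_ : (fun w => _) = (fun w => Num.min (f i w) (\big[Num.min/e w]_(j <- r) f j w))).
  exact: measurable_minr.
by apply/funext => w; rewrite big_cons.
Qed.

Lemma measurable_torus_dist d (x y : W -> d.-tuple R) :
  measurable_fun setT x -> measurable_fun setT y ->
  measurable_fun setT (fun w => torus_dist (x w) (y w)).
Proof.
move=> mx my.
have mk (k : {ffun 'I_d -> 'I_3}) :
    measurable_fun setT (fun w => enorm (shifted_diff (x w) (y w) k)).
  apply: (measurableT_comp (@measurable_enorm R d)).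
  apply/measurable_fun_tnthP => i.
  rewrite (_ : _ \o _ = (fun w => tnth (x w) i - tnth (y w) i + ((k i)%:R - 1))); last first.
    by apply/funext => w /=; rewrite tnth_mktuple.
  have mt (z : W -> d.-tuple R) : measurable_fun setT z ->
      measurable_fun setT (fun w => tnth (z w) i).
    by move=> mz; exact: (measurableT_comp (measurable_tnth i) mz).
  by apply: measurable_funD => //; apply: measurable_funB; exact: mt.
exact: measurable_bigmin.
Qed.

Context (d : nat) (gamma beta : R) (phi : R -> R) (g : R -> R).
Hypotheses (phiP : profile d phi) (mg : measurable_fun setT g).

Definition clamped_prob (r u s : R) : R :=
  clamped phi (u * r ^+ d / (beta * (u / s) `^ gamma)).

Lemma measurable_clamped_prob (u s r : W -> R) :
  measurable_fun setT u -> measurable_fun setT s -> measurable_fun setT r ->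
  measurable_fun setT (fun w => clamped_prob (r w) (u w) (s w)).
Proof.
move=> mu ms mr; apply: (measurableT_comp (measurable_clamped phiP)).
apply: measurable_funM; first by apply: measurable_funM => //; exact: measurable_funX.
apply: (measurableT_comp measurable_invr); apply: measurable_funM => //.
apply: (measurableT_comp (measurable_powR _)); apply: measurable_funM => //.
exact: (measurableT_comp measurable_invr ms).
Qed.

Lemma measurable_edge_density_comp (t : R) (u s r : W -> R) :
  measurable_fun setT u -> measurable_fun setT s -> measurable_fun setT r ->
  measurable_fun setT (fun w => edge_density d gamma beta phi g t (u w) (s w) (r w)).
Proof.
move=> mu ms mr; apply: measurable_funM; first exact: measurable_clamped_prob.
by apply: measurableT_comp => //; exact: measurable_funM.
Qed.

Hypothesis g0 : forall r, 0 <= g r.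

Lemma measurable_edge_mean (t : R) (u s : W -> R) :
  measurable_fun setT u -> measurable_fun setT s ->
  measurable_fun setT (fun w => edge_mean d gamma beta phi g t (u w) (s w)).
Proof.
move=> mu ms.
pose F (z : W * d.-tuple R) : R := \1_(@torus R d) z.2 *
  edge_density d gamma beta phi g t (u z.1) (s z.1) (enorm z.2).
have mF : measurable_fun setT F.
  apply: measurable_funM.
    apply: (measurableT_comp (f := (\1_(@torus R d) : d.-tuple R -> R)) (g := snd)) => //.
    by apply: measurable_indic; exact: measurable_torus.
  have m1 : measurable_fun setT (u \o (fst : W * d.-tuple R -> W)) by exact: measurableT_comp.
  have m2 : measurable_fun setT (s \o (fst : W * d.-tuple R -> W)) by exact: measurableT_comp.
  have m3 : measurable_fun setT (@enorm R d \o (snd : W * d.-tuple R -> _)).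
    by apply: measurableT_comp => //; exact: measurable_enorm.
  apply: measurable_funM.
    apply: (measurableT_comp (measurable_clamped phiP)).
    apply: measurable_funM; first by apply: measurable_funM => //; exact: measurable_funX.
    apply: (measurableT_comp measurable_invr); apply: measurable_funM => //.
    apply: (measurableT_comp (measurable_powR _)); apply: measurable_funM => //.
    exact: (measurableT_comp measurable_invr m2).
  by apply: measurableT_comp => //; exact: measurable_funM.
have mFE : measurable_fun setT (EFin \o F) by exact/measurable_EFinP.
have F0 z : (0 <= (EFin \o F) z)%E.
  by rewrite /= lee_fin mulr_ge0 // mulr_ge0 ?(clamped_ge0 phiP).
apply: (measurableT_comp (f := fine) (g := fun w => \int[@lebesgue_tuple R d]_(x in @torus R d)
    (edge_density d gamma beta phi g t (u w) (s w) (enorm x))%:E)%E).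
  exact: fine_measurable.
rewrite (_ : (fun w => _) = (fun w => \int[@lebesgue_tuple R d]_x (EFin \o F) (w, x))%E).
  exact: (@measurable_fun_fubini_tonelli_F _ _ _ _ _ (@lebesgue_tuple R d) _ mFE F0).
apply/funext => w; rewrite integral_mkcond; apply: eq_integral => x _.
by rewrite patchE /F /= indicE; case: ifPn => _; rewrite ?mul1r ?mul0r.
Qed.
End measurability.

Lemma measurable_fun_subset_sigma (T : pointedType) (S1 S2 : set_system T)
    d (U : measurableType d) (f : T -> U) : S1 `<=` S2 ->
  measurable_fun (setT : set (g_sigma_algebraType S1)) f ->
  measurable_fun (setT : set (g_sigma_algebraType S2)) f.
Proof.
move=> S12 mf _ B mB; have := mf measurableT B mB.
exact: sub_sigma_algebra2.
Qed.

(** * Vertex sigma-algebras and the good event *)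

Section network.
Context (R : realType) (d : nat) (gamma beta : R) (phi : R -> R).
Context (dO : measure_display) (Omega : measurableType dO).
Context (P : probability Omega R) (G : age_based_network d gamma beta phi P).

Let gapG n : Omega -> R := gap (fun k => birth G k : Omega -> R) n.

Lemma measurable_gap n : measurable_fun setT (gapG n).
Proof. by case: n => [|n] //; exact: measurable_funB. Qed.

Lemma vertex_sigma_measurable v A : vertex_sigma G v A -> measurable A.
Proof.
have mp n : measurable_fun setT (pos G n : Omega -> d.-tuple R) by [].
by case: v => n [B mB <-]; [exact: measurable_gap|exact: mp].
Qed.

Lemma vertex_sigmaT v : vertex_sigma G v setT.
Proof. by case: v => n; exists setT => //; rewrite preimage_setT setTI. Qed.

Lemma vertex_sigmaI v A B : vertex_sigma G v A -> vertex_sigma G v B ->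
  vertex_sigma G v (A `&` B).
Proof.
by case: v => n [C mC <-] [D mD <-]; exists (C `&` D);
  rewrite ?setTI ?preimage_setI //; exact: measurableI.
Qed.

(** Indexed by both gaps and positions: a gap is left out for the law of large numbers, a position
    when one end of an edge is averaged. *)
Definition sigma_except (v : nat + nat) : set_system Omega :=
  \bigcup_(i in [set i | i != v]) vertex_sigma G i.

Definition sigma_gaps : set_system Omega := \bigcup_n vertex_sigma G (inl n).

Definition sigma_all : set_system Omega := \bigcup_v vertex_sigma G v.

Lemma sigma_except_measurable v : sigma_except v `<=` measurable.
Proof. by move=> A [i _]; exact: vertex_sigma_measurable. Qed.

Lemma sigma_all_measurable : sigma_all `<=` measurable.
Proof. by move=> A [i _]; exact: vertex_sigma_measurable. Qed.

Lemma sigma_gaps_except n : sigma_gaps `<=` sigma_except (inr n).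
Proof. by move=> A [k _ kA]; exists (inl k). Qed.

Lemma sigma_gaps_all : sigma_gaps `<=` sigma_all.
Proof. by move=> A [k _ kA]; exists (inl k). Qed.

Lemma birthE n w : birth G n w = \sum_(m < n.+1) gapG m w.
Proof.
elim: n => [|n IH]; first by rewrite big_ord1.
by rewrite big_ord_recr /= -IH /gapG /= addrC subrK.
Qed.

Lemma gap_sigma_gaps n : measurable_fun (setT : set (g_sigma_algebraType sigma_gaps)) (gapG n).
Proof.
move=> _ B mB; apply: sub_sigma_algebra; exists n => //; by exists B.
Qed.

Lemma birth_sigma_gaps n :
  measurable_fun (setT : set (g_sigma_algebraType sigma_gaps)) (birth G n : Omega -> R).
Proof.
rewrite (_ : (birth G n : Omega -> R) = (fun w => \sum_(m < n.+1) gapG m w)).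
  by apply: measurable_sum => i; exact: gap_sigma_gaps.
by apply/funext => w; exact: birthE.
Qed.

Lemma birth_sigma_except v n :
  measurable_fun (setT : set (g_sigma_algebraType (sigma_except (inr v))))
    (birth G n : Omega -> R).
Proof.
have H := @birth_sigma_gaps n; apply: (measurable_fun_subset_sigma _ H).
exact: sigma_gaps_except.
Qed.

Lemma birth_sigma_all n :
  measurable_fun (setT : set (g_sigma_algebraType sigma_all)) (birth G n : Omega -> R).
Proof.
have H := @birth_sigma_gaps n; apply: (measurable_fun_subset_sigma _ H).
exact: sigma_gaps_all.
Qed.

Lemma pos_sigma_except v n : inr n != v ->
  measurable_fun (setT : set (g_sigma_algebraType (sigma_except v))) (pos G n : Omega -> d.-tuple R).
Proof.
move=> nv _ B mB; apply: sub_sigma_algebra; exists (inr n) => //; by exists B.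
Qed.

Lemma pos_sigma_all n :
  measurable_fun (setT : set (g_sigma_algebraType sigma_all)) (pos G n : Omega -> d.-tuple R).
Proof.
move=> _ B mB; apply: sub_sigma_algebra; exists (inr n) => //; by exists B.
Qed.

Lemma vertex_independent_rest v (A B : set Omega) :
  <<s sigma_except v >> A -> vertex_sigma G v B -> P (A `&` B) = (P A * P B)%E.
Proof.
exact: (independent_rest vertex_sigma_measurable vertex_sigmaT vertex_sigmaI
  (@vertices_independent _ _ _ _ _ _ _ _ G)).
Qed.

(* Bounding the births below by a multiple of their index makes all the sums
   over vertices born before a given time finite. *)
Definition good (c : R) : set Omega :=
  [set w | (forall n, 0 < gapG n w) /\ (forall n, c * n.+1%:R <= birth G n w)].

Lemma good_sigma_gaps c : <<s sigma_gaps >> (good c).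
Proof.
rewrite (_ : good c = (\bigcap_n (gapG n @^-1` `]0, +oo[%classic)) `&`
    (\bigcap_n ((birth G n : Omega -> R) @^-1` `[c * n.+1%:R, +oo[%classic))).
  apply: (@measurableI _ (g_sigma_algebraType sigma_gaps)); apply: bigcapT_measurable => n;
    rewrite -[X in measurable X]setTI.
  - by apply: gap_sigma_gaps => //; exact: measurable_itv.
  - by apply: birth_sigma_gaps => //; exact: measurable_itv.
apply/seteqP; split => w /=.
  by move=> [H1 H2]; split=> n _ /=; rewrite in_itv /= andbT.
by move=> [H1 H2]; split=> n; [have := H1 n I|have := H2 n I]; rewrite /= in_itv /= andbT.
Qed.

Lemma measurable_good c : measurable (good c).
Proof.
apply: (measurable_sub_sigma sigma_all_measurable).
exact: (sub_sigma_algebra2 sigma_gaps_all) (good_sigma_gaps c).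
Qed.

Lemma good_birth_lt c w i j : good c w -> (j < i)%N -> birth G j w < birth G i w.
Proof.
move=> [H _]; elim: i => // i IH; rewrite ltnS leq_eqVlt.
have gi : birth G i w < birth G i.+1 w by rewrite -subr_gt0; exact: (H i.+1).
by case/predU1P => [->//|/IH]; move/lt_trans; apply.
Qed.

Lemma good_birth_gt0 c w n : good c w -> 0 < birth G n w.
Proof.
move=> gw; have g0 : 0 < birth G 0%N w by have [H _] := gw; exact: (H 0%N).
by case: n => // n; apply: lt_trans g0 _; exact: good_birth_lt gw _.
Qed.

Lemma births_strong_law :
  {ae P, forall w, (forall n, 0 < gapG n w) /\
    (fun n => birth G n w / n.+1%:R) @ \oo --> (1 : R)}.
Proof.
have H1 : {ae P, forall w, forall n, 0 < gapG n w}.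
  apply: ae_foralln => n.
  have mA : measurable (gapG n @^-1` `]0, +oo[).
    rewrite -[X in measurable X]setTI.
    by apply: measurable_gap => //; exact: measurable_itv.
  have PA : P (~` (gapG n @^-1` `]0, +oo[)) = 0%E.
    rewrite probability_setC //.
    by rewrite (exponential_gt0_ae (measurable_gap n) (gap_exponential G n)) subee.
  exists (~` (gapG n @^-1` `]0, +oo[)); split; [exact: measurableC|exact: PA|].
  by move=> w /= H K; apply: H; move: K; rewrite /= in_itv /= andbT.
have H2 := @strong_law R _ Omega P gapG measurable_gap (gap_exponential G) _.
have {}H2 : {ae P, forall w, (fun n => positive_sum gapG n.+1 w / n.+1%:R) @ \oo --> (1 : R)}.
  apply: H2 => i j A B ij mA mB.
  apply: (@vertex_independent_rest (inl i)).
    apply: sub_sigma_algebra; exists (inl j) => //=.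
      by apply/eqP => -[ji]; move: ij; rewrite ji eqxx.
    by exists A => //; rewrite ?setTI.
  by exists B => //; rewrite ?setTI.
apply: filterS2 H1 H2 => w h1 h2; split => //.
rewrite (_ : (fun n => _) = (fun n => positive_sum gapG n.+1 w / n.+1%:R)) //.
apply/funext => n; rewrite birthE /positive_sum; congr (_ / _).
by apply: eq_bigr => i _; rewrite max_l // ltW.
Qed.

(** From some index on, the births exceed (n + 1) / 2; the finitely many earlier ones are positive,
    so a small enough constant covers all of them. *)
Lemma good_exists w : (forall n, 0 < gapG n w) ->
  (fun n => birth G n w / n.+1%:R) @ \oo --> (1 : R) ->
  exists m, good m.+1%:R^-1 w.
Proof.
move=> gap0 H.
have b0 n : 0 < birth G n w.
  rewrite birthE big_ord_recl /=; apply: ltr_pwDl; first exact: (gap0 0%N).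
  by apply: sumr_ge0 => i _; exact: (ltW (gap0 (lift ord0 i))).
have : \forall n \near \oo, 2^-1 < birth G n w / n.+1%:R.
  by apply: (cvgr_gt 1 H); rewrite invf_lt1 // ltr1n.
move=> [N _ HN].
pose q n := Num.truncn (n.+1%:R / birth G n w).
(* The sum dominates each of the finitely many quotients (n + 1) / T_n, and the final successor
   gives M + 1 >= 2, as the tail requires. *)
pose M := (\sum_(n < N) (q n).+1)%N.+1.
exists M%N; split => // n.
rewrite mulrC ler_pdivrMr ?ltr0n // mulrC -ler_pdivrMr //.
have [nN|Nn] := ltnP n N.
  apply: ltW; apply: (lt_le_trans (truncnS_gt _)); rewrite ler_nat.
  by rewrite /M (bigD1 (Ordinal nN)) //= -!addnS leq_addr.
have := HN n Nn; rewrite /= ltr_pdivlMr ?ltr0n // => h.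
rewrite ler_pdivrMr //.
have : 2 <= M.+1%:R :> R by rewrite ler_nat /M.
have := b0 n; nra.
Qed.
End network.

Section edge_weights.
Context (R : realType) (d : nat) (gamma beta : R) (phi : R -> R).
Hypotheses (beta0 : 0 < beta) (phiP : profile d phi).
Context (dO : measure_display) (Omega : measurableType dO).
Context (P : probability Omega R) (G : age_based_network d gamma beta phi P).
Context (g : R -> R) (M : R).
Hypotheses (mg : measurable_fun setT g) (gM : forall r, 0 <= g r <= M).
Context (t c : R).

Let g0 r : 0 <= g r. Proof. by have /andP[] := gM r. Qed.

Let dist (p : nat * nat) w := torus_dist (pos G p.1 w) (pos G p.2 w).

Let prob (p : nat * nat) w :=
  clamped_prob d gamma beta phi (dist p w) (birth G p.1 w) (birth G p.2 w).

Let alive (p : nat * nat) w : R := (birth G p.1 w <= t)%R%:R.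

(* The contribution of a pair to the edge sum, and its conditional means given all
   the vertices and given the birth times only. *)
Definition edge_weight (p : nat * nat) (w : Omega) : R :=
  alive p w * (\1_(link G p) w * g (t `^ (d%:R^-1) * dist p w)).

Definition vertex_weight (p : nat * nat) (w : Omega) : R :=
  alive p w * edge_density d gamma beta phi g t (birth G p.1 w) (birth G p.2 w) (dist p w).

Definition birth_weight (p : nat * nat) (w : Omega) : R :=
  alive p w * edge_mean d gamma beta phi g t (birth G p.1 w) (birth G p.2 w).

Lemma edge_weight_ge0 p w : 0 <= edge_weight p w.
Proof. by rewrite !mulr_ge0. Qed.

Lemma vertex_weight_ge0 p w : 0 <= vertex_weight p w.
Proof. by rewrite mulr_ge0 // (edge_density_ge0 _ _ phiP gM). Qed.

Lemma birth_weight_ge0 p w : 0 <= birth_weight p w.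
Proof. by rewrite mulr_ge0 // (edge_mean_ge0 _ _ phiP gM). Qed.

Section on_sigma.
Context (S : set_system Omega) (p : nat * nat).
Local Notation OS := (g_sigma_algebraType S).
Hypotheses (b1 : measurable_fun (setT : set OS) (birth G p.1 : Omega -> R))
  (b2 : measurable_fun (setT : set OS) (birth G p.2 : Omega -> R)).

Lemma measurable_alive : measurable_fun (setT : set OS) (alive p).
Proof.
rewrite (_ : alive p = \1_((birth G p.1 : Omega -> R) @^-1` `]-oo, t])); last first.
  apply/funext => w; rewrite indicE /alive; congr (nat_of_bool _)%:R.
  by apply/idP/idP => [H|/set_mem]; [apply/mem_set|]; rewrite /= in_itv.
apply: measurable_indic; rewrite -[X in measurable X]setTI.
by apply: b1 => //; exact: measurable_itv.
Qed.

Lemma measurable_birth_weight : measurable_fun (setT : set OS) (birth_weight p).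
Proof.
by apply: measurable_funM; [exact: measurable_alive|exact: measurable_edge_mean].
Qed.

Hypotheses (x1 : measurable_fun (setT : set OS) (pos G p.1 : Omega -> d.-tuple R))
  (x2 : measurable_fun (setT : set OS) (pos G p.2 : Omega -> d.-tuple R)).

Lemma measurable_dist : measurable_fun (setT : set OS) (dist p).
Proof. exact: measurable_torus_dist. Qed.

Lemma measurable_scaled_dist :
  measurable_fun (setT : set OS) (fun w => g (t `^ (d%:R^-1) * dist p w)).
Proof.
by apply: measurableT_comp => //; apply: measurable_funM => //; exact: measurable_dist.
Qed.

Lemma measurable_vertex_weight : measurable_fun (setT : set OS) (vertex_weight p).
Proof.
apply: measurable_funM; first exact: measurable_alive.
by apply: measurable_edge_density_comp => //; exact: measurable_dist.
Qed.
End on_sigma.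

Let birth_all n : measurable_fun (setT : set (g_sigma_algebraType (sigma_all G)))
  (birth G n : Omega -> R).
Proof. exact: birth_sigma_all. Qed.

Let birth_except v n : measurable_fun (setT : set (g_sigma_algebraType (sigma_except G (inr v))))
  (birth G n : Omega -> R).
Proof. exact: birth_sigma_except. Qed.

(** Births are positive on the good event, so the argument of [phi] is nonnegative, where clamping
    changes nothing. *)
Lemma connection_prob_good w p : good G c w ->
  connection_prob gamma beta phi (pos G p.1 w) (birth G p.1 w) (pos G p.2 w) (birth G p.2 w)
  = prob p w.
Proof.
move=> gw; rewrite /prob /clamped_prob clampedE //.
have b1 := good_birth_gt0 p.1 gw.
rewrite mulr_ge0 ?invr_ge0 ?mulr_ge0 ?powR_ge0 ?(ltW b1) ?(ltW beta0) //.
apply: exprn_ge0; rewrite /dist /torus_dist.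
elim/big_ind : _ => [|x y x0 y0|k _]; [exact: enorm_ge0|by rewrite le_min x0|exact: enorm_ge0].
Qed.

(** The conditional law of the links is given on events of the vertex sigma-algebra; it extends to a
    weight [F] measurable for it. Restricting to the good event allows the connection probabilities
    to be replaced by their clamped, measurable versions. *)
Lemma link_law (J : {fset nat * nat}) (F : Omega -> R) :
  (forall p, p \in J -> (p.2 < p.1)%N) ->
  measurable_fun (setT : set (g_sigma_algebraType (sigma_all G))) F ->
  (forall w, 0 <= F w) ->
  (\int[P]_w (\1_(good G c `&` \bigcap_(p in [set` J]) link G p) w * F w)%:E =
   \int[P]_w (\1_(good G c) w * (\prod_(p <- J) prob p w) * F w)%:E)%E.
Proof.
move=> Jlt mF F0.
have mL : measurable (\bigcap_(p in [set` J]) link G p).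
  by apply: fin_bigcap_measurable => // p _; exact: link_measurable.
have mgd := measurable_good G c.
have mprob p : measurable_fun setT (prob p).
  apply: (measurable_fun_sub_sigma (@sigma_all_measurable _ _ _ _ _ _ _ _ G)).
  apply: measurable_clamped_prob => //.
  by apply: measurable_dist; exact: pos_sigma_all.
have prob0 p w : 0 <= prob p w by exact: clamped_ge0 phiP _.
have mprod : measurable_fun setT (fun w => \1_(good G c) w * (\prod_(p <- J) prob p w)).
  apply: measurable_funM; first exact: measurable_indic.
  exact: measurable_prod.
apply: (@ge0_integral_eq_density _ _ _ P (sigma_all G)) => //.
- exact: sigma_all_measurable.
- by apply: measurable_indic; exact: measurableI.
- by move=> w; rewrite mulr_ge0 // prodr_ge0.
move=> A sA.
have sgd : <<s sigma_all G >> (good G c).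
  have S12 : sigma_gaps G `<=` sigma_all G by exact: sigma_gaps_all.
  exact: (@sub_sigma_algebra2 _ setT _ _ S12 _ (good_sigma_gaps (G := G) c)).
have mA : measurable A by exact: measurable_sub_sigma (@sigma_all_measurable _ _ _ _ _ _ _ _ G) _ sA.
have sAg : <<s sigma_all G >> (A `&` good G c).
  exact: (@measurableI _ (g_sigma_algebraType (sigma_all G))).
transitivity (P (A `&` good G c `&` \bigcap_(p in [set` J]) link G p)).
  rewrite integral_indic //; last exact: measurableI.
  by congr (P _); rewrite setIC setIA.
rewrite (@link_conditional_law _ _ _ _ _ _ _ _ G J (A `&` good G c) Jlt sAg).
rewrite [LHS]integral_mkcond [RHS]integral_mkcond; apply: eq_integral => w _.
rewrite !patchE in_setI indicE.
case: (boolP (w \in A)) => //= _.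
case: ifPn => /= [/set_mem gw|_]; last by rewrite mul0r.
by rewrite mul1r; congr EFin; apply: eq_bigr => p _; exact: connection_prob_good.
Qed.

Lemma edge_weight_link (p : nat * nat) (F : Omega -> R) : (p.2 < p.1)%N ->
  measurable_fun (setT : set (g_sigma_algebraType (sigma_all G))) F ->
  (forall w, 0 <= F w) ->
  (\int[P]_w (\1_(good G c) w * edge_weight p w * F w)%:E =
   \int[P]_w (\1_(good G c) w * vertex_weight p w * F w)%:E)%E.
Proof.
move=> plt mF F0.
pose F1 w := alive p w * g (t `^ (d%:R^-1) * dist p w) * F w.
have mF1 : measurable_fun (setT : set (g_sigma_algebraType (sigma_all G))) F1.
  apply: measurable_funM => //; apply: measurable_funM; first exact: measurable_alive.
  by apply: measurable_scaled_dist; exact: pos_sigma_all.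
have F10 w : 0 <= F1 w by rewrite !mulr_ge0.
have := @link_law [fset p]%fset F1 _ mF1 F10.
move=> H; rewrite [LHS](_ : _ =
    (\int[P]_w (\1_(good G c `&` \bigcap_(q in [set` [fset p]%fset]) link G q) w * F1 w)%:E)%E).
  rewrite H; last by move=> q; rewrite inE => /eqP ->.
  apply: eq_integral => w _; rewrite big_seq_fset1 /F1 /vertex_weight /edge_density /prob /clamped_prob.
  by congr EFin; ring.
apply: eq_integral => w _; congr EFin.
rewrite set_fset1 bigcap_set1 indicI /= /F1 /edge_weight; ring.
Qed.

(** As p and q differ, the index set {p, q} has two elements, and the product formula expresses
    conditional independence of the two links. The positions are not averaged at this stage. *)
Lemma edge_weight_link2 (p q : nat * nat) : (p.2 < p.1)%N -> (q.2 < q.1)%N -> p != q ->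
  (\int[P]_w (\1_(good G c) w * edge_weight p w * edge_weight q w)%:E =
   \int[P]_w (\1_(good G c) w * vertex_weight p w * vertex_weight q w)%:E)%E.
Proof.
move=> plt qlt pq.
pose F1 w := (alive p w * g (t `^ (d%:R^-1) * dist p w)) * (alive q w * g (t `^ (d%:R^-1) * dist q w)).
have mF1 : measurable_fun (setT : set (g_sigma_algebraType (sigma_all G))) F1.
  apply: measurable_funM; (apply: measurable_funM; first exact: measurable_alive);
  by apply: measurable_scaled_dist; exact: pos_sigma_all.
have F10 w : 0 <= F1 w by rewrite !mulr_ge0.
have := @link_law [fset p; q]%fset F1 _ mF1 F10.
move=> H; rewrite [LHS](_ : _ =
    (\int[P]_w (\1_(good G c `&` \bigcap_(r in [set` [fset p; q]%fset]) link G r) w * F1 w)%:E)%E).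
  rewrite H; last by move=> r; rewrite !inE => /orP[] /eqP ->.
  apply: eq_integral => w _.
  rewrite big_fsetU1 ?inE //= big_seq_fset1 /F1 /vertex_weight /edge_density /prob /clamped_prob.
  by congr EFin; ring.
apply: eq_integral => w _; congr EFin.
have -> : \bigcap_(r in [set` [fset p; q]%fset]) link G r = link G p `&` link G q.
  apply/seteqP; split => x /=.
    by move=> K; split; apply: K; rewrite /= !inE eqxx ?orbT.
  by move=> [K1 K2] r /=; rewrite !inE => /orP[] /eqP ->.
by rewrite !indicI /= /F1 /edge_weight; ring.
Qed.
End edge_weights.

Section position_averaging.
Context (R : realType) (d : nat) (gamma beta : R) (phi : R -> R).
Hypotheses (d0 : (0 < d)%N) (gammaP : 0 < gamma < 1) (beta0 : 0 < beta) (phiP : profile d phi).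
Context (dO : measure_display) (Omega : measurableType dO).
Context (P : probability Omega R) (G : age_based_network d gamma beta phi P).
Context (g : R -> R) (M : R).
Hypotheses (mg : measurable_fun setT g) (gM : forall r, 0 <= g r <= M).
Context (t c : R).

Let g0 r : 0 <= g r. Proof. by have /andP[] := gM r. Qed.

Local Notation edge_weight := (edge_weight G g t).
Local Notation vertex_weight := (vertex_weight G g t).
Local Notation birth_weight := (birth_weight G g t).
Local Notation A := (good G c).

Lemma integral_position v (k : d.-tuple R -> \bar R) :
  measurable_fun setT k -> (forall x, 0 <= k x)%E ->
  (\int[distribution P (pos G v)]_x k x =
   \int[@lebesgue_tuple R d]_(x in @torus R d) k x)%E.
Proof.
move=> mk k0.
have mT := @measurable_torus R d.
rewrite [LHS](@ge0_integral_density _ _ _ _ R (@lebesgue_tuple R d) (distribution P (pos G v))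
  (\1_(@torus R d)) idfun _ _ _ _ k mk k0).
- rewrite [RHS]integral_mkcond; apply: eq_integral => x _.
  by rewrite patchE indicE; case: ifPn => _; rewrite ?mul1e ?mul0e.
- exact: measurable_indic.
- exact: measurable_id.
- by [].
- move=> B mB; transitivity (@lebesgue_tuple R d (@torus R d `&` B)).
    by rewrite setIC -[RHS](pos_uniform G v mB).
  by apply/esym; exact: (@integral_indic _ _ R (@lebesgue_tuple R d) B mB (@torus R d) mT).
Qed.

Lemma position_torus_ae v : {ae P, forall w, torus (pos G v w)}.
Proof.
have mT := @measurable_torus R d.
have mp : measurable_fun setT (pos G v : Omega -> d.-tuple R) by [].
have mA : measurable ((pos G v : Omega -> d.-tuple R) @^-1` (@torus R d)).
  by rewrite -[X in measurable X]setTI; exact: mp.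
exists (~` ((pos G v : Omega -> d.-tuple R) @^-1` (@torus R d))); split => //.
  exact: measurableC.
have -> : P (~` ((pos G v : Omega -> d.-tuple R) @^-1` (@torus R d))) = (1 - P ((pos G v : Omega -> d.-tuple R) @^-1` (@torus R d)))%E.
  exact: probability_setC.
by rewrite pos_uniform // setIid lebesgue_tuple_torus subee.
Qed.

Lemma good_sigma_except v : <<s sigma_except G (inr v) >> A.
Proof.
have S12 : sigma_gaps G `<=` sigma_except G (inr v) by exact: sigma_gaps_except.
exact: (@sub_sigma_algebra2 _ setT _ _ S12 _ (good_sigma_gaps (G := G) c)).
Qed.

(** The position of v is independent of everything else, so it is integrated out with the rest
    frozen. [D] is the distance with v in its first slot, which lets either end of the pair be
    averaged. Translation invariance asks that the other end lie on the torus, which holds almost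
    surely; hence the comparison of integrands almost everywhere. *)
Lemma freeze_position (v o : nat) (D : d.-tuple R -> d.-tuple R -> R)
    (p : nat * nat) (F : Omega -> R) : v != o ->
  (forall dW (W : measurableType dW) (x y : W -> d.-tuple R), measurable_fun setT x ->
     measurable_fun setT y -> measurable_fun setT (fun w => D (x w) (y w))) ->
  (forall y (k : R -> \bar R), torus y -> measurable_fun setT k -> (forall r, 0 <= k r)%E ->
     (\int[@lebesgue_tuple R d]_(x in @torus R d) k (D x y) =
      \int[@lebesgue_tuple R d]_(x in @torus R d) k (enorm x))%E) ->
  measurable_fun (setT : set (g_sigma_algebraType (sigma_except G (inr v)))) F ->
  (forall w, 0 <= F w) ->
  (\int[P]_w (\1_A w * ((birth G p.1 w <= t)%R%:R * edge_density d gamma beta phi g t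
       (birth G p.1 w) (birth G p.2 w) (D (pos G v w) (pos G o w))) * F w)%:E =
   \int[P]_w (\1_A w * birth_weight p w * F w)%:E)%E.
Proof.
move=> vo mD ID mF F0.
pose S := sigma_except G (inr v).
have Sm : S `<=` measurable by exact: sigma_except_measurable.
have mb n : measurable_fun (setT : set (g_sigma_algebraType S)) (birth G n : Omega -> R).
  exact: birth_sigma_except.
have mo : measurable_fun (setT : set (g_sigma_algebraType S)) (pos G o : Omega -> d.-tuple R).
  by apply: pos_sigma_except; apply/eqP => -[ov]; move: vo; rewrite ov eqxx.
have mI : measurable_fun (setT : set (g_sigma_algebraType S)) (\1_A : Omega -> R).
  by apply: measurable_indic; exact: good_sigma_except.
pose f (z : g_sigma_algebraType S * d.-tuple R) : R :=
  \1_A (z.1 : Omega) * ((birth G p.1 z.1 <= t)%R%:R * edge_density d gamma beta phi g t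
       (birth G p.1 z.1) (birth G p.2 z.1) (D z.2 (pos G o z.1))) * F z.1.
have f0 z : 0 <= f z.
  by rewrite mulr_ge0 // mulr_ge0 ?indicE ?ler0n // mulr_ge0 ?ler0n // (edge_density_ge0 _ _ phiP gM).
have mf : measurable_fun setT f.
  apply: measurable_funM; last exact: (measurableT_comp mF measurable_fst).
  apply: measurable_funM; first exact: (measurableT_comp mI measurable_fst).
  apply: measurable_funM.
    exact: (measurableT_comp (measurable_alive t (mb p.1)) measurable_fst).
  apply: measurable_edge_density_comp => //.
  - exact: (measurableT_comp (mb p.1) measurable_fst).
  - exact: (measurableT_comp (mb p.2) measurable_fst).
  - apply: mD; first exact: measurable_snd.
    exact: (measurableT_comp mo measurable_fst).
have mX : measurable_fun setT (pos G v : Omega -> d.-tuple R) by [].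
have PX (B : set Omega) (C : set (d.-tuple R)) : <<s S >> B -> measurable C ->
    P (B `&` (pos G v : Omega -> d.-tuple R) @^-1` C) = (P B * distribution P (pos G v) C)%E.
  move=> sB mC; rewrite (@vertex_independent_rest _ _ _ _ _ _ _ _ G (inr v) B _ sB) //.
  by exists C => //; rewrite setTI.
rewrite [LHS](@ge0_integral_freeze _ _ R P S Sm _ _ (pos G v) (distribution P (pos G v)) f mX PX mf f0).
have mfE : measurable_fun setT (EFin \o f) by exact/measurable_EFinP.
have fE0 z : (0 <= (EFin \o f) z)%E by rewrite /= lee_fin.
apply: ae_eq_integral => //.
- apply: (measurable_fun_sub_sigma Sm).
  exact: (@measurable_fun_fubini_tonelli_F _ _ _ _ _ (distribution P (pos G v)) _ mfE fE0).
- apply: (measurable_fun_sub_sigma Sm); apply/measurable_EFinP.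
  apply: measurable_funM => //; apply: measurable_funM => //.
  exact: measurable_birth_weight.
have := position_torus_ae o; apply: filterS => w ow _.
have mfw : measurable_fun setT (fun x => (f (w, x))%:E).
  have mp : measurable_fun setT (fun x : d.-tuple R => ((w : g_sigma_algebraType S), x)) by exact: pair1_measurable.
  exact: (measurableT_comp mfE mp).
rewrite integral_position //; last by move=> x; rewrite lee_fin.
pose K := \1_A w * (birth G p.1 w <= t)%R%:R * F w.
have K0 : 0 <= K by rewrite !mulr_ge0.
pose k (r : R) := (K * edge_density d gamma beta phi g t (birth G p.1 w) (birth G p.2 w) r)%:E.
have me := @measurable_edge_density _ d gamma beta _ phiP _ mg t (birth G p.1 w) (birth G p.2 w).
have mk : measurable_fun setT k by apply/measurable_EFinP; exact: measurable_funM.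
transitivity (\int[@lebesgue_tuple R d]_(x in @torus R d) k (D x (pos G o w)))%E.
  by apply: eq_integral => x _; rewrite /k /f /K /=; congr EFin; ring.
rewrite ID //; last by move=> r; rewrite lee_fin mulr_ge0 // (edge_density_ge0 _ _ phiP gM).
rewrite /k; under eq_integral do rewrite EFinM.
have men : measurable_fun (@torus R d) (fun x => (edge_density d gamma beta phi g t (birth G p.1 w) (birth G p.2 w) (enorm x))%:E).
  apply/measurable_EFinP; apply: measurable_funTS.
  exact: (measurableT_comp me (@measurable_enorm R d)).
have en0 x : @torus R d x -> (0 <= (edge_density d gamma beta phi g t (birth G p.1 w) (birth G p.2 w) (enorm x))%:E)%E.
  by rewrite lee_fin (edge_density_ge0 _ _ phiP gM).
rewrite (@ge0_integralZl _ _ R (@lebesgue_tuple R d) _ (@measurable_torus R d) _ men _ en0) ?lee_fin //.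
rewrite -(edge_meanE gamma beta phiP mg gM) -EFinM /K /birth_weight; congr EFin; ring.
Qed.

Lemma vertex_weight_freeze (v : nat) (p : nat * nat) (F : Omega -> R) : p.1 != p.2 ->
  (v == p.1) || (v == p.2) ->
  measurable_fun (setT : set (g_sigma_algebraType (sigma_except G (inr v)))) F ->
  (forall w, 0 <= F w) ->
  (\int[P]_w (\1_A w * vertex_weight p w * F w)%:E =
   \int[P]_w (\1_A w * birth_weight p w * F w)%:E)%E.
Proof.
move=> p12 vp mF F0.
case/orP: vp => /eqP vp.
  rewrite -(@freeze_position v p.2 (@torus_dist R d) p F) ?vp //.
  - by move=> dW W x y; exact: measurable_torus_dist.
  - by move=> y k ty mk k0; exact: integral_torus_dist.
  - by rewrite -vp.
rewrite -(@freeze_position v p.1 (fun x y => torus_dist y x) p F) ?vp //.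
- by rewrite eq_sym.
- by move=> dW W x y mx my; exact: measurable_torus_dist.
- move=> y k ty mk k0; rewrite -(integral_torus_dist ty mk k0).
  by apply: eq_integral => x /set_mem tx; rewrite torus_distC.
- by rewrite -vp.
Qed.
End position_averaging.

(** * Fluctuations *)

Section bounded_functions.
Context (dT : measure_display) (T : measurableType dT) (R : realType).
Context (P : probability T R).

(** A class of integrable functions closed under sums and products, in which signed integrals may be
    expanded freely. *)
Definition bounded_measurable (f : T -> R) : Prop :=
  measurable_fun setT f /\ exists B, forall w, `|f w| <= B.

Lemma bounded_measurable_integrable f : bounded_measurable f ->
  P.-integrable setT (EFin \o f).
Proof.
move=> [mf [B fB]]; apply: measurable_bounded_integrable => //.
- by rewrite -ge0_fin_numE // fin_num_measure.
- exists B; split; first by rewrite num_real.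
  by move=> x Bx w _; exact: le_trans (fB w) (ltW Bx).
Qed.

Lemma bounded_measurableD f h : bounded_measurable f -> bounded_measurable h ->
  bounded_measurable (fun w => f w + h w).
Proof.
move=> [mf [B fB]] [mh [C hC]]; split; first exact: measurable_funD.
by exists (B + C) => w; apply: (le_trans (ler_normD _ _)); exact: lerD.
Qed.

Lemma bounded_measurableN f : bounded_measurable f -> bounded_measurable (fun w => - f w).
Proof.
move=> [mf [B fB]]; split; first exact: measurableT_comp.
by exists B => w; rewrite normrN.
Qed.

Lemma bounded_measurableM f h : bounded_measurable f -> bounded_measurable h ->
  bounded_measurable (fun w => f w * h w).
Proof.
move=> [mf [B fB]] [mh [C hC]]; split; first exact: measurable_funM.
by exists (B * C) => w; rewrite normrM ler_pM.
Qed.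

Lemma bounded_measurable_sum (I : Type) (r : seq I) (f : I -> T -> R) :
  (forall i, bounded_measurable (f i)) -> bounded_measurable (fun w => \sum_(i <- r) f i w).
Proof.
move=> bf; elim: r => [|i r IH].
  split; first by under eq_fun do rewrite big_nil; exact: measurable_cst.
  by exists 0 => w; rewrite big_nil normr0.
by under eq_fun do rewrite big_cons; exact: bounded_measurableD.
Qed.

Lemma Rintegral_bounded_sum (I : Type) (r : seq I) (f : I -> T -> R) :
  (forall i, bounded_measurable (f i)) ->
  \int[P]_w (\sum_(i <- r) f i w) = \sum_(i <- r) \int[P]_w f i w.
Proof.
move=> bf; elim: r => [|i r IH].
  rewrite big_nil; under eq_Rintegral do rewrite big_nil.
  by rewrite Rintegral_cst // mul0r.
rewrite big_cons -IH; under eq_Rintegral do rewrite big_cons.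
by rewrite RintegralD //; apply: bounded_measurable_integrable => //;
  exact: bounded_measurable_sum.
Qed.

Lemma uncorrelated_second_moment (I : eqType) (r : seq I) (D : I -> T -> R) : uniq r ->
  (forall i, bounded_measurable (D i)) ->
  {in r &, forall i j, i != j -> \int[P]_w (D i w * D j w) = 0} ->
  \int[P]_w ((\sum_(i <- r) D i w) ^+ 2) = \sum_(i <- r) \int[P]_w (D i w ^+ 2).
Proof.
move=> ur bD D0.
have bDD i j : bounded_measurable (fun w => D i w * D j w) by exact: bounded_measurableM.
under eq_Rintegral do rewrite expr2 big_distrlr /=.
rewrite Rintegral_bounded_sum; last by move=> i; exact: bounded_measurable_sum.
rewrite !big_seq; apply: eq_bigr => i ir.
rewrite Rintegral_bounded_sum // (bigD1_seq i) //= big_seq_cond big1 ?addr0 //.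
by move=> j /andP[jr ji]; apply: D0 => //; rewrite eq_sym.
Qed.

(** The hypotheses on mixed moments make the differences Y_i - H_i orthogonal, so only squares
    survive. As Y_i and H_i are nonnegative, each square is at most Y_i^2 + H_i^2. Here H_i will be
    the mean of Y_i given the births. *)
Lemma decorrelated_second_moment (I : eqType) (r : seq I) (Y H : I -> T -> R) : uniq r ->
  (forall i, bounded_measurable (Y i)) -> (forall i, bounded_measurable (H i)) ->
  (forall i w, 0 <= Y i w) -> (forall i w, 0 <= H i w) ->
  {in r &, forall i j, i != j ->
    \int[P]_w (Y i w * Y j w) = \int[P]_w (H i w * H j w) /\
    \int[P]_w (Y i w * H j w) = \int[P]_w (H i w * H j w)} ->
  \int[P]_w ((\sum_(i <- r) Y i w - \sum_(i <- r) H i w) ^+ 2) <=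
  \sum_(i <- r) (\int[P]_w (Y i w ^+ 2) + \int[P]_w (H i w ^+ 2)).
Proof.
move=> ur bY bH Y0 H0 YH.
have bD i : bounded_measurable (fun w => Y i w - H i w).
  by apply: bounded_measurableD => //; exact: bounded_measurableN.
under eq_Rintegral do rewrite -sumrB.
rewrite (@uncorrelated_second_moment _ r (fun i w => Y i w - H i w) ur bD).
  apply: ler_sum => i _.
  have bY2 : bounded_measurable (fun w => Y i w ^+ 2).
    by under eq_fun do rewrite expr2; exact: bounded_measurableM.
  have bH2 : bounded_measurable (fun w => H i w ^+ 2).
    by under eq_fun do rewrite expr2; exact: bounded_measurableM.
  rewrite -RintegralD //; [|exact: bounded_measurable_integrable..].
  apply: le_Rintegral => //.
  - apply: bounded_measurable_integrable; under eq_fun do rewrite expr2.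
    exact: bounded_measurableM.
  - by apply: bounded_measurable_integrable; exact: bounded_measurableD.
  - move=> w _; have := Y0 i w; have := H0 i w; nra.
move=> i j ir jr ij; have [e1 e2] := YH i j ir jr ij.
have ji : j != i by rewrite eq_sym.
have [_ e3] := YH j i jr ir ji.
transitivity (\int[P]_w ((Y i w * Y j w + H i w * H j w) - (Y i w * H j w + Y j w * H i w))).
  by apply: eq_Rintegral => w _; ring.
rewrite RintegralB // ?RintegralD //;
  try (by apply: bounded_measurable_integrable; repeat (apply: bounded_measurableD ||
    apply: bounded_measurableM)).
rewrite e1 e2 e3.
have -> : \int[P]_w (H j w * H i w) = \int[P]_w (H i w * H j w).
  by apply: eq_Rintegral => w _; rewrite mulrC.
by rewrite subrr.
Qed.

Lemma measurable_norm_gt (f : T -> R) e : measurable_fun setT f ->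
  measurable [set w | e < `|f w|].
Proof.
move=> mf; rewrite (_ : mkset _ = setT `&` (fun w => `|f w|) @^-1` `]e, +oo[%classic).
  have mn : measurable_fun setT (fun w => `|f w|) by exact: measurableT_comp.
  by apply: mn => //; exact: measurable_itv.
by rewrite setTI; apply/seteqP; split => w /=; rewrite in_itv /= andbT.
Qed.

Lemma second_moment_chebyshev (f : T -> R) (eps : R) : bounded_measurable f -> 0 < eps ->
  (P [set w | eps < `|f w|]%R <= (eps ^- 2 * \int[P]_w (f w ^+ 2))%:E)%E.
Proof.
move=> bf e0; have [mf _] := bf.
have mA : measurable [set w | eps < `|f w|] by exact: measurable_norm_gt.
have bf2 : bounded_measurable (fun w => f w ^+ 2).
  by under eq_fun do rewrite expr2; exact: bounded_measurableM.
have bfe : bounded_measurable (fun w => eps ^- 2 * f w ^+ 2).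
  apply: bounded_measurableM => //; split; first exact: measurable_cst.
  by exists `|eps ^- 2|.
have bA : bounded_measurable (\1_[set w | eps < `|f w|] : T -> R).
  split; first exact: measurable_indic.
  by exists 1 => w; rewrite indicE; case: (_ \in _); rewrite ?normr1 ?normr0.
have -> : P [set w | eps < `|f w|] = (\int[P]_w \1_[set w | eps < `|f w|] w)%:E.
  rewrite /Rintegral integral_indic // setIT fineK //.
  exact: fin_num_measure.
rewrite lee_fin -RintegralZl //; last exact: bounded_measurable_integrable.
apply: le_Rintegral => //; [exact: bounded_measurable_integrable..|].
move=> w _; rewrite indicE; case: (boolP (w \in _)) => [/set_mem /= ew|_].
  rewrite mulrC ler_pdivlMr ?exprn_gt0 // mul1r -(real_normK (num_real (f w))).
  by rewrite ler_sqr ?nnegrE // ltW.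
by rewrite mulr_ge0 // ?invr_ge0 ?sqr_ge0 // exprn_ge0 // ltW.
Qed.
End bounded_functions.

Definition ordered_pairs (N : nat) : seq (nat * nat) :=
  [seq (i, j) | i <- iota 0 N, j <- iota 0 i].

Lemma ordered_pairs_uniq N : uniq (ordered_pairs N).
Proof.
apply: allpairs_uniq_dep; first exact: iota_uniq.
  by move=> i _; exact: iota_uniq.
by move=> [a b] [a' b'] _ _ /= [-> ->].
Qed.

Lemma ordered_pairs_lt N p : p \in ordered_pairs N -> (p.2 < p.1)%N.
Proof. by case/allpairsPdep => i [j [_]]; rewrite mem_iota => /andP[_ ji] ->. Qed.

(** Extending the torus integral to R^d leaves at most M / k, with k = u / (beta (u / s)^gamma).
    Since u / s >= 1 and gamma < 1, the power is at most u / s, whence k >= s / beta. *)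
Lemma edge_mean_le_inv (R : realType) (d : nat) (gamma beta : R) (phi g : R -> R) (M t u s : R) :
  (0 < d)%N -> 0 < gamma < 1 -> 0 < beta -> profile d phi ->
  measurable_fun setT g -> (forall r, 0 <= g r <= M) -> 0 < s -> s <= u ->
  edge_mean d gamma beta phi g t u s <= M * beta / s.
Proof.
move=> d0 /andP[gamma0 gamma1] beta0 phiP mg gM s0 su.
have u0 : 0 < u by exact: lt_le_trans su.
have M0 : 0 <= M by have /andP[h1 h2] := gM 0; exact: le_trans h2.
pose k := u / (beta * (u / s) `^ gamma).
have us0 : 0 < u / s by rewrite divr_gt0.
have k0 : 0 < k by rewrite divr_gt0 // mulr_gt0 // powR_gt0.
have us1 : 1 <= u / s by rewrite ler_pdivlMr // mul1r.
have ksb : s / beta <= k.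
  rewrite /k ler_pdivlMr ?mulr_gt0 ?powR_gt0 // mulrA divfK ?gt_eqF //.
  rewrite mulrC -ler_pdivlMr //.
  by rewrite -[leRHS](powRr1 (ltW us0)); apply: ler_powR => //; exact: ltW.
apply: (@le_trans _ _ (M / k)); last first.
  rewrite -mulrA ler_wpM2l // -(invrK beta) -invfM lef_pV2 ?posrE ?mulr_gt0 ?invr_gt0 ?mulr_gt0 ?powR_gt0 //.
  by rewrite mulrC.
have mc : measurable_fun setT (fun x : d.-tuple R => clamped phi (k * enorm x ^+ d)).
  apply: (measurableT_comp (measurable_clamped phiP)).
  apply: measurable_funM => //; apply: measurable_funX; exact: measurable_enorm.
have me : measurable_fun setT (fun x : d.-tuple R => (edge_density d gamma beta phi g t u s (enorm x))%:E).
  apply/measurable_EFinP.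
  exact: (measurableT_comp (@measurable_edge_density _ d gamma beta _ phiP _ mg t u s) (@measurable_enorm R d)).
rewrite -lee_fin (edge_meanE gamma beta phiP mg gM).
apply: (@le_trans _ _ (\int[@lebesgue_tuple R d]_x (M%:E * (clamped phi (k * enorm x ^+ d))%:E))%E).
  apply: (@le_trans _ _ (\int[@lebesgue_tuple R d]_x (edge_density d gamma beta phi g t u s (enorm x))%:E)%E).
    apply: (@ge0_subset_integral _ _ R (@lebesgue_tuple R d) _ setT (@measurable_torus R d) measurableT _ me) => //.
    by move=> x _; rewrite lee_fin (edge_density_ge0 _ _ phiP gM).
  apply: ge0_le_integral => //.
  - by move=> x _; rewrite lee_fin (edge_density_ge0 _ _ phiP gM).
  - by under eq_fun do rewrite -EFinM; apply/measurable_EFinP; exact: measurable_funM.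
  - move=> x _; rewrite -EFinM lee_fin /edge_density mulrC.
    have -> : u * enorm x ^+ d / (beta * (u / s) `^ gamma) = k * enorm x ^+ d.
      by rewrite /k mulrAC.
    by rewrite ler_wpM2r ?(clamped_ge0 phiP) //; have /andP[] := gM (t `^ (d%:R^-1) * enorm x).
have mcE : measurable_fun setT (fun x : d.-tuple R => (clamped phi (k * enorm x ^+ d))%:E).
  exact/measurable_EFinP.
have c0 x : setT x -> (0 <= (clamped phi (k * enorm (x : d.-tuple R) ^+ d))%:E)%E.
  by move=> _; rewrite lee_fin (clamped_ge0 phiP).
rewrite (@ge0_integralZl _ _ R (@lebesgue_tuple R d) setT measurableT _ mcE _ c0) ?lee_fin //.
by rewrite (integral_clamped phiP d0 k0) -EFinM lee_fin.
Qed.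

Section edge_moments.
Context (R : realType) (d : nat) (gamma beta : R) (phi : R -> R).
Hypotheses (d0 : (0 < d)%N) (gammaP : 0 < gamma < 1) (beta0 : 0 < beta) (phiP : profile d phi).
Context (dO : measure_display) (Omega : measurableType dO).
Context (P : probability Omega R) (G : age_based_network d gamma beta phi P).
Context (g : R -> R) (M : R).
Hypotheses (mg : measurable_fun setT g) (gM : forall r, 0 <= g r <= M).
Context (t c : R).
Hypothesis c0 : 0 < c.

Let g0 r : 0 <= g r. Proof. by have /andP[] := gM r. Qed.
Let M0 : 0 <= M. Proof. by have /andP[h1 h2] := gM 0; exact: le_trans h2. Qed.

Local Notation edge_weight := (edge_weight G g t).
Local Notation vertex_weight := (vertex_weight G g t).
Local Notation birth_weight := (birth_weight G g t).
Local Notation A := (good G c).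

Let birth_except v n : measurable_fun (setT : set (g_sigma_algebraType (sigma_except G (inr v))))
  (birth G n : Omega -> R).
Proof. exact: birth_sigma_except. Qed.

Let birth_all n : measurable_fun (setT : set (g_sigma_algebraType (sigma_all G)))
  (birth G n : Omega -> R).
Proof. exact: birth_sigma_all. Qed.

Lemma birth_weight_le_inv p w : (p.2 < p.1)%N -> A w ->
  birth_weight p w <= M * beta / (c * p.2.+1%:R).
Proof.
move=> plt gw; rewrite /birth_weight.
have C0 : 0 <= M * beta / (c * p.2.+1%:R).
  by rewrite divr_ge0 // ?mulr_ge0 // ltW.
case: (_ <= t); last by rewrite mul0r.
rewrite mul1r; have b2 := good_birth_gt0 p.2 gw.
apply: (le_trans (edge_mean_le_inv t d0 gammaP beta0 phiP mg gM b2 _)).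
  by apply: ltW; exact: good_birth_lt gw plt.
rewrite ler_wpM2l ?mulr_ge0 ?(ltW beta0) // lef_pV2 ?posrE ?mulr_gt0 ?ltr0n //.
by have [_ ->] := gw.
Qed.

Lemma edge_weight_le p w : edge_weight p w <= M.
Proof.
rewrite /edge_weight; have /andP[_ h] := gM (t `^ (d%:R^-1) * torus_dist (pos G p.1 w) (pos G p.2 w)).
case: (_ <= t); last by rewrite mul0r.
rewrite mul1r indicE; case: (_ \in _); first by rewrite mul1r.
by rewrite mul0r.
Qed.

Lemma birth_weight_le p w : birth_weight p w <= M.
Proof.
rewrite /birth_weight; case: (_ <= t); last by rewrite mul0r.
by rewrite mul1r; apply: (edge_mean_le _ _ phiP mg gM).
Qed.

Let Y p w := \1_A w * edge_weight p w.
Let H p w := \1_A w * birth_weight p w.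

Let indicM (a b : R) w : \1_A w * a * (\1_A w * b) = \1_A w * a * b.
Proof. by rewrite indicE; case: (_ \in _); rewrite ?mul1r ?mul0r. Qed.

Let Y0 p w : 0 <= Y p w.
Proof. by rewrite mulr_ge0 // (edge_weight_ge0 _ gM). Qed.

Let H0 p w : 0 <= H p w.
Proof. by rewrite mulr_ge0 // (birth_weight_ge0 phiP _ gM). Qed.

Let bY p : bounded_measurable (Y p).
Proof.
split.
  apply: measurable_funM; first by apply: measurable_indic; exact: measurable_good.
  apply: measurable_funM.
    by apply: (measurable_fun_sub_sigma (@sigma_all_measurable _ _ _ _ _ _ _ _ G)); exact: measurable_alive.
  apply: measurable_funM; first by apply: measurable_indic; exact: link_measurable.
  apply: (measurable_fun_sub_sigma (@sigma_all_measurable _ _ _ _ _ _ _ _ G)).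
  by apply: measurable_scaled_dist => //; exact: pos_sigma_all.
exists M => w; rewrite ger0_norm // /Y indicE.
by case: (_ \in _); rewrite ?mul1r ?mul0r // edge_weight_le.
Qed.

Let bH p : bounded_measurable (H p).
Proof.
split.
  apply: measurable_funM; first by apply: measurable_indic; exact: measurable_good.
  apply: (measurable_fun_sub_sigma (@sigma_all_measurable _ _ _ _ _ _ _ _ G)).
  exact: (measurable_birth_weight phiP mg gM).
exists M => w; rewrite ger0_norm // /H indicE.
by case: (_ \in _); rewrite ?mul1r ?mul0r // birth_weight_le.
Qed.

(** If the younger ends agree, the older end of p differs from that of q. Otherwise the younger end
    of p is free unless it is the older end of q, and then the older end of p lies below both ends
    of q. *)
Lemma free_vertex (p q : nat * nat) : (p.2 < p.1)%N -> (q.2 < q.1)%N -> p != q ->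
  exists v, [/\ (v == p.1) || (v == p.2), v != q.1 & v != q.2].
Proof.
case: p q => [a b] [a' b'] /= ba ba' /eqP pq.
have [aq1|aq1] := eqVneq a a'.
  exists b; rewrite eqxx orbT; split=> //.
    by rewrite neq_ltn -aq1 ba.
  by apply/eqP => bb; apply: pq; rewrite aq1 bb.
have [aq2|aq2] := eqVneq a b'; last by exists a; rewrite eqxx.
exists b; rewrite eqxx orbT; split=> //.
  by rewrite neq_ltn (ltn_trans ba) // aq2.
by rewrite neq_ltn -aq2 ba.
Qed.

(* Two distinct pairs do not have the same vertices, so each pair has a vertex
   that is free of the other one: averaging over its position makes the weights
   uncorrelated. *)
Lemma birth_weight_cross p q : (p.2 < p.1)%N -> (q.2 < q.1)%N -> p != q ->
  \int[P]_w (Y p w * Y q w) = \int[P]_w (H p w * H q w) /\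
  \int[P]_w (Y p w * H q w) = \int[P]_w (H p w * H q w).
Proof.
move=> plt qlt pq.
have pne : p.1 != p.2 by rewrite neq_ltn plt orbT.
have qne : q.1 != q.2 by rewrite neq_ltn qlt orbT.
have hb0 r w : 0 <= birth_weight r w by exact: (birth_weight_ge0 phiP _ gM).
have E3 : (\int[P]_w (\1_A w * birth_weight p w * birth_weight q w)%:E =
    \int[P]_w (H p w * H q w)%:E)%E.
  by apply: eq_integral => w _; rewrite /H indicM.
have mbE v r : measurable_fun (setT : set (g_sigma_algebraType (sigma_except G (inr v)))) (birth_weight r).
  exact: (measurable_birth_weight phiP mg gM t (@birth_except v r.1) (@birth_except v r.2)).
have mbA r : measurable_fun (setT : set (g_sigma_algebraType (sigma_all G))) (birth_weight r).
  exact: (measurable_birth_weight phiP mg gM t (@birth_all r.1) (@birth_all r.2)).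
have vf := @vertex_weight_freeze _ _ _ _ _ phiP _ _ _ G _ _ mg gM t c.
have VC (a b : Omega -> R) :
    (\int[P]_w (\1_A w * a w * b w)%:E = \int[P]_w (\1_A w * b w * a w)%:E)%E.
  by apply: eq_integral => w _; rewrite mulrAC.
split; rewrite /Rintegral; apply: (f_equal fine); rewrite -E3.
  transitivity (\int[P]_w (\1_A w * edge_weight p w * edge_weight q w)%:E)%E.
    by apply: eq_integral => w _; rewrite /Y indicM.
  rewrite (edge_weight_link2 beta0 phiP G mg gM t c plt qlt pq).
  have [v [vp vq1 vq2]] := free_vertex plt qlt pq.
  have mV : measurable_fun (setT : set (g_sigma_algebraType (sigma_except G (inr v)))) (vertex_weight q).
    have n1 : inr q.1 != (inr v : nat + nat) by apply/eqP => -[qv]; move: vq1; rewrite qv eqxx.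
    have n2 : inr q.2 != (inr v : nat + nat) by apply/eqP => -[qv]; move: vq2; rewrite qv eqxx.
    exact: (@measurable_vertex_weight _ _ _ _ _ phiP _ _ _ G _ mg t _ q (@birth_except v q.1) (@birth_except v q.2)
      (@pos_sigma_except _ _ _ _ _ _ _ _ G _ _ n1) (@pos_sigma_except _ _ _ _ _ _ _ _ G _ _ n2)).
  rewrite (vf v p _ pne vp mV (fun w => vertex_weight_ge0 phiP G gM t q w)).
  (* The factor of [p] now depends on births only, so a vertex of [q] may be averaged with that
     factor frozen, even if the pairs share it. *)
  apply: (etrans (VC (birth_weight p) (vertex_weight q))).
  apply: etrans (VC (birth_weight q) (birth_weight p)).
  exact: (vf q.1 q (birth_weight p) qne (introT orP (or_introl (eqxx _))) (mbE q.1 p) (hb0 p)).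
transitivity (\int[P]_w (\1_A w * edge_weight p w * birth_weight q w)%:E)%E.
  by apply: eq_integral => w _; rewrite /Y /H indicM.
apply: (etrans (edge_weight_link beta0 phiP mg gM t c plt (mbA q) (hb0 q))).
exact: (vf p.1 p (birth_weight q) pne (introT orP (or_introl (eqxx _))) (mbE p.1 q) (hb0 q)).
Qed.

Lemma edge_weight_mean p : (p.2 < p.1)%N -> \int[P]_w Y p w = \int[P]_w H p w.
Proof.
move=> plt; have pne : p.1 != p.2 by rewrite neq_ltn plt orbT.
rewrite /Rintegral; congr fine.
transitivity (\int[P]_w (\1_A w * edge_weight p w * cst 1 w)%:E)%E.
  by apply: eq_integral => w _; rewrite mulr1.
have c1 (S : set_system Omega) : measurable_fun (setT : set (g_sigma_algebraType S)) (cst 1 : Omega -> R).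
  exact: measurable_cst.
have c10 w : 0 <= (cst 1 : Omega -> R) w by [].
apply: (etrans (edge_weight_link beta0 phiP mg gM t c plt (c1 _) c10)).
apply: (etrans (@vertex_weight_freeze _ _ _ _ _ phiP _ _ _ G _ _ mg gM t c p.1 p _ pne
  (introT orP (or_introl (eqxx _))) (c1 _) c10)).
by apply: eq_integral => w _; rewrite mulr1.
Qed.

(** Weights lie in [0, M], so a second moment is at most M times the mean. The edge weight and the
    birth weight have the same mean on the good event, and there the latter is bounded pointwise. *)
Lemma edge_weight_second_moment p : (p.2 < p.1)%N ->
  \int[P]_w (Y p w ^+ 2) + \int[P]_w (H p w ^+ 2) <= 2 * M * (M * beta / (c * p.2.+1%:R)).
Proof.
move=> plt.
have sq f : bounded_measurable f -> (forall w, 0 <= f w <= M) ->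
    \int[P]_w (f w ^+ 2) <= M * \int[P]_w f w.
  move=> bf fM; rewrite -RintegralZl //; last exact: bounded_measurable_integrable.
  apply: le_Rintegral => //.
  - apply: bounded_measurable_integrable; under eq_fun do rewrite expr2.
    exact: bounded_measurableM.
  - apply: bounded_measurable_integrable; apply: bounded_measurableM => //.
    by split; [exact: measurable_cst|exists `|M|].
  - by move=> w _; have /andP[f0 f1] := fM w; rewrite expr2 ler_wpM2r.
have YM w : 0 <= Y p w <= M.
  rewrite Y0 /Y indicE; case: (_ \in _); rewrite ?mul1r ?mul0r //.
  exact: edge_weight_le.
have HM w : 0 <= H p w <= M.
  rewrite H0 /H indicE; case: (_ \in _); rewrite ?mul1r ?mul0r //.
  exact: birth_weight_le.
have HI : \int[P]_w H p w <= M * beta / (c * p.2.+1%:R).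
  have C0 : 0 <= M * beta / (c * p.2.+1%:R).
    by rewrite divr_ge0 // ?mulr_ge0 // ltW.
  rewrite -[leRHS]mulr1 -[X in _ * X](_ : fine (P setT) = 1); last by rewrite probability_setT.
  rewrite -(Rintegral_cst P measurableT); apply: le_Rintegral => //.
  - exact: bounded_measurable_integrable.
  - by apply: bounded_measurable_integrable; split; [exact: measurable_cst|exists `|M * beta / (c * p.2.+1%:R)|].
  move=> w _; rewrite /H indicE; case: (boolP (w \in A)) => [/set_mem gw|_]; last by rewrite mul0r.
  by rewrite mul1r; exact: birth_weight_le_inv.
have hY := sq _ (bY p) YM; rewrite edge_weight_mean // in hY.
have hH := sq _ (bH p) HM.
have hM : M * \int[P]_w H p w <= M * (M * beta / (c * p.2.+1%:R)) by rewrite ler_wpM2l.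
apply: (le_trans (lerD (le_trans hY hM) (le_trans hH hM))).
by rewrite -mulr2n -[leLHS]mulr_natl -[leRHS]mulrA.
Qed.

Lemma edge_chebyshev N eps : 0 < eps ->
  (P [set w | (eps < `|\1_A w * (\sum_(p <- ordered_pairs N) edge_weight p w -
                              \sum_(p <- ordered_pairs N) birth_weight p w)|)%R] <=
   (eps ^- 2 * \sum_(p <- ordered_pairs N) (2 * M * (M * beta / (c * p.2.+1%:R))))%:E)%E.
Proof.
move=> e0.
have Du := ordered_pairs_uniq N.
have bS : bounded_measurable (fun w => \sum_(p <- ordered_pairs N) Y p w - \sum_(p <- ordered_pairs N) H p w).
  apply: bounded_measurableD; first exact: bounded_measurable_sum.
  by apply: bounded_measurableN; exact: bounded_measurable_sum.
rewrite (_ : mkset _ = [set w | (eps < `|\sum_(p <- ordered_pairs N) Y p w - \sum_(p <- ordered_pairs N) H p w|)%R]).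
  apply: (le_trans (second_moment_chebyshev P bS e0)).
  rewrite lee_fin ler_wpM2l ?invr_ge0 ?exprn_ge0 ?(ltW e0) //.
  have cross : {in ordered_pairs N &, forall i j, i != j ->
      \int[P]_w (Y i w * Y j w) = \int[P]_w (H i w * H j w) /\
      \int[P]_w (Y i w * H j w) = \int[P]_w (H i w * H j w)}.
    by move=> p q /ordered_pairs_lt plt /ordered_pairs_lt qlt pq; exact: birth_weight_cross.
  apply: (le_trans (decorrelated_second_moment Du bY bH Y0 H0 cross)).
  rewrite !big_seq; apply: ler_sum => p /ordered_pairs_lt; exact: edge_weight_second_moment.
apply/seteqP; split => w /=; by rewrite mulrBr !mulr_sumr.
Qed.
End edge_moments.

(** * Edge sums on the good event *)

Lemma eventually_outside_probability0 (dT : measure_display) (T : measurableType dT)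
    (R : realType) (P : probability T R) (E : nat -> set T) :
  (forall k, measurable (E k)) -> {ae P, forall w, \forall k \near \oo, ~ E k w} ->
  P (E k) @[k --> \oo] --> 0%E.
Proof.
move=> mE aE.
have mI k : measurable_fun setT (fun w => (\1_(E k) w)%:E : \bar R).
  by apply/measurable_EFinP; exact: measurable_indic.
have i1 : P.-integrable setT (fun w : T => (cst 1%R w)%:E : \bar R).
  apply: bounded_measurable_integrable; split; first exact: measurable_cst.
  by exists `|1|.
have [_ _ H] := @dominated_convergence _ _ R P setT measurableT
  (fun k w => (\1_(E k) w)%:E) (fun=> 0%E) (fun w => (cst 1%R w)%:E) mI
  (measurable_cst 0%E) (ltac:(by
    apply: filterS aE => w Ew _; apply: cvg_near_cst; apply: filterS Ew => k Ek;
    rewrite indicE memNset)) i1 (ltac:(by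
    apply: aeW => w k _; rewrite /= lee_fin indicE; case: (_ \in _); rewrite ?normr1 ?normr0)).
rewrite integral0 in H.
rewrite (_ : (fun k => P (E k)) = (fun k => \int[P]_w (\1_(E k) w)%:E)%E) //.
by apply/funext => k; rewrite integral_indic // setIT.
Qed.

(** Cruder than a logarithm, but enough for a variance of order t^(3/2). The induction uses 2 b (b -
    a) >= b^2 - a^2 = 1 for a and b the roots of n and n + 1. *)
Lemma harmonic_le_sqrt (R : realType) n :
  \sum_(j < n) (j.+1%:R)^-1 <= 2 * Num.sqrt n%:R :> R.
Proof.
elim: n => [|n IH]; first by rewrite big_ord0 sqrtr0 mulr0.
rewrite big_ord_recr /=; apply: (le_trans (lerD IH (lexx _))).
have : Num.sqrt n.+1%:R ^+ 2 = Num.sqrt n%:R ^+ 2 + 1 :> R by rewrite !sqr_sqrtr // natr1.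
have : Num.sqrt n.+1%:R ^+ 2 = n.+1%:R :> R by rewrite sqr_sqrtr.
have : Num.sqrt n%:R <= Num.sqrt n.+1%:R :> R by rewrite ler_sqrt // ler_nat.
have : 1 <= Num.sqrt n.+1%:R :> R by rewrite -[leLHS]sqrtr1 ler_sqrt // ler1n.
have : 0 <= Num.sqrt n%:R :> R by exact: sqrtr_ge0.
set a := Num.sqrt n%:R; set b := Num.sqrt n.+1%:R.
move: a b => a b a0 b1 ab <- b2; have b0 : 0 < b by exact: lt_le_trans b1.
have b20 : 0 < b ^+ 2 by rewrite exprn_gt0.
rewrite addrC -lerBrDr -mulrBr -(mul1r (b ^- 2)) ler_pdivrMr //.
have h : 1 <= 2 * b * (b - a) by nra.
rewrite [leRHS](_ : _ = 2 * b * (b - a) * b); last by ring.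
by apply: (le_trans h); rewrite ler_peMr // (le_trans _ h).
Qed.

Lemma ordered_pairs_sum (R : realType) (N : nat) (f : nat * nat -> R) :
  \sum_(p <- ordered_pairs N) f p = \sum_(i < N) \sum_(j < i) f (nat_of_ord i, nat_of_ord j).
Proof.
rewrite /ordered_pairs big_allpairs_dep.
have E n (h : nat -> R) : \sum_(i <- iota 0 n) h i = \sum_(i < n) h i.
  by rewrite -(big_mkord xpredT) /index_iota subn0.
by rewrite E; apply: eq_bigr => i _; rewrite E.
Qed.

Lemma ordered_pairs_sum_le (R : realType) (N : nat) (K : R) : 0 <= K ->
  \sum_(p <- ordered_pairs N) K / p.2.+1%:R <= 2 * K * N%:R * Num.sqrt N%:R.
Proof.
move=> K0; rewrite ordered_pairs_sum /=.
apply: (@le_trans _ _ (\sum_(i < N) 2 * K * Num.sqrt N%:R)).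
  apply: ler_sum => i _; rewrite -mulr_sumr -mulrA mulrCA ler_wpM2l //.
  apply: (le_trans (harmonic_le_sqrt R i)).
  by rewrite ler_wpM2l // ler_sqrt // ler_nat ltnW.
by rewrite sumr_const card_ord -[leLHS]mulr_natr mulrAC.
Qed.

Section edge_sums.
Context (R : realType) (d : nat) (gamma beta : R) (phi : R -> R).
Hypotheses (d0 : (0 < d)%N) (gammaP : 0 < gamma < 1) (beta0 : 0 < beta) (phiP : profile d phi).
Context (dO : measure_display) (Omega : measurableType dO).
Context (P : probability Omega R) (G : age_based_network d gamma beta phi P).
Context (g : R -> R) (M : R).
Hypotheses (mg : measurable_fun setT g) (gM : forall r, 0 <= g r <= M).
Context (c : R) (t : nat -> R) (N : nat -> nat).
Hypotheses (c0 : 0 < c) (t1 : forall k, 1 <= t k) (toy : t k @[k --> \oo] --> +oo)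
  (tN : forall k, t k < c * (N k)%:R) (Nt : forall k, c * (N k)%:R <= t k + c).

Local Notation A := (good G c).

Let ell := fine (\int[@lebesgue_triple R d]_z
  ((limit_density gamma phi beta^-1 1 z)%:E * (g (enorm z.2.2))%:E))%E.

Let S k w := \sum_(p <- ordered_pairs (N k)) edge_weight G g (t k) p w.
Let m k w := \sum_(p <- ordered_pairs (N k)) birth_weight G g (t k) p w.

Let t0 k : 0 < t k. Proof. exact: lt_le_trans (t1 k). Qed.

Let birth_all n : measurable_fun (setT : set (g_sigma_algebraType (sigma_all G)))
  (birth G n : Omega -> R).
Proof. exact: birth_sigma_all. Qed.

Lemma measurable_edge_weight s p : measurable_fun setT (edge_weight G g s p).
Proof.
apply: measurable_funM.
  by apply: (measurable_fun_sub_sigma (@sigma_all_measurable _ _ _ _ _ _ _ _ G)); exact: measurable_alive.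
apply: measurable_funM; first by apply: measurable_indic; exact: link_measurable.
apply: (measurable_fun_sub_sigma (@sigma_all_measurable _ _ _ _ _ _ _ _ G)).
by apply: measurable_scaled_dist => //; exact: pos_sigma_all.
Qed.

Let mm k : measurable_fun setT (m k).
Proof.
apply: measurable_sum => p.
apply: (measurable_fun_sub_sigma (@sigma_all_measurable _ _ _ _ _ _ _ _ G)).
exact: (measurable_birth_weight phiP mg gM).
Qed.

Let mS k : measurable_fun setT (S k).
Proof. by apply: measurable_sum => p; exact: measurable_edge_weight. Qed.

Let mA : measurable_fun setT (\1_A : Omega -> R).
Proof. by apply: measurable_indic; exact: measurable_good. Qed.

(** Off the good event the indicator annihilates the deviation. On it, the births of almost every
    outcome form a deterministic sequence to which the convergence of the mean sum applies. *)
Lemma birth_sum_cvg_in_probability e : 0 < e ->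
  P [set w | (e < `|\1_A w * (m k w / t k - ell)|)%R] @[k --> \oo] --> 0%E.
Proof.
move=> e0; apply: eventually_outside_probability0.
  move=> k; apply: measurable_norm_gt; apply: measurable_funM => //.
  by apply: measurable_funB => //; apply: measurable_funM.
apply: filterS (births_strong_law G) => w [_ H].
have [gw|gw] := pselect (A w); last first.
  by near=> k; rewrite /= indicE memNset // mul0r normr0; apply/negP; rewrite -leNgt ltW.
have [_ ge] := gw.
have := mean_sum_cvg d0 gammaP beta0 phiP mg gM c0 ge H t0 toy tN.
move/cvgrPdist_lt => /(_ e e0); apply: filterS => k /=.
rewrite indicE mem_set // mul1r distrC -/ell => h; apply/negP; rewrite -leNgt.
by rewrite /m ordered_pairs_sum; exact: ltW.
Unshelve. all: by end_near.
Qed.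

Lemma edge_fluctuation_cvg e : 0 < e ->
  P [set w | (e < `|\1_A w * ((S k w - m k w) / t k)|)%R] @[k --> \oo] --> 0%E.
Proof.
move=> e0.
pose K := 2 * M * (M * beta / c).
have M0 : 0 <= M by have /andP[h1 h2] := gM 0; exact: le_trans h2.
have K0 : 0 <= K by rewrite !mulr_ge0 ?invr_ge0 ?(ltW beta0) ?(ltW c0).
(* From c N <= t + c and t >= 1 one gets N <= (1 + c) t / c: the number of relevant vertices is
   linear in t. *)
pose a := (1 + c) / c.
have a0 : 0 < a by rewrite divr_gt0 // addr_gt0.
have Na k : (N k)%:R <= a * t k.
  rewrite -(ler_pM2l c0) (le_trans (Nt k)) // /a mulrA mulrCA divff ?gt_eqF // mulr1 mulrDl mul1r lerD2l.
  by rewrite ler_peMr // ltW.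
(* Chebyshev at level e t gives (e t)^-2 times 2 K (a t) sqrt (a t), that is C / sqrt t. *)
pose C := e ^- 2 * (2 * K * a * Num.sqrt a).
have bound k : (P [set w | (e < `|\1_A w * ((S k w - m k w) / t k)|)%R] <= (C / Num.sqrt (t k))%:E)%E.
  rewrite (_ : mkset _ = [set w | (e * t k < `|\1_A w * (S k w - m k w)|)%R]); last first.
    have E w : `|\1_A w * ((S k w - m k w) / t k)| = `|\1_A w * (S k w - m k w)| / t k.
      by rewrite mulrA normrM normfV (gtr0_norm (t0 k)).
    by apply/seteqP; split => w /=; rewrite E ltr_pdivlMr.
  apply: (le_trans (edge_chebyshev d0 gammaP beta0 phiP G mg gM (t k) c0 (N k) (mulr_gt0 e0 (t0 k)))).
  rewrite lee_fin.
  have -> : \sum_(p <- ordered_pairs (N k)) 2 * M * (M * beta / (c * p.2.+1%:R)) =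
      \sum_(p <- ordered_pairs (N k)) K / p.2.+1%:R.
    by apply: eq_bigr => p _; rewrite /K invfM !mulrA.
  apply: (@le_trans _ _ ((e * t k) ^- 2 * (2 * K * (a * t k) * Num.sqrt (a * t k)))).
    rewrite ler_wpM2l ?invr_ge0 ?sqr_ge0 //; apply: (le_trans (ordered_pairs_sum_le _ K0)).
    apply: ler_pM => //; first by rewrite (mulr_ge0 (mulr_ge0 _ K0)) ?ler0n.
      by rewrite ler_wpM2l // mulr_ge0.
    by rewrite ler_sqrt // mulr_ge0 // ltW.
  rewrite sqrtrM ?(ltW a0) // /C.
  have s0 : 0 < Num.sqrt (t k) by rewrite sqrtr_gt0.
  have s2 : t k = Num.sqrt (t k) ^+ 2 by rewrite sqr_sqrtr // ltW.
  rewrite le_eqVlt; apply/orP; left; apply/eqP.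
  rewrite s2 sqrtr_sqr ger0_norm ?(ltW s0) //; move: (Num.sqrt (t k)) s0 => s s0.
  by field; rewrite !gt_eqF.
apply: (@squeeze_cvge _ _ _ _ (fun=> 0%E) _ (fun k => (C / Num.sqrt (t k))%:E)).
- by near=> k; rewrite bound measure_ge0.
- exact: cvg_cst.
- apply: cvg_EFin; first by near=> k.
  have sy : Num.sqrt (t k) @[k --> \oo] --> +oo.
    apply/cvgryPge => B; near=> k.
    have [B0|B0] := leP 0 B; last by rewrite (le_trans (ltW B0)) ?sqrtr_ge0.
    rewrite -[leLHS](ger0_norm B0) -sqrtr_sqr ler_sqrt; last by rewrite ltW.
    by near: k; move/cvgryPge : toy; exact.
  have iy : (Num.sqrt (t k))^-1 @[k --> \oo] --> 0.
    by apply/gtr0_cvgV0 => //; near=> k; rewrite sqrtr_gt0.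
  have := cvgM (cvg_cst C) iy; rewrite mulr0; exact.
Unshelve. all: by end_near.
Qed.

Lemma edge_sum_cvg_in_probability e : 0 < e ->
  P [set w | (e < `|\1_A w * (S k w / t k - ell)|)%R] @[k --> \oo] --> 0%E.
Proof.
move=> e0; have e20 : 0 < e / 2 by rewrite divr_gt0.
pose U k := [set w | (e / 2 < `|\1_A w * ((S k w - m k w) / t k)|)%R].
pose V k := [set w | (e / 2 < `|\1_A w * (m k w / t k - ell)|)%R].
have mU k : measurable (U k).
  apply: measurable_norm_gt; apply: measurable_funM => //; apply: measurable_funM => //.
  exact: measurable_funB.
have mV k : measurable (V k).
  by apply: measurable_norm_gt; apply: measurable_funM => //; apply: measurable_funB => //; apply: measurable_funM.
apply: (@squeeze_cvge _ _ _ _ (fun=> 0%E) _ (fun k => P (U k) + P (V k))%E).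
- near=> k; rewrite measure_ge0 /=; apply: (le_trans _ (measureU2 _ (mU k) (mV k))).
  apply: le_measure; rewrite ?inE.
  + by apply: measurable_norm_gt; apply: measurable_funM => //; apply: measurable_funB => //; apply: measurable_funM.
  + exact: measurableU.
  move=> w /= ew; have [|Uw] := ltP (e / 2) (`|\1_A w * ((S k w - m k w) / t k)|); first by left.
  right; rewrite /V /= ltNge; apply/negP => Vw; move: ew; apply/negP; rewrite -leNgt.
  have -> : \1_A w * (S k w / t k - ell) = \1_A w * ((S k w - m k w) / t k) + \1_A w * (m k w / t k - ell).
    by rewrite -mulrDr; congr (_ * _); rewrite mulrBl addrA subrK.
  by apply: (le_trans (ler_normD _ _)); rewrite [leRHS](splitr e) lerD.
- exact: cvg_cst.
- rewrite -[X in _ --> X](adde0 0%E); apply: cvgeD => //.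
    exact: edge_fluctuation_cvg.
  exact: birth_sum_cvg_in_probability.
Unshelve. all: by end_near.
Qed.
End edge_sums.

(** * Empirical averages *)

(** Scalings and finite sums of measures pass through integrals of nonnegative functions, so [g] is
    split into its positive and negative parts. For the empty list both sides are 0. *)
Lemma Rintegral_empirical (R : realType) (l : seq R) (D : set R) (g : R -> R) :
  measurable D -> measurable_fun D g -> (forall r, r \in l -> D r) ->
  \int[mscale ((size l)%:R^-1)%:nng (msum (fun k => \d_(l`_k)) (size l))]_(r in D) g r =
  (size l)%:R^-1 * \sum_(r <- l) g r.
Proof.
move=> mD mg lD.
set mu := mscale _ _.
have ge0_int (f : R -> R) : measurable_fun D f -> (forall r, 0 <= f r) ->
    (\int[mu]_(r in D) (f r)%:E = ((size l)%:R^-1 * \sum_(r <- l) f r)%:E)%E.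
  move=> mf f0; have mfE : measurable_fun D (fun r => (f r)%:E) by exact/measurable_EFinP.
  have fE0 r : D r -> (0 <= (f r)%:E)%E by rewrite lee_fin.
  rewrite /mu (ge0_integral_mscale _ mD _ mfE fE0) (ge0_integral_measure_sum _ mD fE0 mfE).
  rewrite EFinM /=; apply: (f_equal (fun z => _ * z)%E).
  rewrite (big_nth 0) big_mkord -sumEFin; apply: eq_bigr => k _.
  by rewrite integral_dirac // diracE mem_set ?mul1e //; apply: lD; exact: mem_nth.
rewrite /Rintegral integralE.
have pE : (\int[mu]_(r in D) (EFin \o g)^\+ r = \int[mu]_(r in D) (Num.max (g r) 0)%:E)%E.
  by apply: eq_integral => r _; rewrite funeposE /= EFin_max.
have nE : (\int[mu]_(r in D) (EFin \o g)^\- r = \int[mu]_(r in D) (Num.max (- g r) 0)%:E)%E.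
  by apply: eq_integral => r _; rewrite funenegE /= EFin_max.
rewrite pE nE !ge0_int.
- rewrite -EFinB /= -mulrBr -sumrB; congr (_ * _); apply: eq_bigr => r _.
  by have [h|h] := leP (g r) 0; [rewrite max_l ?oppr_ge0 // ?sub0r ?opprK|rewrite max_r ?subr0 // oppr_le0 ltW].
- by apply: measurable_maxr => //; exact: measurableT_comp.
- by move=> r; rewrite le_max lexx orbT.
- exact: measurable_maxr.
- by move=> r; rewrite le_max lexx orbT.
Qed.

Lemma torus_dist_ge0 (R : realType) (d : nat) (x y : d.-tuple R) : 0 <= torus_dist x y.
Proof.
rewrite /torus_dist.
elim/big_ind : _ => [|a b a0 b0|k _]; [exact: enorm_ge0|by rewrite le_min a0|exact: enorm_ge0].
Qed.

Lemma sum_fset_set (R : realType) (T : choiceType) (E : set T) (r : seq T) (f : T -> R) :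
  uniq r -> E `<=` [set` r] -> \sum_(p <- fset_set E) f p = \sum_(p <- r) \1_E p * f p.
Proof.
move=> ur Er; have fE : finite_set E by exact: sub_finite_set (finite_seq r).
rewrite (perm_big [seq p <- r | p \in E]) /=.
  rewrite big_filter big_mkcond /=; apply: eq_bigr => p _.
  by rewrite indicE; case: ifP; rewrite ?mul1r ?mul0r.
apply: uniq_perm; [exact: fset_uniq|exact: filter_uniq|] => p.
rewrite mem_filter in_fset_set //; case: (boolP (p \in E)) => //= /set_mem /Er.
by move=> /= ->.
Qed.

Section empirical.
Context (R : realType) (d : nat) (gamma beta : R) (phi : R -> R).
Context (dO : measure_display) (Omega : measurableType dO).
Context (P : probability Omega R) (G : age_based_network d gamma beta phi P).

Lemma rescaled_length_ge0 t w p : 0 <= rescaled_length G t w p.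
Proof. by rewrite mulr_ge0 ?powR_ge0 ?torus_dist_ge0. Qed.

Lemma empirical_average_integral (g : R -> R) t w : {within `[0, +oo[, continuous g} ->
  empirical_average G g t w = \int[empirical_measure G t w]_(r in `[0, +oo[) g r.
Proof.
move=> cg; have mD : measurable (`[0, +oo[%classic : set R) by exact: measurable_itv.
rewrite /empirical_measure Rintegral_empirical //.
- by rewrite /rescaled_lengths size_map big_map.
- exact: subspace_continuous_measurable_fun.
- by move=> r /mapP[p _ ->]; rewrite /= in_itv /= andbT rescaled_length_ge0.
Qed.

Lemma eq_empirical_average (g h : R -> R) t w : (forall r, 0 <= r -> g r = h r) ->
  empirical_average G g t w = empirical_average G h t w.
Proof.
by move=> gh; congr (_ * _); apply: eq_bigr => p _; exact: gh (rescaled_length_ge0 _ _ _).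
Qed.

Lemma good_edges_ordered c t N w : good G c w -> t < c * N%:R -> 0 < c ->
  edges G t w `<=` [set` ordered_pairs N].
Proof.
move=> gw tN c0 [i j] [/= /andP[_ it] _ ji _].
have jni : (j < i)%N.
  rewrite ltnNge; apply/negP; rewrite leq_eqVlt => /predU1P[ij|ij].
    by move: ji; rewrite ij ltxx.
  by have := good_birth_lt gw ij; rewrite ltNge (ltW ji).
have iN : (i < N)%N.
  have [_ ge] := gw; have := le_lt_trans (le_trans (ge i) it) tN.
  by rewrite ltr_pM2l // ltr_nat; apply: leq_trans.
have : (i, j) \in ordered_pairs N.
  by apply: allpairs_f_dep; rewrite mem_iota.
by [].
Qed.

(** On the good event the index order is the order of birth, and no vertex of index N or more is
    born by time t. The edges are thus the linked pairs j < i < N whose younger end is born by time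
    t. *)
Lemma good_edge_sum (g : R -> R) c t N w : good G c w -> t < c * N%:R -> 0 < c ->
  \sum_(p <- edge_fset G t w) g (rescaled_length G t w p) =
  \sum_(p <- ordered_pairs N) edge_weight G g t p w.
Proof.
move=> gw tN c0.
rewrite (sum_fset_set _ (ordered_pairs_uniq N) (good_edges_ordered gw tN c0)).
rewrite !big_seq; apply: eq_bigr => p /ordered_pairs_lt plt.
rewrite /edge_weight mulrA; congr (_ * _).
have b12 := good_birth_lt gw plt.
have b1 := good_birth_gt0 p.1 gw; have b2 := good_birth_gt0 p.2 gw.
rewrite !indicE -natrM mulnb; congr (nat_of_bool _)%:R.
apply/idP/andP.
  by move=> /set_mem [/andP[_ h1] _ _ h2]; split => //; exact: mem_set.
move=> [h1 /set_mem h2]; apply/mem_set; split => //; apply/andP; split => //.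
by rewrite (le_trans (ltW b12)).
Qed.

Let square N := [seq (i, j) | i <- iota 0 N, j <- iota 0 N].

Let square_uniq N : uniq (square N).
Proof. by apply: allpairs_uniq; [exact: iota_uniq..|move=> [a b] [a' b'] _ _ /= [-> ->]]. Qed.

Let measurable_edge_event t p : measurable [set w | edges G t w p].
Proof.
have mb n : measurable_fun setT (birth G n : Omega -> R) by [].
have mv n : measurable [set w | vertices G t w n].
  rewrite (_ : mkset _ = setT `&` (birth G n : Omega -> R) @^-1` `]0, t]%classic).
    by apply: mb => //; exact: measurable_itv.
  by rewrite setTI; apply/seteqP; split => w /=; rewrite in_itv.
rewrite (_ : mkset _ = [set w | vertices G t w p.1] `&` [set w | vertices G t w p.2] `&`
    (setT `&` (fun w => birth G p.1 w - birth G p.2 w) @^-1` `]0, +oo[%classic) `&` link G p).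
  apply: measurableI; last exact: link_measurable.
  apply: measurableI; first exact: measurableI.
  have mB : measurable_fun setT (fun w => birth G p.1 w - birth G p.2 w) by exact: measurable_funB.
  by apply: mB => //; exact: measurable_itv.
rewrite setTI; apply/seteqP; split => w /=.
  by move=> [h1 h2 h3 h4]; do 3?split => //; rewrite in_itv /= andbT subr_gt0.
by move=> [[[h1 h2]]]; rewrite in_itv /= andbT subr_gt0 => h3 h4; split.
Qed.

(** Where all edges join vertices of index below N, the average is a quotient of finite measurable
    sums. Outside the union of these events the edge set is infinite, [fset_set] is empty and the
    average is 0. Births need not be ordered here, hence the full square of indices. *)
Lemma measurable_empirical_deviation (g : R -> R) t l e : measurable_fun setT g ->
  measurable [set w | e < `|empirical_average G g t w - l|].
Proof.
move=> mg.
pose F N := [set w | edges G t w `<=` [set` square N]].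
have mF N : measurable (F N).
  rewrite (_ : F N = \bigcap_i \bigcap_j
      (if (i, j) \in square N then setT else ~` [set w | edges G t w (i, j)])).
    apply: bigcapT_measurable => i; apply: bigcapT_measurable => j.
    by case: ifP => // _; exact/measurableC/measurable_edge_event.
  apply/seteqP; split => w /= H.
    move=> i _ j _; case: ifPn => // /negP pN; by move=> /H.
  by move=> [i j] Ep; apply/negPn/negP => /negPf pN; have := H i I j I; rewrite pN.
pose W N (h : R -> R) w := \sum_(p <- square N)
  \1_[set w | edges G t w p] w * h (rescaled_length G t w p).
have mW N h : measurable_fun setT h -> measurable_fun setT (W N h).
  move=> mh; apply: measurable_sum => p; apply: measurable_funM.
    by apply: measurable_indic; exact: measurable_edge_event.
  apply: (measurableT_comp mh); apply: measurable_funM => //.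
  exact: measurable_torus_dist.
have FE N w : F N w -> empirical_average G g t w = (W N (cst 1) w)^-1 * W N g w.
  move=> Fw; have E h := @sum_fset_set R _ _ _ (fun p => h (rescaled_length G t w p)) (square_uniq N) Fw.
  have WE h : W N h w = \sum_(p <- edge_fset G t w) h (rescaled_length G t w p).
    by rewrite E; apply: eq_bigr => p _; rewrite !indicE; congr ((nat_of_bool _)%:R * _); apply/idP/idP => /set_mem ?; exact/mem_set.
  rewrite !WE /empirical_average; congr (_^-1 * _).
  by rewrite big_const_seq count_predT iter_addr_0.
have nF w : ~ (\bigcup_N F N) w -> empirical_average G g t w = 0.
  move=> nw; have E0 : edge_fset G t w = fset0.
    rewrite /edge_fset /fset_set; case: pselect => // fE; exfalso; apply: nw.
    exists (\sum_(p <- fset_set (edges G t w)) (p.1 + p.2)).+1 => // p Ep.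
    have pE : p \in fset_set (edges G t w) by rewrite in_fset_set //; exact: mem_set.
    have : (p.1 + p.2 <= \sum_(p <- fset_set (edges G t w)) (p.1 + p.2))%N.
      by rewrite (bigD1_seq p) ?fset_uniq //= leq_addr.
    move=> ps; apply/allpairsP; exists p; rewrite !mem_iota /= add0n !ltnS.
    by rewrite (leq_trans (leq_addr _ _) ps) (leq_trans (leq_addl _ _) ps) -surjective_pairing.
  by rewrite /empirical_average E0 big_seq_fset0 mulr0.
pose B N := [set w | e < `|(W N (cst 1) w)^-1 * W N g w - l|].
have mB N : measurable (B N).
  apply: measurable_norm_gt; apply: measurable_funB => //; apply: measurable_funM.
    by apply: (measurableT_comp (@measurable_invr R)); apply: mW.
  exact: mW.
have mU : measurable (\bigcup_N F N) by exact: bigcupT_measurable.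
rewrite (_ : mkset _ = (\bigcup_N (F N `&` B N)) `|`
    (~` (\bigcup_N F N) `&` [set w | e < `|0 - l|])).
  apply: measurableU; first by apply: bigcupT_measurable => N; exact: measurableI.
  apply: measurableI; first exact: measurableC.
  have [el|el] := pselect (e < `|0 - l|).
    by rewrite (_ : mkset _ = setT) //; apply/seteqP; split.
  by rewrite (_ : mkset _ = set0) //; apply/seteqP; split.
apply/seteqP; split => w /=.
  move=> ew; have [[N _ Fw]|nw] := pselect ((\bigcup_N F N) w).
    by left; exists N => //; split => //; rewrite /B /= -FE.
  by right; split => //; rewrite -(nF w nw).
move=> [[N _ [Fw]]|[nw]]; first by rewrite /B /= -(FE N).
by rewrite (nF w nw).
Qed.
End empirical.

(** * Convergence in probability of the empirical averages *)

Lemma ratio_continuity (R : realType) (A B e : R) : 0 <= A -> 0 < B -> 0 < e ->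
  exists2 delta, 0 < delta & forall a b, `|a - A| <= delta -> `|b - B| <= delta ->
    0 < b /\ `|a / b - A / B| <= e.
Proof.
move=> A0 B0 e0; have AB0 : 0 < A + B by exact: ltr_wpDl.
(* The first bound keeps b above B / 2; the second, multiplied by (A + B) / (B^2 / 2), equals e. *)
exists (Num.min (B / 2) (e * B ^+ 2 / (2 * (A + B)))).
  by rewrite lt_min !divr_gt0 ?mulr_gt0 ?exprn_gt0.
move=> a b; rewrite !le_min => /andP[_ a2] /andP[b1 b2].
have b0 : B / 2 <= b by move: b1; rewrite ler_distl => /andP[h _]; lra.
have b_gt0 : 0 < b by apply: lt_le_trans b0; rewrite divr_gt0.
split => //.
have -> : a / b - A / B = ((a - A) * B - A * (b - B)) / (b * B).
  by field; rewrite !gt_eqF.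
rewrite normrM normfV [X in _ / X]gtr0_norm ?mulr_gt0 // ler_pdivrMr ?mulr_gt0 //.
apply: (le_trans (ler_normB _ _)); rewrite !normrM (gtr0_norm B0) (ger0_norm A0).
move: a2 b2; set D := e * B ^+ 2 / (2 * (A + B)) => a2 b2.
apply: (@le_trans _ _ (D * (A + B))).
  by rewrite mulrDr addrC [D * A]mulrC lerD // ?ler_wpM2l // ler_wpM2r // ltW.
rewrite (_ : D * (A + B) = e * (B / 2 * B)); last by rewrite /D; field; rewrite gt_eqF.
by rewrite ler_wpM2l ?(ltW e0) // ler_wpM2r // ltW.
Qed.

(** The scale m is fixed first, making [q m] small, and k is sent to infinity afterwards. In the
    application m indexes the constant of the good event and k the time. *)
Lemma cvg0_of_two_scales (R : realType) (p q : nat -> R) (r : nat -> nat -> R) :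
  (forall k, 0 <= p k) -> (forall m k, p k <= q m + r m k) ->
  q m @[m --> \oo] --> 0 -> (forall m, r m k @[k --> \oo] --> 0) ->
  p k @[k --> \oo] --> 0.
Proof.
move=> p0 pqr q0 r0; apply/cvgrPdist_lt => e e0.
have e20 : 0 < e / 2 by rewrite divr_gt0.
have [m _ Hm] : \forall m \near \oo, `|0 - q m| < e / 2 by move/cvgrPdist_lt : q0; apply.
have {}Hm := Hm m (leqnn m); rewrite /= sub0r normrN in Hm.
have : \forall k \near \oo, `|0 - r m k| < e / 2 by have /cvgrPdist_lt := r0 m; apply.
apply: filterS => k; rewrite !sub0r !normrN (ger0_norm (p0 k)) => hr.
apply: (le_lt_trans (pqr m k)); rewrite (splitr e); apply: ltrD.
  exact: le_lt_trans (ler_norm _) Hm.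
exact: le_lt_trans (ler_norm _) hr.
Qed.

Lemma cvg_fine0 (R : realType) (u : nat -> \bar R) :
  u k @[k --> \oo] --> 0%E -> fine (u k) @[k --> \oo] --> (0 : R).
Proof. exact: fine_cvg. Qed.

Section convergence.
Context (R : realType) (d : nat) (gamma beta : R) (phi : R -> R).
Hypotheses (d0 : (0 < d)%N) (gammaP : 0 < gamma < 1) (beta0 : 0 < beta) (phiP : profile d phi).

Definition edge_functional (g : R -> R) : R := fine (\int[@lebesgue_triple R d]_z
  ((limit_density gamma phi beta^-1 1 z)%:E * (g (enorm z.2.2))%:E))%E.

Lemma edge_functional1 : edge_functional (cst 1) = beta / (1 - gamma).
Proof.
have /andP[gamma0 gamma1] := gammaP.
rewrite /edge_functional; under eq_integral do rewrite mule1.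
rewrite mass_limit_density ?invr_gt0 //= mul1r invfM invrK //.
Qed.

Context (dO : measure_display) (Omega : measurableType dO).
Context (P : probability Omega R) (G : age_based_network d gamma beta phi P).

Lemma good_cvg : P (~` good G m.+1%:R^-1) @[m --> \oo] --> 0%E.
Proof.
apply: eventually_outside_probability0.
  by move=> m; apply: measurableC; exact: measurable_good.
apply: filterS (births_strong_law G) => w [gap0 H].
have [m [_ gm]] := good_exists gap0 H.
(* Smaller constants give larger good events, so membership persists for all later indices. *)
exists m => // n /= mn; apply; split => // i; apply: le_trans (gm i).
by rewrite ler_wpM2r // lef_pV2 ?posrE ?ltr0n // ler_nat.
Qed.

(** [h] is the test function raised by M to make it nonnegative; subtracting M inside the average
    shifts the ratio by M as soon as there is an edge. *)
Lemma empirical_average_cvg (h : R -> R) (K M : R) (t : nat -> R) e :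
  measurable_fun setT h -> (forall r, 0 <= h r <= K) ->
  (forall k, 1 <= t k) -> t k @[k --> \oo] --> +oo -> 0 < e ->
  fine (P [set w | (e < `|empirical_average G (fun r => h r - M) (t k) w -
    (edge_functional h / edge_functional (cst 1) - M)|)%R]) @[k --> \oo] --> (0 : R).
Proof.
move=> mh hK t1 toy e0.
have t0 k : 0 < t k by exact: lt_le_trans (t1 k).
have A0 : 0 <= edge_functional h.
  apply: fine_ge0; apply: integral_ge0 => z _.
  apply: mule_ge0; rewrite lee_fin; last by have /andP[] := hK (enorm z.2.2).
  exact: limit_density_ge0.
have B0 : 0 < edge_functional (cst 1).
  rewrite edge_functional1 divr_gt0 // subr_gt0; by have /andP[] := gammaP.
have [del del0 Hdel] := ratio_continuity A0 B0 e0.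
pose c (m : nat) : R := m.+1%:R^-1.
have c0 m : 0 < c m by rewrite invr_gt0.
(* Truncation plus one gives the strict bound t < c N together with c N <= t + c. *)
pose N m k := (Num.truncn (t k / c m)).+1.
have tN m k : t k < c m * (N m k)%:R.
  by rewrite mulrC -ltr_pdivrMr // truncnS_gt.
have Nt m k : c m * (N m k)%:R <= t k + c m.
  rewrite -natr1 mulrDr mulr1 lerD2r mulrC -ler_pdivlMr //.
  by rewrite truncn_le // divr_ge0 // ltW.
pose S (g : R -> R) m k w := \sum_(p <- ordered_pairs (N m k)) edge_weight G g (t k) p w.
pose U (g : R -> R) m k := [set w | (del < `|\1_(good G (c m)) w * (S g m k w / t k - edge_functional g)|)%R].
have mcst : measurable_fun setT (cst 1 : R -> R) by exact: measurable_cst.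
have cst1 r : 0 <= (cst 1 : R -> R) r <= 1 by rewrite /= ler01 lexx.
have mU (g : R -> R) m k : measurable_fun setT g -> (forall r, 0 <= g r) -> measurable (U g m k).
  move=> mg g0; apply: measurable_norm_gt; apply: measurable_funM.
    by apply: measurable_indic; exact: measurable_good.
  apply: measurable_funB => //; apply: measurable_funM => //.
  by apply: measurable_sum => p; exact: (measurable_edge_weight G mg).
have one0 (r : R) : 0 <= (cst 1 : R -> R) r by [].
have h0 r : 0 <= h r by have /andP[] := hK r.
pose E k := [set w | (e < `|empirical_average G (fun r => h r - M) (t k) w -
    (edge_functional h / edge_functional (cst 1) - M)|)%R].
have mE k : measurable (E k) by apply: measurable_empirical_deviation; exact: measurable_funB.
have sub m k : E k `<=` ~` good G (c m) `|` (U h m k `|` U (cst 1) m k).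
  move=> w Ew; have [gw|] := pselect (good G (c m) w); last by left.
  right; apply: contrapT => /not_orP[/negP nh /negP n1]; move: Ew; apply/negP.
  rewrite -!leNgt indicE mem_set // !mul1r /S -!(good_edge_sum _ gw (tN m k) (c0 m)) in nh n1 *.
  have [b0 ab] := Hdel _ _ nh n1.
  have -> : empirical_average G (fun r => h r - M) (t k) w =
      ((\sum_(p <- edge_fset G (t k) w) h (rescaled_length G (t k) w p)) / t k) /
      ((\sum_(p <- edge_fset G (t k) w) cst 1 (rescaled_length G (t k) w p)) / t k) - M.
    rewrite /empirical_average sumrB.
    set n : R := #|` edge_fset G (t k) w|%:R.
    move: b0; rewrite /=; set s := \sum_(p <- edge_fset G (t k) w) h (rescaled_length G (t k) w p).
    have cardE (a : R) : \sum_(p <- edge_fset G (t k) w) a = a * n.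
      by rewrite big_const_seq count_predT iter_addr_0 mulr_natr.
    rewrite !cardE mul1r => b0.
    (* The edge count over t is close to a positive limit, so the graph has an edge and the quotient
       is a genuine average. *)
    have n0 : 0 < n by rewrite pmulr_lgt0 ?invr_gt0 // in b0.
    clearbody n s; have T0 := t0 k.
    by field; rewrite !gt_eqF.
  by rewrite opprD opprK addrACA [- M + M]addrC subrr addr0.
have mg m := measurable_good G (c m).
have mUU m k : measurable (U h m k `|` U (cst 1) m k).
  by apply: measurableU; apply: mU.
apply: (@cvg0_of_two_scales _ _ (fun m => fine (P (~` good G (c m))))
  (fun m k => fine (P (U h m k)) + fine (P (U (cst 1) m k)))).
- by move=> k; exact: fine_ge0.
- move=> m k; rewrite -!fineD ?fin_num_measure //; try by [exact: measurableC|exact: mU].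
    apply: fine_le; rewrite ?fin_numD ?fin_num_measure //; try by [exact: measurableC|exact: mU|exact: mE].
    apply: (le_trans (le_measure _ _ _ (sub m k))); rewrite ?inE //.
      by apply: measurableU => //; exact: measurableC.
    apply: (le_trans (measureU2 _ _ _)) => //; first exact: measurableC.
    by apply: leeD2l; apply: measureU2; exact: mU.
  by rewrite fin_numD !fin_num_measure //; exact: mU.
- by apply: cvg_fine0; exact: good_cvg.
- move=> m; rewrite -[X in _ --> X]addr0.
  apply: cvgD; apply: cvg_fine0.
    exact: (edge_sum_cvg_in_probability d0 gammaP beta0 phiP G mh hK (c0 m) t1 toy (tN m) (Nt m) del0).
  exact: (edge_sum_cvg_in_probability d0 gammaP beta0 phiP G mcst cst1 (c0 m) t1 toy (tN m) (Nt m) del0).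
Qed.
End convergence.

Lemma edge_law_functional (R : realType) (d : nat) (gamma beta : R) (phi : R -> R)
    (lambda : probability R R) (g : R -> R) (M : R) :
  (0 < d)%N -> 0 < gamma < 1 -> 0 < beta -> profile d phi ->
  lambda `]0, +oo[%classic = 1%E ->
  (forall G : R -> \bar R, measurable_fun setT G -> (forall r, 0 <= G r)%E ->
    (\int[lambda]_r G r = ((1 - gamma) / beta)%:E * \int[@lebesgue_triple R d]_z
      ((limit_density gamma phi beta^-1 1 z)%:E * G (enorm z.2.2)))%E) ->
  measurable_fun setT g -> (forall r, `|g r| <= M) ->
  \int[lambda]_(r in `[0, +oo[) g r =
  edge_functional d gamma beta phi (fun r => g r + M) /
  edge_functional d gamma beta phi (cst 1) - M.
Proof.
move=> d0 gammaP beta0 phiP l1 lE mg gM; have /andP[gamma0 gamma1] := gammaP.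
have k0 : 0 < (1 - gamma) / beta by rewrite divr_gt0 // subr_gt0.
have bg : bounded_measurable g by split => //; exists M.
have bM : bounded_measurable (cst M : R -> R).
  by split; [exact: measurable_cst|exists `|M|].
have bh : bounded_measurable (fun r => g r + M) by exact: bounded_measurableD.
have hE : \int[lambda]_r (g r + M) = edge_functional d gamma beta phi (fun r => g r + M) /
    edge_functional d gamma beta phi (cst 1).
  have mh : measurable_fun setT (fun r => (g r + M)%:E) by apply/measurable_EFinP; case: bh.
  have h0 r : (0 <= (g r + M)%:E)%E by rewrite lee_fin -lerBlDr sub0r; have := gM r; rewrite ler_norml => /andP[].
  have fin : (\int[lambda]_r (g r + M)%:E)%E \is a fin_num.
    by apply: integrable_fin_num => //; exact: (@bounded_measurable_integrable _ _ _ lambda _ bh).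
  rewrite /Rintegral; move: fin; rewrite lE // /edge_functional -/(edge_functional d gamma beta phi (cst 1)).
  (* The integral against the limit law is finite, which rules out an infinite value hidden by
     [fine]. *)
  rewrite edge_functional1 //; case: (integral _ _ _) => [r _|/=|/=] /=.
  - by field; rewrite !gt_eqF // subr_gt0.
  - by rewrite mulry gtr0_sg // mul1e.
  - by rewrite mulrNy gtr0_sg // mul1e.
rewrite -hE RintegralD //; [|exact: bounded_measurable_integrable..].
rewrite Rintegral_cst // [X in fine X](_ : _ = 1%E) ?mulr1 ?addrK; last exact: probability_setT.
have mD : measurable (`[0, +oo[%classic : set R) by exact: measurable_itv.
have mP : measurable (`]0, +oo[%classic : set R) by exact: measurable_itv.
rewrite /Rintegral integral_mkcond; congr fine; apply: ae_eq_integral => //.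
- by apply/(measurable_restrictT _ mD)/measurable_funTS/measurable_EFinP.
- exact/measurable_EFinP.
(* The limit law is carried by the open half-line, so integrating over [0, +oo[ or over the line is
   the same. *)
exists (~` `]0, +oo[%classic); split; first exact: measurableC.
  by rewrite [LHS]probability_setC // l1 subee.
move=> r /= H r0; apply: H => _; rewrite patchE mem_set //=.
by move: r0; rewrite /= !in_itv /= !andbT; exact: ltW.
Qed.

Theorem theorem6p1 (R : realType) (d : nat) (gamma beta : R) (phi : R -> R) :
  (1 <= d)%N -> 0 < gamma < 1 -> 0 < beta -> profile d phi ->
  exists lambda : probability R R,
    [/\ lambda `]0, +oo[%classic = 1%E,
        forall (a : R) (b : \bar R), 0 <= a -> (a%:E < b)%E ->
          lambda [set r | a <= r /\ (r%:E < b)%E] =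
          limit_mass d gamma beta phi a b &
        forall (dO : measure_display) (Omega : measurableType dO)
          (P : probability Omega R) (G : age_based_network d gamma beta phi P)
          (g : R -> R),
          {within `[0, +oo[, continuous g} ->
          (exists M : R, forall r, 0 <= r -> `|g r| <= M) ->
          (forall (t : R) (w : Omega), 0 < t ->
             empirical_average G g t w =
             \int[empirical_measure G t w]_(r in `[0, +oo[) g r) /\
          cvg_in_probability P
            (fun t w => \int[empirical_measure G t w]_(r in `[0, +oo[) g r)
            (\int[lambda]_(r in `[0, +oo[) g r)].
Proof.
move=> d0 gammaP beta0 phiP.
have [lambda [l1 l2 l3]] := edge_law_exists d0 gammaP beta0 phiP.
exists lambda; split => // dO Omega P G g cg [M0 gM0].
have avgE t w := empirical_average_integral G t w cg.
split; first by move=> t w _; exact: avgE.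
move=> e e0.
pose M := Num.max M0 0.
(* [g] is controlled on the closed half-line only; extending it by the constant g 0 makes it bounded
   and measurable on the line without affecting any edge length. *)
pose g' r := g (Num.max r 0).
have g'E r : 0 <= r -> g r = g' r by move=> r0; rewrite /g' max_l.
have g'M r : `|g' r| <= M.
  by rewrite (le_trans (gM0 _ _)) ?le_max ?lexx ?orbT.
have mg' : measurable_fun setT g'.
  have mD : measurable (`[0, +oo[%classic : set R) by exact: measurable_itv.
  rewrite (_ : g' = g \o (fun r => Num.max r 0)) //.
  apply: (measurable_comp mD).
  - by move=> _ [r _ <-]; rewrite /= in_itv /= andbT le_max lexx orbT.
  - exact: subspace_continuous_measurable_fun.
  - by apply: measurable_maxr => //; exact: measurable_id.
have lE : \int[lambda]_(r in `[0, +oo[) g r = edge_functional d gamma beta phi (fun r => g' r + M) /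
    edge_functional d gamma beta phi (cst 1) - M.
  rewrite -(edge_law_functional d0 gammaP beta0 phiP l1 l3 mg' g'M).
  by apply: eq_Rintegral => r /set_mem; rewrite /= in_itv /= andbT => /g'E.
have bh r : 0 <= g' r + M <= M + M.
  by have := g'M r; rewrite ler_norml => /andP[h1 h2]; rewrite lerD2r h2 -lerBlDr sub0r h1.
have mh : measurable_fun setT (fun r => g' r + M) by exact: measurable_funD.
rewrite (_ : (fun t => _) = (fun t => (fine (P [set w | (e <
    `|empirical_average G (fun r => g' r + M - M) t w - (edge_functional d gamma beta phi (fun r => g' r + M) /
    edge_functional d gamma beta phi (cst 1) - M)|)%R]))%:E)); last first.
  apply/funext => t; rewrite fineK ?fin_num_measure //; last first.
    by apply: measurable_empirical_deviation; exact: measurable_funB.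
  rewrite -lE; congr (P _); apply/seteqP; split => w /=; rewrite -avgE (@eq_empirical_average _ _ _ _ _ _ _ _ G g (fun r => g' r + M - M)) // => r r0;
    by rewrite addrK g'E.
apply: cvg_EFin; first by near=> t.
(* The limit along real times is tested on sequences tending to infinity; replacing u by max 1 u
   ensures times of at least 1 and changes finitely many terms. *)
apply/cvg_pinftyP => u uy /=.
have := @empirical_average_cvg R d gamma beta phi d0 gammaP beta0 phiP dO Omega P G
  (fun r => g' r + M) (M + M) M (fun k => Num.max 1 (u k)) e mh bh _ _ e0.
have u1 k : 1 <= Num.max 1 (u k) by rewrite le_max lexx.
have uy1 : Num.max 1 (u k) @[k --> \oo] --> +oo.
  apply/cvgryPge => B; have /cvgryPge /(_ B) := uy; apply: filterS => k Bu.
  by rewrite le_max Bu orbT.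
move=> /(_ u1 uy1); apply: cvg_trans; apply: near_eq_cvg.
have /cvgryPge /(_ 1) := uy; apply: filterS => k /= uk.
by rewrite max_r.
Unshelve. all: by end_near.
Qed.
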